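(* Let $L$ be a cylindrical Lévy process in $U$, let $T>0$, and let $(S,\mathcal{S},\eta)$ be a finite measure space. Let $g\colon S\times[0,T]\to U$ be a function such that (a) $g$ is $\mathcal{S}\otimes\mathcal{B}([0,T])$-measurable; (b) the map $t\mapsto g(s,t)$ is regulated for $\eta$-almost all $s\in S$; (c) the map $t\mapsto g(\cdot,t)$ belongs to $R([0,T];L^2_\eta(S;U))$. Then all integrals below are well defined, namely: (1) the map $t\mapsto\int_S g(s,t)\,\eta(\mathrm{d}s)$ (Bochner integral) belongs to $R([0,T];U)$; (2) the process $\big(\int_0^T g(s,t)\,\mathrm{d}L(t):\ s\in S\big)$ defines a random variable with values in $L^2_\eta(S;\mathbb{R})$ (i.e. it has an $\mathcal{S}\otimes\mathcal{F}$-measurable version whose paths $s\mapsto\int_0^Tg(s,t)\,\mathrm{d}L(t)$ lie in $L^2_\eta(S;\mathbb R)$ almost surely); and $P$-almost surely $$\int_S\int_0^T g(s,t)\,\mathrm{d}L(t)\,\eta(\mathrm{d}s)=\int_0^T\int_S g(s,t)\,\eta(\mathrm{d}s)\,\mathrm{d}L(t).$$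
   Context: Let $(\Omega,\mathcal F,P)$ be a probability space and $U,V$ separable real Hilbert spaces (identified with their duals) with orthonormal bases $(e_k)_{k\in\mathbb N}$ of $U$ and $(h_k)_{k\in\mathbb N}$ of $V$. $L^0_P(\Omega;\mathbb R)$ denotes the space of (classes of) real random variables with convergence in probability. A cylindrical random variable in $U$ is a linear continuous map $Z\colon U\to L^0_P(\Omega;\mathbb R)$. A cylindrical Lévy process $L=(L(t))_{t\ge0}$ in $U$ is a family of cylindrical random variables such that for all $n\in\mathbb N$ and $u_1,\dots,u_n\in U$ the process $((L(t)u_1,\dots,L(t)u_n))_{t\ge0}$ is a Lévy process in $\mathbb R^n$. Then $E[\exp(iL(t)u)]=\exp(t\Psi(u))$ with $\Psi(u)=ia(u)-\tfrac12\langle Qu,u\rangle+\int_U(e^{i\langle u,h\rangle}-1-i\langle u,h\rangle\mathbb 1_{[-1,1]}(\langle u,h\rangle))\,\mu(\mathrm dh)$, where $a\colon U\to\mathbb R$ is continuous with $a(0)=0$, $Q$ is a positive symmetric bounded operator on $U$, and $\mu$ is a cylindrical measure on the algebra of cylindrical sets of $U$ with $\int_U(\langle u,h\rangle^2\wedge1)\mu(\mathrm dh)<\infty$ for all $u$; $(a,Q,\mu)$ are the (cylindrical) characteristics and $\Psi$ the symbol of $L$. A function $g\colon[0,T]\to X$ ($X$ a Banach space) is regulated if it has only discontinuities of the first kind; $R([0,T];X)$ is the Banach space of regulated functions with the supremum norm. For $g\in R([0,T];U)$ the real random variable $\int_0^T g(t)\,\mathrm dL(t)$ is defined for step functions $g=\sum_k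 u_k\mathbb 1_{(t_k,t_{k+1}]}$ by $\sum_k (L(t_{k+1})-L(t_k))u_k$ and in general as the limit in probability of such integrals along step functions converging uniformly to $g$; for Borel $A\subseteq[0,T]$ one sets $\int_A g\,\mathrm dL:=\int_0^T\mathbb 1_A g\,\mathrm dL$ (this is well defined). $L^2_\eta(S;U)$ is the Bochner space of square integrable $U$-valued functions. *)

(* Defs.v *)
From HB Require Import structures.
From mathcomp Require Import all_boot all_order all_algebra.
From mathcomp Require Import all_classical all_reals all_analysis.
Set Implicit Arguments. Unset Strict Implicit. Unset Printing Implicit Defensive.
Import Order.TTheory GRing.Theory Num.Theory.
Import numFieldNormedType.Exports.
Local Open Scope classical_set_scope.
Local Open Scope ring_scope.

Section Defs.
Context {R : realType}.

Definition hilbert_onb (U : normedModType R) (ip : U -> U -> R) (e : nat -> U) : Prop :=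
  [/\ (forall u v, ip u v = ip v u),
      (forall a u v w, ip (a *: u + v) w = a * ip u w + ip v w),
      (forall u, ip u u = `|u| ^+ 2),
      (forall i j, ip (e i) (e j) = (i == j)%:R) &
      (forall u, (forall k, ip u (e k) = 0) -> u = 0)].

Definition regulated (V : normedModType R) (T : R) (f : R -> V) : Prop :=
  (forall t, 0 <= t < T -> exists l : V, f @ t^'+ --> l) /\
  (forall t, 0 < t <= T -> exists l : V, f @ t^'- --> l).

Section Bochner.
Context {d : measure_display} {S : measurableType d} {U : normedModType R}.
Variable mu : {measure set S -> \bar R}.

Definition simple_eval (r : seq (U * set S)) (s : S) : U :=
  \sum_(p <- r) (if s \in p.2 then p.1 else 0).
Definition simple_integral (r : seq (U * set S)) : U :=
  \sum_(p <- r) (fine (mu p.2) *: p.1).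
Definition simple_meas (r : seq (U * set S)) : Prop :=
  forall p, p \in r -> measurable p.2.

Definition strongly_measurable (f : S -> U) : Prop :=
  exists r : nat -> seq (U * set S), (forall n, simple_meas (r n)) /\
    {ae mu, forall s, simple_eval (r n) s @[n --> \oo] --> f s}.

Definition bochner_integral (f : S -> U) (v : U) : Prop :=
  exists r : nat -> seq (U * set S), [/\ (forall n, simple_meas (r n)),
    {ae mu, forall s, simple_eval (r n) s @[n --> \oo] --> f s},
    (\int[mu]_s (`|simple_eval (r n) s - f s|)%:E)%E @[n --> \oo] --> 0%E &
    simple_integral (r n) @[n --> \oo] --> v].

Definition L2U (f : S -> U) : Prop :=
  strongly_measurable f /\ (\int[mu]_s ((`|f s| ^+ 2)%:E) < +oo)%E.
End Bochner.

Definition L2R {d : measure_display} {S : measurableType d}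
  (mu : {measure set S -> \bar R}) (f : S -> R) : Prop :=
  measurable_fun setT f /\ (\int[mu]_s ((f s ^+ 2)%:E) < +oo)%E.

Definition L2_regulated {d : measure_display} {S : measurableType d}
  {U : normedModType R} (mu : {measure set S -> \bar R}) (T : R) (g : S -> R -> U) : Prop :=
  [/\ (forall t, 0 <= t <= T -> L2U mu (fun s => g s t)),
      (forall t, 0 <= t < T -> exists h, L2U mu h /\
         (fun r => (\int[mu]_s ((`|g s r - h s| ^+ 2)%:E))%E) @ t^'+ --> 0%E) &
      (forall t, 0 < t <= T -> exists h, L2U mu h /\
         (fun r => (\int[mu]_s ((`|g s r - h s| ^+ 2)%:E))%E) @ t^'- --> 0%E)].

Definition jointly_measurable {d : measure_display} {S : measurableType d}
  {U : normedModType R} (T : R) (g : S -> R -> U) : Prop :=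
  forall O : set U, open O ->
    measurable ((setT `*` `[0, T]) `&` ((fun p : S * R => g p.1 p.2) @^-1` O)).

Section Proba.
Context {d : measure_display} {Om : measurableType d} (P : probability Om R).

Definition cvg_in_prob (Y : nat -> Om -> R) (X : Om -> R) : Prop :=
  forall e : R, 0 < e ->
    P [set w | e < `|Y n w - X w|] @[n --> \oo] --> 0%E.

Definition levy_Rn (n : nat) (X : R -> Om -> 'I_n -> R) : Prop :=
  [/\ (forall t i, 0 <= t -> measurable_fun setT (fun w => X t w i)),
      {ae P, forall w, forall i, X 0 w i = 0},
      (* independent increments: for 0 <= t_0 < ... < t_m, the increments
         X(t_{j+1}) - X(t_j) are independent random vectors (product rule on
         the generating pi-system of Borel rectangles) *)
      (forall (m : nat) (t : nat -> R), 0 <= t 0 ->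
         (forall j, (j < m)%N -> t j < t j.+1) ->
         forall B : 'I_m -> 'I_n -> set R, (forall j i, measurable (B j i)) ->
         fine (P [set w | forall j i, B j i (X (t j.+1) w i - X (t j) w i)]) =
         \prod_(j < m) fine (P [set w | forall i, B j i (X (t j.+1) w i - X (t j) w i)])),
      (forall s t, 0 <= s <= t -> forall B : 'I_n -> set R,
         (forall i, measurable (B i)) ->
         P [set w | forall i, B i (X t w i - X s w i)] =
         P [set w | forall i, B i (X (t - s) w i)]) &
      (forall t, 0 <= t -> forall e : R, 0 < e ->
         (fun r => P [set w | exists i, e < `|X r w i - X t w i|])
           @ (within (fun r => 0 <= r) (nbhs t)) --> 0%E)].

(* a cylindrical Levy process in U: L t u is (a representative of) the
   real random variable L(t)u *)
Definition cyl_levy {U : normedModType R} (L : R -> U -> Om -> R) : Prop :=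
  [/\ (forall t u, 0 <= t -> measurable_fun setT (L t u)),
      (forall t a b u v, 0 <= t -> {ae P, forall w,
          L t (a *: u + b *: v) w = a * L t u w + b * L t v w}),
      (* L(t) : U -> L^0 is continuous (sequentially; both spaces metrizable) *)
      (forall t (u : nat -> U) (u0 : U), 0 <= t -> u n @[n --> \oo] --> u0 ->
          cvg_in_prob (fun n => L t (u n)) (L t u0)) &
      (forall n (us : 'I_n -> U), levy_Rn (fun t w i => L t (us i) w))].

(* step functions on [0,T]:  sum_k u_k 1_{(a_k,b_k]} + sum_j v_j 1_{{c_j}} *)
Record stepfun (U : normedModType R) := StepFun {
  st_itv : seq (U * R * R);
  st_pts : seq (U * R) }.

Definition step_eval {U : normedModType R} (phi : stepfun U) (t : R) : U :=
  \sum_(p <- st_itv phi) (if (p.1.2 < t) && (t <= p.2) then p.1.1 else 0) +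
  \sum_(q <- st_pts phi) (if t == q.2 then q.1 else 0).

Definition step_admissible {U : normedModType R} (T : R) (phi : stepfun U) : Prop :=
  (forall p, p \in st_itv phi -> 0 <= p.1.2 <= p.2 /\ p.2 <= T) /\
  (forall q, q \in st_pts phi -> 0 <= q.2 <= T).

Definition step_int {U : normedModType R} (L : R -> U -> Om -> R)
  (phi : stepfun U) (w : Om) : R :=
  \sum_(p <- st_itv phi) (L p.2 p.1.1 w - L p.1.2 p.1.1 w).

Definition stoch_int {U : normedModType R} (L : R -> U -> Om -> R) (T : R)
  (f : R -> U) (X : Om -> R) : Prop :=
  measurable_fun setT X /\
  forall phi : nat -> stepfun U, (forall n, step_admissible T (phi n)) ->
    (forall e : R, 0 < e -> \forall n \near \oo,
        forall t, 0 <= t <= T -> `|step_eval (phi n) t - f t| < e) ->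
    cvg_in_prob (fun n => step_int L (phi n)) X.
End Proba.

Definition meas_version {dS dO : measure_display} {S : measurableType dS}
  {Om : measurableType dO} {U : normedModType R} (mu : {measure set S -> \bar R})
  (P : probability Om R) (L : R -> U -> Om -> R) (T : R) (g : S -> R -> U)
  (Y : S -> Om -> R) : Prop :=
  measurable_fun setT (fun p : S * Om => Y p.1 p.2) /\
  {ae mu, forall s, stoch_int P L T (g s) (Y s)}.

End Defs.

(* Main.v *)
Require Import Defs.
From HB Require Import structures.
From mathcomp Require Import all_boot all_order all_algebra.
From mathcomp Require Import all_classical all_reals all_analysis.
From mathcomp Require Import measurable_realfun ring lra.
Set Implicit Arguments. Unset Strict Implicit. Unset Printing Implicit Defensive.
Import Order.TTheory GRing.Theory Num.Theory.
Import numFieldNormedType.Exports.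
Local Open Scope classical_set_scope.
Local Open Scope ring_scope.

(* For each e > 0 there is C with 1 - Re chi + |Im chi| <= (t - s)(e + C |u|^2), chi being the
   characteristic function of (L(t) - L(s))u at 1. By independence of the increments and
   the truncation inequality, P(|int phi dL| > a) <= e + C int_0^T |phi|^2 dt for all step
   functions phi. Rademacher signs upgrade this to square functions, hence, for integrands
   G(s,t) that are finite sums of 1_A(s) 1_(a,b](t) u, to
   P(int_S (int G(s,.) dL)^2 d eta > a) <= e + C int_S int_0^T |G|^2 dt d eta.
   The integrand g is an L^2(S x [0,T]) limit of such G_n, chosen so that, almost surely, the
   pathwise integrals of G_n are Cauchy in L^2(S) at a geometric rate. For G_n the exchange of
   integrals is linearity of L, and it passes to the limit; the limit is identified, for almost
   all s and for the integral over S, by the energy bound applied to uniform step approximations. *)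

(** * Expectations of bounded random variables *)

(** The increments of [L] may lack moments, so no isometry controls the integrals and all estimates
    are in probability. The summand [e] is the price: at small [u] the characteristic function is
    controlled by continuity alone, which comes without a rate, and growth like [|u|^2] appears only
    on enlarging [u]. The L^2(S) norm of a path is not linear in [L], so a bound for one step
    function says nothing about it directly; a signed sum of step functions is again a step
    function, which is why random signs enter. Two kinds of approximation have to be reconciled. The
    stochastic integral is defined through uniform approximation in t, whereas for fixed s the paths
    g(s, .) are only approximated in L^2(dt). The energy controls both. Linearity of L(t) holds
    outside a null set that depends on the vectors involved, hence exact identities are proved for
    simple integrands, where finitely many vectors occur. Joint measurability in (s, w) is kept
    throughout, since it alone turns a statement valid for almost all s, almost surely, into one
    valid almost surely, for almost all s. *)

Section BoundedMeasurable.
Context (R : realType) (d : measure_display) (Om : measurableType d)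
  (P : probability Om R).
Implicit Types f g H X Y : Om -> R.

(** Closed under sums and products and contained in L^1(P), so that the linearity of the expectation
    needs only this one side condition. *)
Definition bdd_meas f := measurable_fun setT f /\ exists M : R, forall w, `|f w| <= M.

Lemma bdd_meas_int f : bdd_meas f -> P.-integrable setT (EFin \o f).
Proof.
move=> [mf [M fM]]; apply: measurable_bounded_integrable => //.
  by rewrite (le_lt_trans (probability_le1 P measurableT))// ltry.
exists M; split; first exact: num_real.
by move=> N MN w _; apply: le_trans (fM w) (ltW MN).
Qed.

Lemma bdd_meas_cst r : bdd_meas (fun=> r).
Proof. by split; [exact: measurable_cst|exists `|r|]. Qed.

Lemma bdd_measD f g : bdd_meas f -> bdd_meas g -> bdd_meas (fun w => f w + g w).
Proof.
move=> [mf [M fM]] [mg [N gN]]; split; first exact: measurable_funD.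
by exists (M + N) => w; rewrite (le_trans (ler_normD _ _))// lerD.
Qed.

Lemma bdd_measM f g : bdd_meas f -> bdd_meas g -> bdd_meas (fun w => f w * g w).
Proof.
move=> [mf [M fM]] [mg [N gN]]; split; first exact: measurable_funM.
by exists (M * N) => w; rewrite normrM ler_pM.
Qed.

Lemma bdd_measN f : bdd_meas f -> bdd_meas (fun w => - f w).
Proof.
move=> [mf [M fM]]; split; last by exists M => w; rewrite normrN.
exact: measurableT_comp.
Qed.

Lemma bdd_measB f g : bdd_meas f -> bdd_meas g -> bdd_meas (fun w => f w - g w).
Proof. by move=> bf bg; apply: bdd_measD => //; exact: bdd_measN. Qed.

Lemma bdd_meas_indic (A : set Om) : measurable A -> bdd_meas (\1_A).
Proof.
move=> mA; split; first exact: measurable_indic.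
by exists 1 => w; rewrite indicE normr_nat lern1; case: (_ \in _).
Qed.

Lemma bdd_meas_comp (h : R -> R) X : measurable_fun setT h ->
  (forall x, `|h x| <= 1) -> measurable_fun setT X -> bdd_meas (fun w => h (X w)).
Proof.
move=> mh h1 mX; split; last by exists 1.
exact: measurableT_comp.
Qed.

Lemma measurable_cosT : measurable_fun setT (@cos R).
Proof. by apply: continuous_measurable_fun; exact: continuous_cos. Qed.

Lemma measurable_sinT : measurable_fun setT (@sin R).
Proof. by apply: continuous_measurable_fun; exact: continuous_sin. Qed.

Lemma normr_cos_le1 (x : R) : `|cos x| <= 1.
Proof. by rewrite ler_norml cos_geN1 cos_le1. Qed.

Lemma normr_sin_le1 (x : R) : `|sin x| <= 1.
Proof. by rewrite ler_norml sin_geN1 sin_le1. Qed.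

Lemma bdd_meas_cos X : measurable_fun setT X -> bdd_meas (fun w => cos (X w)).
Proof. exact: (bdd_meas_comp measurable_cosT normr_cos_le1). Qed.

Lemma bdd_meas_sin X : measurable_fun setT X -> bdd_meas (fun w => sin (X w)).
Proof. exact: (bdd_meas_comp measurable_sinT normr_sin_le1). Qed.

Local Notation E f := (\int[P]_w f w).

Lemma ED f g : bdd_meas f -> bdd_meas g ->
  E (fun w => f w + g w) = E f + E g.
Proof. by move=> bf bg; rewrite RintegralD//; exact: bdd_meas_int. Qed.

Lemma EB f g : bdd_meas f -> bdd_meas g ->
  E (fun w => f w - g w) = E f - E g.
Proof. by move=> bf bg; rewrite RintegralB//; exact: bdd_meas_int. Qed.

Lemma EZ r f : bdd_meas f -> E (fun w => r * f w) = r * E f.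
Proof. by move=> bf; rewrite RintegralZl//; exact: bdd_meas_int. Qed.

Lemma Ecst r : E (fun=> r) = r.
Proof. rewrite /Rintegral.
rewrite (integral_cst P measurableT r%:E).
transitivity (fine (r%:E * 1)%E); last by rewrite mule1.
by congr (fine (_ * _)); exact: probability_setT. Qed.

Lemma Eindic (A : set Om) : measurable A -> E (\1_A) = fine (P A).
Proof. by move=> mA; rewrite /Rintegral integral_indic// setIT. Qed.

Lemma Ele f g : bdd_meas f -> bdd_meas g -> (forall w, f w <= g w) -> E f <= E g.
Proof. by move=> bf bg fg; apply: le_Rintegral => //; exact: bdd_meas_int. Qed.

Lemma Enorm f : bdd_meas f -> `|E f| <= E (fun w => `|f w|).
Proof. by move=> bf; apply: le_normr_Rintegral => //; exact: bdd_meas_int. Qed.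

Lemma Enorm_le f M : bdd_meas f -> (forall w, `|f w| <= M) -> `|E f| <= M.
Proof.
move=> bf fM; rewrite (le_trans (Enorm bf))// -[leRHS]Ecst; apply: Ele => //.
- case: bf => mf [N fN]; split; first exact: measurableT_comp.
  by exists N => w; rewrite normr_id.
- exact: bdd_meas_cst.
Qed.

Lemma ae_eq_E f g : bdd_meas f -> bdd_meas g -> {ae P, forall w, f w = g w} ->
  E f = E g.
Proof.
move=> [mf _] [mg _] fg; congr fine; apply: ae_eq_integral => //.
- exact/measurable_EFinP.
- exact/measurable_EFinP.
- by apply: filterS fg => w /= -> _.
Qed.

(* Peeling off binary digits: [f = 2^-1 1_(f >= 2^-1) + f'] with [2 f'] again
   [0,1]-valued, so that the error is halved at each step. *)
Let transfer01 H X Y (k C : R) n :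
  bdd_meas H -> measurable_fun setT X -> measurable_fun setT Y ->
  (forall w, `|H w| <= C) ->
  (forall B, measurable B -> E (fun w => H w * \1_(X @^-1` B) w) =
                             k * E (\1_(Y @^-1` B))) ->
  forall h : R -> R, measurable_fun setT h -> (forall x, 0 <= h x <= 1) ->
  `|E (fun w => H w * h (X w)) - k * E (fun w => h (Y w))| <=
    (C + `|k|) * 2^-1 ^+ n.
Proof.
move=> bH mX mY MC HB; elim: n => [|n IH] h mh h01.
  have h1 x : `|h x| <= 1 by case/andP: (h01 x) => h0 h1; rewrite ger0_norm.
  rewrite expr0 mulr1 (le_trans (ler_normB _ _))// lerD//.
    apply: Enorm_le; first by apply: bdd_measM => //; exact: bdd_meas_comp.
    by move=> w; rewrite normrM -[leRHS]mulr1 ler_pM.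
  rewrite normrM -[leRHS]mulr1 ler_wpM2l//.
  by apply: Enorm_le => //; exact: bdd_meas_comp.
pose B := h @^-1` `[2^-1, +oo[.
have mB : measurable B by rewrite -[B]setTI; exact: mh.
pose h' x := 2 * h x - \1_B x.
have mh' : measurable_fun setT h'.
  by apply: measurable_funB; [exact: measurable_funM|exact: measurable_indic].
have hB x : (x \in B) = (2^-1 <= h x).
  by apply/idP/idP => [|?]; rewrite ?inE /B /= in_itv/= andbT.
have h'01 x : 0 <= h' x <= 1.
  rewrite /h' indicE hB; case/andP: (h01 x) => h0 h1.
  by case: (leP 2^-1 (h x)) => /= hx; apply/andP; split; lra.
have hE x : h x = 2^-1 * h' x + 2^-1 * \1_B x by rewrite /h'; field.
have bX (l : R -> R) Z : measurable_fun setT l -> (forall x, 0 <= l x <= 1) ->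
    measurable_fun setT Z -> bdd_meas (fun w => l (Z w)).
  move=> ml l01 mZ; apply: bdd_meas_comp => // x.
  by case/andP: (l01 x) => l0 l1; rewrite ger0_norm.
have mXB (Z : Om -> R) : measurable_fun setT Z -> measurable (Z @^-1` B).
  by move=> mZ; rewrite -[_ @^-1` _]setTI; exact: (mZ measurableT _ mB).
have bB (Z : Om -> R) : measurable_fun setT Z -> bdd_meas (\1_(Z @^-1` B)).
  by move=> mZ; apply: bdd_meas_indic; exact: mXB.
have -> : E (fun w => H w * h (X w)) =
    2^-1 * E (fun w => H w * h' (X w)) + 2^-1 * E (fun w => H w * \1_(X @^-1` B) w).
  rewrite -!EZ -?ED; last 4 first.
    - by apply: bdd_measM; [exact: bdd_meas_cst|apply: bdd_measM => //; exact: bX].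
    - by apply: bdd_measM; [exact: bdd_meas_cst|apply: bdd_measM => //; exact: bB].
    - by apply: bdd_measM => //; exact: bB.
    - by apply: bdd_measM => //; exact: bX.
  by apply: eq_Rintegral => w _; rewrite [in LHS]hE !indicE; ring.
have -> : E (fun w => h (Y w)) =
    2^-1 * E (fun w => h' (Y w)) + 2^-1 * E (\1_(Y @^-1` B)).
  rewrite -!EZ -?ED; last 4 first.
    - by apply: bdd_measM; [exact: bdd_meas_cst|exact: bX].
    - by apply: bdd_measM; [exact: bdd_meas_cst|exact: bB].
    - exact: bB.
    - exact: bX.
  by apply: eq_Rintegral => w _; rewrite [in LHS]hE !indicE; ring.
rewrite HB// [X in `|X|](_ : _ = 2^-1 *
  (E (fun w => H w * h' (X w)) - k * E (fun w => h' (Y w)))); last by ring.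
rewrite normrM ger0_norm// exprS mulrCA ler_wpM2l//.
exact: IH.
Qed.

(** A rule tested on events extends to bounded functions. With [H] a function of the past and
    [Y = X] it expresses independence of [X] from the past; with [H = 1] it expresses equality of
    laws. *)
Lemma transfer H X Y k :
  bdd_meas H -> measurable_fun setT X -> measurable_fun setT Y ->
  (forall B, measurable B -> E (fun w => H w * \1_(X @^-1` B) w) =
                             k * E (\1_(Y @^-1` B))) ->
  forall h : R -> R, measurable_fun setT h -> (forall x, `|h x| <= 1) ->
  E (fun w => H w * h (X w)) = k * E (fun w => h (Y w)).
Proof.
move=> bH mX mY HB.
have [C MC] := bH.2.
have C0 : 0 <= C by exact: le_trans (MC point).
suff main : forall h : R -> R, measurable_fun setT h -> (forall x, 0 <= h x <= 1) ->
    E (fun w => H w * h (X w)) = k * E (fun w => h (Y w)).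
  move=> h mh h1; pose h' x := 2^-1 * (h x + 1).
  have mh' : measurable_fun setT h'.
    by apply: measurable_funM => //; apply: measurable_funD.
  have h'01 x : 0 <= h' x <= 1.
    by have := h1 x; rewrite ler_norml /h' => /andP[? ?]; apply/andP; split; lra.
  have h'1 x : `|h' x| <= 1.
    by case/andP: (h'01 x) => ? ?; rewrite ger0_norm.
  (* The event [setT] settles the constants, and then the affine change [h' = (h + 1) / 2] reduces
     values in [-1, 1] to values in [0, 1]. *)
  have c1 : E H = k.
    have := HB setT measurableT; rewrite !preimage_setT Eindic//.
    rewrite probability_setT/= mulr1 => <-.
    by apply: eq_Rintegral => w _; rewrite indicT mulr1.
  have hE x : h x = 2 * h' x - 1 by rewrite /h'; field.
  have bY Z (l : R -> R) : measurable_fun setT l -> (forall x, `|l x| <= 1) ->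
    measurable_fun setT Z -> bdd_meas (fun w => l (Z w)) by move=> *; exact: bdd_meas_comp.
  have -> : E (fun w => H w * h (X w)) = 2 * E (fun w => H w * h' (X w)) - E H.
    rewrite -EZ -?EB//; last 2 first.
      - by apply: bdd_measM; [exact: bdd_meas_cst|apply: bdd_measM => //; exact: bY].
      - by apply: bdd_measM => //; exact: bY.
    by apply: eq_Rintegral => w _; rewrite hE; ring.
  have -> : E (fun w => h (Y w)) = 2 * E (fun w => h' (Y w)) - 1.
    rewrite -[X in _ - X]Ecst -EZ -?EB//; last 3 first.
      - by apply: bdd_measM; [exact: bdd_meas_cst|exact: bY].
      - exact: bdd_meas_cst.
      - exact: bY.
    by apply: eq_Rintegral => w _; rewrite hE.
  by rewrite main// c1; ring.
move=> h mh h01; apply/eqP; rewrite -subr_eq0 -normr_le0; apply/ler_addgt0Pr => e e0.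
rewrite add0r.
have Ck : 0 <= C + `|k| by rewrite addr_ge0.
have := @cvg_geometric R (C + `|k|) 2^-1.
rewrite ger0_norm// => /(_ _)/cvgrPdist_lt /(_ _ e0)[]; first by rewrite invf_lt1// ltr1n.
move=> n _ /(_ n (leqnn n)) /=; rewrite sub0r normrN ger0_norm ?mulr_ge0 ?exprn_ge0//.
move=> /ltW; apply: le_trans; exact: transfer01.
Qed.

Lemma same_law_E X Y : measurable_fun setT X -> measurable_fun setT Y ->
  (forall B : set R, measurable B -> P (X @^-1` B) = P (Y @^-1` B)) ->
  forall h : R -> R, measurable_fun setT h -> (forall x, `|h x| <= 1) ->
  E (fun w => h (X w)) = E (fun w => h (Y w)).
Proof.
move=> mX mY XY h mh h1.
rewrite -[RHS]mul1r -(@transfer (fun=> 1) X Y 1)//.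
- by apply: eq_Rintegral => w _; rewrite mul1r.
- exact: bdd_meas_cst.
move=> B mB; rewrite mul1r.
under eq_Rintegral do rewrite mul1r.
by rewrite !Eindic ?XY// -[_ @^-1` _]setTI; [exact: mY|exact: mX].
Qed.

End BoundedMeasurable.

(** * Characteristic functions of sums of independent variables *)

Section IndependentSums.
Context (R : realType) (d : measure_display) (Om : measurableType d)
  (P : probability Om R).
Implicit Types X Y : Om -> R.

Local Notation E f := (\int[P]_w f w).

(** Real and imaginary part of the product of the [c j + i s j] over [j < k]; all characteristic
    functions are handled through such pairs of reals. *)
Fixpoint trig_prod (c s : nat -> R) (k : nat) : R * R :=
  if k is k'.+1 then
    let p := trig_prod c s k' in (p.1 * c k' - p.2 * s k', p.2 * c k' + p.1 * s k')
  else (1, 0).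

Context (m : nat) (X : nat -> Om -> R).
Hypothesis mX : forall j, measurable_fun setT (X j).
Hypothesis indep : forall B : nat -> set R, (forall j, measurable (B j)) ->
  fine (P [set w | forall j, (j < m)%N -> B j (X j w)]) =
  \prod_(j < m) fine (P (X j @^-1` B j)).

Let c j := E (fun w => cos (X j w)).
Let s j := E (fun w => sin (X j w)).
Let psum k w := \sum_(j < k) X j w.
Let rect k (B : nat -> set R) := [set w | forall j, (k <= j < m)%N -> B j (X j w)].

Let measurable_rect k B : (forall j, measurable (B j)) -> measurable (rect k B).
Proof.
move=> mB; rewrite (_ : rect k B =
  \bigcap_(j in [set j | (k <= j < m)%N]) (X j @^-1` B j)).
  by apply: bigcap_measurableType => // j _; rewrite -[_ @^-1` _]setTI; exact: mX.
by apply/seteqP; split => w /= h j; exact: h.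
Qed.

Let measurable_psum k : measurable_fun setT (psum k).
Proof. exact: measurable_sum. Qed.

(** Independence is given on rectangles of events. The induction moves one variable at a time from
    the rectangle into the trigonometric factor, by the addition formulas, while the variables from
    [k] on are still tested by events. *)
Lemma indep_trig k : (k <= m)%N -> forall B, (forall j, measurable (B j)) ->
  E (fun w => cos (psum k w) * \1_(rect k B) w) =
    (trig_prod c s k).1 * \prod_(k <= j < m) fine (P (X j @^-1` B j)) /\
  E (fun w => sin (psum k w) * \1_(rect k B) w) =
    (trig_prod c s k).2 * \prod_(k <= j < m) fine (P (X j @^-1` B j)).
Proof.
elim: k => [|k IH] km B mB.
  split.
    under eq_Rintegral do rewrite /psum big_ord0 cos0 mul1r.
    by rewrite mul1r Eindic ?big_mkord -?indep//; exact: measurable_rect.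
  under eq_Rintegral do rewrite /psum big_ord0 sin0 mul0r.
  by rewrite Ecst mul0r.
set Q := \prod_(k.+1 <= j < m) _.
pose A := rect k.+1 B.
have mA : measurable A by exact: measurable_rect.
have step (h : R -> R) q : measurable_fun setT h -> (forall x, `|h x| <= 1) ->
    (forall B', (forall j, measurable (B' j)) ->
      E (fun w => h (psum k w) * \1_(rect k B') w) =
      q * \prod_(k <= j < m) fine (P (X j @^-1` B' j))) ->
    forall l : R -> R, measurable_fun setT l -> (forall x, `|l x| <= 1) ->
    E (fun w => h (psum k w) * \1_A w * l (X k w)) =
    q * Q * E (fun w => l (X k w)).
  move=> mh h1 hq l ml l1; apply: transfer => //.
    by apply: bdd_measM; [exact: bdd_meas_comp|exact: bdd_meas_indic].
  (* The event on [X k] is put back as the [k]-th side of the rectangle, where the induction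
     hypothesis applies. *)
  move=> D mD; pose B' j := if j == k then D else B j.
  have mB' j : measurable (B' j) by rewrite /B'; case: ifP.
  transitivity (E (fun w => h (psum k w) * \1_(rect k B') w)).
    apply: eq_Rintegral => w _; rewrite -mulrA; congr (_ * _).
    have -> : rect k B' = A `&` X k @^-1` D.
      apply/seteqP; split => v /=.
        move=> hv; split => [j /andP[kj jm]|].
          have := hv j; rewrite /B' gtn_eqF//; apply.
          by rewrite (ltnW kj) jm.
        by have := hv k; rewrite /B' eqxx; apply; rewrite leqnn.
      move=> [hA hD] j /andP[]; rewrite leq_eqVlt => /predU1P[<- _|kj jm].
        by rewrite /B' eqxx.
      by rewrite /B' gtn_eqF//; apply: hA; rewrite kj jm.
    by rewrite indicI.
  rewrite hq// big_ltn// /B' eqxx Eindic; last first.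
    by rewrite -[_ @^-1` _]setTI; exact: mX.
  rewrite [\prod_(_ <= _ < _) _](_ : _ = Q); last first.
    by apply: eq_big_nat => j /andP[kj _]; rewrite gtn_eqF.
  by rewrite mulrAC mulrA.
have hc := fun B' mB' => (IH (ltnW km) B' mB').1.
have hs := fun B' mB' => (IH (ltnW km) B' mB').2.
have mc := @measurable_cosT R; have ms := @measurable_sinT R.
have c1 := @normr_cos_le1 R; have s1 := @normr_sin_le1 R.
have bb (h l : R -> R) : measurable_fun setT h -> (forall x, `|h x| <= 1) ->
    measurable_fun setT l -> (forall x, `|l x| <= 1) ->
    bdd_meas (fun w => h (psum k w) * \1_A w * l (X k w)).
  move=> *; apply: bdd_measM; last exact: bdd_meas_comp.
  by apply: bdd_measM; [exact: bdd_meas_comp|exact: bdd_meas_indic].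
split.
  transitivity (E (fun w => cos (psum k w) * \1_A w * cos (X k w) -
                            sin (psum k w) * \1_A w * sin (X k w))).
    by apply: eq_Rintegral => w _; rewrite /psum big_ord_recr cosD -/(psum k w); ring.
  rewrite EB ?(step _ _ mc c1 hc _ mc c1) ?(step _ _ ms s1 hs _ ms s1)//=.
  - by rewrite -/(c k) -/(s k); ring.
  - exact: bb.
  - exact: bb.
transitivity (E (fun w => sin (psum k w) * \1_A w * cos (X k w) +
                          cos (psum k w) * \1_A w * sin (X k w))).
  by apply: eq_Rintegral => w _; rewrite /psum big_ord_recr sinD -/(psum k w); ring.
rewrite ED ?(step _ _ ms s1 hs _ mc c1) ?(step _ _ mc c1 hc _ ms s1)//=.
- by rewrite -/(c k) -/(s k); ring.
- exact: bb.
- exact: bb.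
Qed.

Lemma indep_trig_sum k : (k <= m)%N ->
  E (fun w => cos (\sum_(j < k) X j w)) = (trig_prod c s k).1 /\
  E (fun w => sin (\sum_(j < k) X j w)) = (trig_prod c s k).2.
Proof.
move=> km; have [] := indep_trig km (fun=> measurableT).
rewrite (_ : rect k _ = setT); last by apply/seteqP; split.
rewrite big1 ?mulr1 => [<- <-|j _]; last first.
  by rewrite preimage_setT; have -> : P setT = 1%E by exact: probability_setT.
by split; apply: eq_Rintegral => w _; rewrite indicT mulr1.
Qed.

(** If [a + i b] belongs to the partial sum and [c + i s] to the next variable, then [1 - (a c - b
    s) = (1 - a) + a (1 - c) + b s] with [|a|, |b| <= 1]. The product thus costs a sum, provided
    that the sines are counted along with the cosines. *)
Lemma indep_cos_sum_ge k : (k <= m)%N ->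
  1 - E (fun w => cos (\sum_(j < k) X j w)) <=
  \sum_(j < k) (1 - E (fun w => cos (X j w)) + `|E (fun w => sin (X j w))|).
Proof.
elim: k => [|k IH] km.
  under eq_Rintegral do rewrite big_ord0 cos0.
  by rewrite Ecst subrr big_ord0.
have [cE sE] := indep_trig_sum (ltnW km).
have [-> _] := indep_trig_sum km; rewrite /= big_ord_recr/= -cE -sE -/(c k) -/(s k).
have := IH (ltnW km).
set a := E (fun w => cos _); set b := E (fun w => sin _).
set S := \sum_(_ < _) _ => aS.
have a1 : `|a| <= 1.
  by apply: Enorm_le => [|w]; [exact: (bdd_meas_cos (measurable_psum k))|exact: normr_cos_le1].
have b1 : `|b| <= 1.
  by apply: Enorm_le => [|w]; [exact: (bdd_meas_sin (measurable_psum k))|exact: normr_sin_le1].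
have ck1 : c k <= 1.
  rewrite (le_trans (ler_norm _))//.
  by apply: Enorm_le => [|w]; [exact: bdd_meas_cos|exact: normr_cos_le1].
have h1 : a * (1 - c k) <= 1 - c k.
  rewrite -[leRHS]mul1r ler_wpM2r ?subr_ge0//.
  exact: le_trans (ler_norm _) a1.
have h2 : b * s k <= `|s k|.
  by rewrite (le_trans (ler_norm _))// normrM -[leRHS]mul1r ler_wpM2r.
lra.
Qed.

End IndependentSums.

(** * Expectations of Lipschitz functions under convergence in probability *)

Section TrigLipschitz.
Context (R : realType).

Lemma lipschitz_of_derive_le1 (f df : R -> R) (x y : R) :
  (forall z : R, is_derive z (1 : R) f (df z)) -> (forall z, `|df z| <= 1) ->
  `|f x - f y| <= `|x - y|.
Proof.
move=> fdf df1; wlog yx : x y / y <= x.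
  by move=> h; case/orP: (le_total y x) => xy; [|rewrite distrC [leRHS]distrC]; exact: h.
have [z _ ->] : exists2 c, c \in `[y, x] & f x - f y = df c * (x - y).
  apply: MVT_segment => //.
  apply: continuous_subspaceT => z; apply/differentiable_continuous.
  by apply/derivable1_diffP; exact: (@ex_derive _ _ _ _ _ _ _ (fdf z)).
by rewrite normrM -[leRHS]mul1r ler_wpM2r.
Qed.

Lemma cos_lipschitz (x y : R) : `|cos x - cos y| <= `|x - y|.
Proof.
apply: (lipschitz_of_derive_le1 (df := fun z => - sin z)) => z.
by rewrite normrN normr_sin_le1.
Qed.

Lemma sin_lipschitz (x y : R) : `|sin x - sin y| <= `|x - y|.
Proof.
apply: (lipschitz_of_derive_le1 (df := cos)) => z.
exact: normr_cos_le1.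
Qed.

End TrigLipschitz.

Section ExpectationConvergence.
Context (R : realType) (d : measure_display) (Om : measurableType d)
  (P : probability Om R).
Local Notation E f := (\int[P]_w f w).

Lemma measurable_gt_norm (X : Om -> R) (a : R) : measurable_fun setT X ->
  measurable [set w | a < `|X w|].
Proof.
move=> mX; rewrite (_ : [set _ | _] = (fun w => `|X w|) @^-1` `]a, +oo[).
  by rewrite -[_ @^-1` _]setTI; apply: measurableT_comp.
by apply/seteqP; split => w /=; rewrite in_itv/= andbT.
Qed.

Lemma E_lipschitz_le (h : R -> R) (X Y : Om -> R) (a : R) :
  measurable_fun setT h -> (forall x, `|h x| <= 1) ->
  (forall x y, `|h x - h y| <= `|x - y|) ->
  measurable_fun setT X -> measurable_fun setT Y -> 0 < a ->
  `|E (fun w => h (X w)) - E (fun w => h (Y w))| <=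
    a + 2 * fine (P [set w | a < `|X w - Y w|]).
Proof.
move=> mh h1 hL mX mY a0.
set A := [set w | _].
have mA : measurable A by apply: measurable_gt_norm; exact: measurable_funB.
have bX := bdd_meas_comp mh h1 mX; have bY := bdd_meas_comp mh h1 mY.
have bA := bdd_meas_indic R mA.
rewrite -EB//; apply: le_trans (Enorm P (bdd_measB bX bY)) _.
have -> : a + 2 * fine (P A) = E (fun w => a + 2 * \1_A w).
  rewrite (@ED _ _ _ P (fun=> a)) ?EZ ?Ecst ?Eindic//.
  - exact: bdd_meas_cst.
  - by apply: bdd_measM => //; exact: bdd_meas_cst.
apply: Ele.
- have [m [M hM]] := bdd_measB bX bY.
  split; first exact: measurableT_comp.
  by exists M => w; rewrite normr_id.
- apply: bdd_measD; first exact: bdd_meas_cst.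
  by apply: bdd_measM => //; exact: bdd_meas_cst.
move=> w; rewrite indicE; have [wA|/negP wA] := boolP (w \in A).
  rewrite mulr1 (le_trans (ler_normB _ _))//.
  by have := h1 (X w); have := h1 (Y w); lra.
rewrite mulr0 addr0 (le_trans (hL _ _))// leNgt; apply/negP => aw.
by apply: wA; rewrite inE.
Qed.

Lemma cvg_E_of_cvg_prob (T : Type) (F : set_system T) (FF : Filter F) (h : R -> R)
  (Y : T -> Om -> R) (X : Om -> R) :
  measurable_fun setT h -> (forall x, `|h x| <= 1) ->
  (forall x y, `|h x - h y| <= `|x - y|) ->
  measurable_fun setT X -> (\forall t \near F, measurable_fun setT (Y t)) ->
  (forall e : R, 0 < e -> P [set w | e < `|Y t w - X w|] @[t --> F] --> 0%E) ->
  E (fun w => h (Y t w)) @[t --> F] --> E (fun w => h (X w)).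
Proof.
move=> mh h1 hL mX mY YX; apply/cvgrPdist_le => e e0.
have e4 : 0 < e / 4 by rewrite divr_gt0.
have /fine_cvg/cvgrPdist_le/(_ _ e4) ? := YX _ e4.
near=> t; rewrite distrC.
have mYt : measurable_fun setT (Y t) by near: t.
rewrite (le_trans (E_lipschitz_le mh h1 hL mYt mX e4))//.
have : `|0 - fine (P [set w | e / 4 < `|Y t w - X w|])| <= e / 4 by near: t.
rewrite sub0r normrN ger0_norm ?fine_ge0//.
by move=> ?; lra.
Unshelve. all: by end_near. Qed.

End ExpectationConvergence.

(** * Increments of a cylindrical Levy process *)

Section LevyLaws.
Context (R : realType) (U : normedModType R).
Context (d : measure_display) (Om : measurableType d) (P : probability Om R).
Context (L : R -> U -> Om -> R) (HL : cyl_levy P L).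
Local Notation E f := (\int[P]_w f w).

Lemma levy_meas t u : 0 <= t -> measurable_fun setT (L t u).
Proof. by case: HL => h _ _ _; exact: h. Qed.

Lemma levy_lin t a b u v : 0 <= t -> {ae P, forall w,
  L t (a *: u + b *: v) w = a * L t u w + b * L t v w}.
Proof. by case: HL => _ h _ _; exact: h. Qed.

Lemma levyZ t a u : 0 <= t -> {ae P, forall w, L t (a *: u) w = a * L t u w}.
Proof.
move=> t0; apply: filterS (levy_lin a 0 u u t0) => w.
by rewrite scale0r addr0 mul0r addr0.
Qed.

Lemma levyD t u v : 0 <= t -> {ae P, forall w, L t (u + v) w = L t u w + L t v w}.
Proof.
move=> t0; apply: filterS (levy_lin 1 1 u v t0) => w.
by rewrite !scale1r !mul1r.
Qed.

Lemma levy_u0 t : 0 <= t -> {ae P, forall w, L t 0 w = 0}.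
Proof.
by move=> t0; apply: filterS (levyZ 0 0 t0) => w; rewrite scale0r mul0r.
Qed.

Lemma levy_t0 u : {ae P, forall w, L 0 u w = 0}.
Proof.
case: HL => _ _ _ /(_ 1%N (fun=> u))[_ h _ _ _].
by apply: filterS h => w /(_ ord0).
Qed.

Lemma levy_incr_meas s t u : 0 <= s -> 0 <= t ->
  measurable_fun setT (fun w => L t u w - L s u w).
Proof. by move=> *; apply: measurable_funB; exact: levy_meas. Qed.

Lemma levy_incr_law s t u (h : R -> R) : 0 <= s <= t ->
  measurable_fun setT h -> (forall x, `|h x| <= 1) ->
  E (fun w => h (L t u w - L s u w)) = E (fun w => h (L (t - s) u w)).
Proof.
move=> /andP[s0 st] mh h1.
apply: (@same_law_E _ _ _ P (fun w => L t u w - L s u w)) => //.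
- by apply: levy_incr_meas => //; exact: le_trans st.
- by apply: levy_meas; rewrite subr_ge0.
move=> B mB; case: HL => _ _ _ /(_ 1%N (fun=> u))[_ _ _ + _].
move=> /(_ s t); rewrite s0 st => /(_ isT (fun=> B) (fun=> mB)) hh.
rewrite (_ : _ @^-1` B = [set w | forall i : 'I_1, B (L t u w - L s u w)]).
  rewrite hh; congr (P _); apply/seteqP; split => w /=; last by move=> + i; exact.
  by move=> /(_ ord0).
by apply/seteqP; split => w /=; [move=> + i; exact|move=> /(_ ord0)].
Qed.

(** The directions may differ from one increment to the next: the vector process
    [(L(t) v_0, ..., L(t) v_(m-1))] has independent increments, and testing the [j]-th one in its
    [j]-th coordinate only, with [setT] elsewhere, isolates the direction [v j]. *)
Lemma levy_incr_indep (m : nat) (t : nat -> R) (v : nat -> U) :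
  (forall j, 0 <= t j) -> (forall j, (j < m)%N -> t j < t j.+1) ->
  forall B : nat -> set R, (forall j, measurable (B j)) ->
  fine (P [set w | forall j, (j < m)%N -> B j (L (t j.+1) (v j) w - L (t j) (v j) w)]) =
  \prod_(j < m) fine (P ((fun w => L (t j.+1) (v j) w - L (t j) (v j) w) @^-1` B j)).
Proof.
move=> t0 tm B mB.
case: HL => _ _ _ /(_ m (fun i : 'I_m => v i))[_ _ + _ _].
move=> /(_ m t (t0 0%N) tm (fun j i => if i == j then B j else setT)).
have -> : [set w | forall j i : 'I_m, (if i == j then B j else setT)
    (L (t j.+1) (v i) w - L (t j) (v i) w)] =
  [set w | forall j, (j < m)%N -> B j (L (t j.+1) (v j) w - L (t j) (v j) w)].
  apply/seteqP; split => w /=.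
    by move=> h j jm; have := h (Ordinal jm) (Ordinal jm); rewrite eqxx.
  by move=> h j i; case: eqP => // ->; exact: h.
move=> -> => [|j i]; last by case: ifP.
apply: eq_bigr => j _; congr (fine (P _)).
apply/seteqP; split => w /=; first by move=> /(_ j); rewrite eqxx.
by move=> h i; case: eqP => // ->.
Qed.

Lemma levy_cvg_t u t : 0 <= t -> forall e : R, 0 < e ->
  P [set w | e < `|L r u w - L t u w|] @[r --> within (fun r => 0 <= r) (nbhs t)] --> 0%E.
Proof.
move=> t0 e e0; case: HL => _ _ _ /(_ 1%N (fun=> u))[_ _ _ _ /(_ t t0 e e0)].
apply: cvg_trans; apply: near_eq_cvg; near=> r; congr (P _).
apply/seteqP; split => w /=; first by case.
by move=> ?; exists ord0.
Unshelve. all: by end_near. Qed.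

Lemma levy_cvg_u t (u : nat -> U) (u0 : U) (h : R -> R) : 0 <= t ->
  u n @[n --> \oo] --> u0 ->
  measurable_fun setT h -> (forall x, `|h x| <= 1) ->
  (forall x y, `|h x - h y| <= `|x - y|) ->
  E (fun w => h (L t (u n) w)) @[n --> \oo] --> E (fun w => h (L t u0 w)).
Proof.
move=> t0 uu0 mh h1 hL; apply: cvg_E_of_cvg_prob => //.
- exact: levy_meas.
- by apply: nearW => n; exact: levy_meas.
- by case: HL => _ _ /(_ t u u0 t0 uu0).
Qed.

(** [Num.max 0 t] extends the function to negative times by its value at 0; continuity on the whole
    line is what the integral lemmas below ask for. *)
Lemma levy_E_continuous u (h : R -> R) :
  measurable_fun setT h -> (forall x, `|h x| <= 1) ->
  (forall x y, `|h x - h y| <= `|x - y|) ->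
  continuous (fun t : R => E (fun w => h (L (Num.max 0 t) u w)) : R).
Proof.
move=> mh h1 hL t.
pose G r := E (fun w => h (L r u w)).
have max0 (r : R) : 0 <= Num.max 0 r by rewrite le_max lexx.
have : G r @[r --> within (fun r => 0 <= r) (nbhs (Num.max 0 t))] --> G (Num.max 0 t).
  apply: cvg_E_of_cvg_prob => //.
  - exact: levy_meas.
  - by rewrite near_withinE; apply: nearW => r; exact: levy_meas.
  - exact: levy_cvg_t.
move=> /cvgrPdist_lt GG; apply/cvgrPdist_lt => e e0.
have := GG e e0; rewrite near_withinE => hnear.
have cmax : (fun r : R => Num.max 0 r) @ t --> Num.max 0 t.
  by apply: continuous_max; [exact: cvg_cst|exact: cvg_id].
have h' : \forall r \near t, `|G (Num.max 0 t) - G (Num.max 0 r)| < e.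
  have := cmax _ hnear; rewrite nbhs_simpl => h'.
  exact: (@filterS _ (nbhs t) _ _ _ (fun r hr => hr (max0 r)) h').
exact: h'.
Qed.

End LevyLaws.

(** * Characteristic functions *)

Section ContinuousIntegrals.
Context (R : realType).
Implicit Types (f g c s : R -> R).
Local Notation I f a b := (\int[@lebesgue_measure R]_(x in `[a, b]) f x).

Lemma integrable_cont f (a b : R) : continuous f ->
  (@lebesgue_measure R).-integrable `[a, b] (EFin \o f).
Proof.
move=> cf; apply: continuous_compact_integrable; first exact: segment_compact.
exact: continuous_subspaceT.
Qed.

Lemma Rint_shift f (a b r : R) : continuous f -> a <= b ->
  I (fun x => f (x + r)) a b = I f (a + r) (b + r).
Proof.
move=> cf ab; rewrite /Rintegral; congr fine.
pose F := fun x : R => x + r.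
have F' : F^`()%classic = cst 1.
  apply/funext => x; rewrite derive1E /F deriveD//.
  by rewrite derive_id derive_cst addr0.
have cF : continuous F.
  by move=> x; apply: cvgD; [exact: cvg_id|exact: cvg_cst].
apply/esym.
transitivity (\int[lebesgue_measure]_(x in `[a, b]) (((f \o F) * F^`()%classic) x)%:E)%E.
apply: (@integration_by_substitution_increasing _ F f a b) => //.
- by move=> x y _ _ xy; rewrite /F ltrD2r.
- by rewrite F' => x _; exact: cst_continuous.
- by rewrite F'; exact: is_cvg_cst.
- by rewrite F'; exact: is_cvg_cst.
- split.
  + by move=> x _; rewrite /F; apply: derivableD.
  + by apply: cvg_at_right_filter; exact: cF.
  + by apply: cvg_at_left_filter; exact: cF.
- exact: continuous_subspaceT.
by apply: eq_integral => x _; rewrite F' /= mulr1.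
Qed.

Lemma Rint_cat f (a b c : R) : continuous f -> a <= b -> b <= c ->
  I f a b + I f b c = I f a c.
Proof.
move=> cf ab bc; have ic := integrable_cont a c cf.
have := Rintegral_itvB ic (x := b); rewrite !bnd_simp => /(_ ab bc).
rewrite Rintegral_itv_obnd_cbnd => [<-|]; first by rewrite addrC subrK.
by apply: integrableS ic => //; apply: subset_itvr; rewrite bnd_simp.
Qed.

Lemma Rint_lin f g (a b x y : R) : continuous f -> continuous g ->
  I (fun z => x * f z + y * g z) a b = x * I f a b + y * I g a b.
Proof.
move=> cf cg; rewrite RintegralD//; last 2 first.
- by apply: integrable_cont => z; apply: cvgM; [exact: cvg_cst|exact: cf].
- by apply: integrable_cont => z; apply: cvgM; [exact: cvg_cst|exact: cg].
by rewrite !RintegralZl//; exact: integrable_cont.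
Qed.

Lemma Rint_norm_le f (a b : R) : continuous f -> (forall x, `|f x| <= 1) -> a <= b ->
  `|I f a b| <= b - a.
Proof.
move=> cf f1 ab; apply: le_trans (le_normr_Rintegral _ _) _ => //.
  exact: integrable_cont.
apply: (@le_trans _ _ (I (fun=> 1) a b)).
  apply: le_Rintegral => //.
  - by apply: integrable_norm; exact: integrable_cont.
  - by apply: integrable_cont => x; exact: cvg_cst.
have len : fine (@lebesgue_measure R `[a, b]%classic) = b - a.
  rewrite lebesgue_measure_itv/= lte_fin; case: ltgtP ab => //= -> _.
  by rewrite subrr.
by rewrite Rintegral_cst// mul1r len.
Qed.

(** With [F] the primitive of [f] vanishing at 0, both sides are [F (T + r) - F T - F r], which is
    symmetric in [r] and [T]. *)
Lemma Rint_swap_shift f (r T : R) : continuous f -> 0 <= r -> 0 <= T ->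
  I (fun x => f (x + r)) 0 T - I f 0 T = I (fun x => f (x + T)) 0 r - I f 0 r.
Proof.
move=> cf r0 T0; rewrite !Rint_shift// !add0r.
have h1 : I f 0 r + I f r (T + r) = I f 0 (T + r).
  by apply: Rint_cat => //; rewrite lerDr.
have h2 : I f 0 T + I f T (r + T) = I f 0 (T + r).
  by rewrite [T + r]addrC; apply: Rint_cat => //; rewrite lerDr.
lra.
Qed.

(* With [z = c + i s], a continuous multiplicative semigroup in the unit disk, integrating
   [z (x + r) - z x = z x (z r - 1)] over [x] in [0, T] and exchanging the roles of [r] and [T]
   gives [(z r - 1) \int_0^T z = (z T - 1) \int_0^r z]. *)
Lemma semigroup_linear_bound c s (r T : R) : continuous c -> continuous s ->
  (forall x, `|c x| <= 1) -> (forall x, `|s x| <= 1) ->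
  (forall x y, 0 <= x -> 0 <= y -> c (x + y) = c x * c y - s x * s y) ->
  (forall x y, 0 <= x -> 0 <= y -> s (x + y) = s x * c y + c x * s y) ->
  0 <= r -> 0 < T -> 3 / 4 * T <= I c 0 T -> `|I s 0 T| <= T / 4 ->
  1 - c r + `|s r| <= 4 * r / T * (1 - c T + `|s T|).
Proof.
move=> cc cs c1 s1 cD sD r0 T0 hA hB.
have T0' := ltW T0.
have in0 a x : x \in `[0, a]%classic -> 0 <= x.
  by rewrite inE /= in_itv/= => /andP[].
have lc x y : 0 <= y -> I (fun z => c (z + y)) 0 x = c y * I c 0 x + (- s y) * I s 0 x.
  move=> y0; rewrite -Rint_lin//; apply: eq_Rintegral => z /in0 z0.
  by rewrite cD//; ring.
have ls x y : 0 <= y -> I (fun z => s (z + y)) 0 x = c y * I s 0 x + s y * I c 0 x.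
  move=> y0; rewrite -Rint_lin//; apply: eq_Rintegral => z /in0 z0.
  by rewrite sD//; ring.
have e1 := Rint_swap_shift cc r0 T0'; have e2 := Rint_swap_shift cs r0 T0'.
rewrite !lc// in e1; rewrite !ls// in e2.
have := Rint_norm_le cc c1 r0; have := Rint_norm_le cs s1 r0; rewrite subr0.
move: hA hB e1 e2; set A := I c 0 T; set B := I s 0 T.
set p := I c 0 r; set q := I s 0 r => hA hB e1 e2 q0 p0.
have x0 : 0 <= 1 - c r by have := c1 r; rewrite ler_norml subr_ge0 => /andP[].
have a0 : 0 <= 1 - c T by have := c1 T; rewrite ler_norml subr_ge0 => /andP[].
set x := 1 - c r in x0 *; set y := s r; set a := 1 - c T in a0 *; set b := s T.
(* [f1] and [f2] are the real and imaginary parts of the exchanged identity, with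
   [z r - 1 = - x + i y] and [z T - 1 = - a + i b]. *)
have f1 : x * A = - (y * B) + a * p + b * q by rewrite /x /a /y /b; lra.
have f2 : y * A = x * B - a * q + b * p by rewrite /x /a /y /b; lra.
have B4 z : `|z * B| <= `|z| * (T / 4) by rewrite normrM ler_wpM2l.
have rp z : `|z * p| <= `|z| * r by rewrite normrM ler_wpM2l.
have rq z : `|z * q| <= `|z| * r by rewrite normrM ler_wpM2l.
have A0 : 0 <= A by rewrite (le_trans _ hA)// mulr_ge0.
have g1 : x * A <= `|y| * (T / 4) + a * r + `|b| * r.
  rewrite f1 -[a in leRHS](ger0_norm a0).
  apply: lerD; last exact: le_trans (ler_norm _) (rq _).
  apply: lerD; last exact: le_trans (ler_norm _) (rp _).
  by apply: le_trans (ler_norm _) _; rewrite normrN; exact: B4.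
have g2 : `|y| * A <= x * (T / 4) + a * r + `|b| * r.
  rewrite -[X in `|y| * X](ger0_norm A0) -normrM f2.
  rewrite -[a in leRHS](ger0_norm a0) -[x in leRHS](ger0_norm x0).
  apply: le_trans (ler_normD _ _) _; apply: lerD => //.
  by apply: le_trans (ler_normB _ _) _; apply: lerD.
have g3 : (x + `|y|) * (3 / 4 * T) <= (x + `|y|) * A.
  by rewrite ler_wpM2l// addr_ge0.
(* On adding [g1] and [g2], the terms with [T / 4] are absorbed by [3 / 4 * T], and half of [T] is
   left on the left-hand side. *)
have : (x + `|y|) * (T / 2) <= 2 * r * (a + `|b|) by lra.
rewrite -(ler_pM2r (_ : 0 < 2 / T)) ?divr_gt0//.
rewrite (_ : (x + `|y|) * (T / 2) * (2 / T) = x + `|y|); last by field; rewrite gt_eqF.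
by rewrite (_ : 2 * r * (a + `|b|) * (2 / T) = 4 * r / T * (a + `|b|))//; field; rewrite gt_eqF.
Qed.

End ContinuousIntegrals.

Section BoundedConvergence.
Context (R : realType) (d : measure_display) (S : measurableType d)
  (mu : {measure set S -> \bar R}).

Lemma bdd_cvg_Rintegral (D : set S) (f_ : nat -> S -> R) (f : S -> R) :
  measurable D -> (mu D < +oo)%E ->
  (forall n, measurable_fun D (f_ n)) ->
  (forall x, D x -> f_ n x @[n --> \oo] --> f x) ->
  (forall n x, `|f_ n x| <= 1) ->
  \int[mu]_(x in D) f_ n x @[n --> \oo] --> \int[mu]_(x in D) f x.
Proof.
move=> mD Dfin mf f_f f1.
have mf' : measurable_fun D f by exact: measurable_fun_cvg mf f_f.
have ic : mu.-integrable D (EFin \o (fun=> 1)).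
  apply: measurable_bounded_integrable => //.
  by exists 1; split; [exact: num_real|move=> N N1 x _ /=; rewrite normr1 ltW].
have [|||||jf _ h] := @dominated_convergence _ _ _ mu D mD
  (fun n => EFin \o f_ n) (EFin \o f) (EFin \o (fun=> 1)).
- by move=> n; exact/measurable_EFinP.
- exact/measurable_EFinP.
- by apply: aeW => x Dx; apply: cvg_EFin; [exact: nearW|exact: f_f].
- exact: ic.
- by apply: aeW => x n _ /=; rewrite lee_fin f1.
apply: fine_cvg; rewrite fineK//.
by apply: integrable_fin_num.
Qed.

End BoundedConvergence.

Lemma three_quarters_le (R : realType) (T x : R) : `|T - x| <= T / 4 -> 3 / 4 * T <= x.
Proof. by rewrite ler_norml => /andP[? ?]; lra. Qed.

Section CharacteristicFunction.
Context (R : realType) (U : normedModType R).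
Context (d : measure_display) (Om : measurableType d) (P : probability Om R).
Context (L : R -> U -> Om -> R) (HL : cyl_levy P L).
Local Notation E f := (\int[P]_w f w).

Let c (u : U) (t : R) : R := E (fun w => cos (L (Num.max 0 t) u w)).
Let s (u : U) (t : R) : R := E (fun w => sin (L (Num.max 0 t) u w)).

Let max0 (r : R) : 0 <= Num.max 0 r. Proof. by rewrite le_max lexx. Qed.

Let mL t u : measurable_fun setT (L (Num.max 0 t) u).
Proof. exact: levy_meas HL _ _ (max0 t). Qed.

Let c1 u t : `|c u t| <= 1.
Proof. by apply: Enorm_le => [|w]; [exact: bdd_meas_cos|exact: normr_cos_le1]. Qed.

Let s1 u t : `|s u t| <= 1.
Proof. by apply: Enorm_le => [|w]; [exact: bdd_meas_sin|exact: normr_sin_le1]. Qed.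

Let c_cont u : continuous (c u).
Proof.
exact: (levy_E_continuous HL (@measurable_cosT R) (@normr_cos_le1 R) (@cos_lipschitz R)).
Qed.

Let s_cont u : continuous (s u).
Proof.
exact: (levy_E_continuous HL (@measurable_sinT R) (@normr_sin_le1 R) (@sin_lipschitz R)).
Qed.

Let cE u t : 0 <= t -> c u t = E (fun w => cos (L t u w)).
Proof. by move=> t0; rewrite /c max_r. Qed.

Let sE u t : 0 <= t -> s u t = E (fun w => sin (L t u w)).
Proof. by move=> t0; rewrite /s max_r. Qed.

Let c0 u : c u 0 = 1.
Proof.
rewrite cE// -[RHS](Ecst P 1); apply: ae_eq_E.
- by apply: bdd_meas_cos; exact: (levy_meas HL).
- exact: bdd_meas_cst.
by apply: filterS (levy_t0 HL u) => w ->; rewrite cos0.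
Qed.

Let s0 u : s u 0 = 0.
Proof.
rewrite sE// -[RHS](Ecst P 0); apply: ae_eq_E.
- by apply: bdd_meas_sin; exact: (levy_meas HL).
- exact: bdd_meas_cst.
by apply: filterS (levy_t0 HL u) => w ->; rewrite sin0.
Qed.

Let cu0 t : c 0 t = 1.
Proof.
rewrite -[RHS](Ecst P 1); apply: ae_eq_E.
- exact: bdd_meas_cos.
- exact: bdd_meas_cst.
by apply: filterS (levy_u0 HL (max0 t)) => w ->; rewrite cos0.
Qed.

Let su0 t : s 0 t = 0.
Proof.
rewrite -[RHS](Ecst P 0); apply: ae_eq_E.
- exact: bdd_meas_sin.
- exact: bdd_meas_cst.
by apply: filterS (levy_u0 HL (max0 t)) => w ->; rewrite sin0.
Qed.

Let semigroup u x y : 0 <= x -> 0 <= y ->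
  c u (x + y) = c u x * c u y - s u x * s u y /\
  s u (x + y) = s u x * c u y + c u x * s u y.
Proof.
(* Independence of increments is available at strictly increasing times, so zero summands are
   treated apart. *)
rewrite le_eqVlt => /predU1P[<- y0|x0].
  by rewrite add0r c0 s0; split; ring.
rewrite le_eqVlt => /predU1P[<-|y0].
  by rewrite addr0 c0 s0; split; ring.
have x0' := ltW x0; have y0' := ltW y0; have xy0 := addr_ge0 x0' y0'.
pose t (j : nat) := match j with 0%N => 0 | 1%N => x | _ => x + y end.
pose X j w := L (t j.+1) u w - L (t j) u w.
have t0 j : 0 <= t j by case: j => [|[|j]].
have tm j : (j < 2)%N -> t j < t j.+1.
  by case: j => [|[|j]]//= _; rewrite ltrDl.
have mX j : measurable_fun setT (X j) by apply: (levy_incr_meas HL).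
have [] := @indep_trig_sum _ _ _ P 2 X mX
  (levy_incr_indep HL (fun=> u) t0 tm) 2 (leqnn 2).
have sumE w : \sum_(j < 2) X j w = L (x + y) u w - L 0 u w.
  by rewrite !big_ord_recr big_ord0 /X /=; ring.
have law (h : R -> R) : measurable_fun setT h -> (forall z, `|h z| <= 1) ->
    [/\ E (fun w => h (\sum_(j < 2) X j w)) = E (fun w => h (L (x + y) u w)),
        E (fun w => h (X 0%N w)) = E (fun w => h (L x u w)) &
        E (fun w => h (X 1%N w)) = E (fun w => h (L y u w))].
  move=> mh h1; split.
  - under eq_Rintegral do rewrite sumE.
    by rewrite (levy_incr_law HL)// ?lexx// subr0.
  - by rewrite (levy_incr_law HL)/= ?lexx// subr0.
  - by rewrite (levy_incr_law HL)/= ?x0' ?lerDl// addrAC subrr add0r.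
have [cs cx cy] := law _ (@measurable_cosT R) (@normr_cos_le1 R).
have [ss sx sy] := law _ (@measurable_sinT R) (@normr_sin_le1 R).
rewrite cs ss /= cx cy sx sy -!cE// -!sE// => -> ->.
by split; ring.
Qed.

Local Notation I f a b := (\int[@lebesgue_measure R]_(x in `[a, b]) f x).

Let cvg_trig (u : nat -> U) : u n @[n --> \oo] --> 0 ->
  (forall t, c (u n) t @[n --> \oo] --> (1 : R)) /\
  (forall t, s (u n) t @[n --> \oo] --> (0 : R)).
Proof.
move=> u0; split => t.
  rewrite -(cu0 t).
  exact: (levy_cvg_u HL (max0 t) u0 (@measurable_cosT R) (@normr_cos_le1 R) (@cos_lipschitz R)).
rewrite -(su0 t).
exact: (levy_cvg_u HL (max0 t) u0 (@measurable_sinT R) (@normr_sin_le1 R) (@sin_lipschitz R)).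
Qed.

(** The numerical hypotheses of [semigroup_linear_bound], together with smallness at time [T]. They
    hold for small [u] since the characteristic functions tend to 1 boundedly on [0, T]. *)
Let good (T e : R) (u : U) := [/\ 3 / 4 * T <= I (c u) 0 T, `|I (s u) 0 T| <= T / 4 &
  1 - c u T + `|s u T| <= e].

Let good_near (T e : R) (u : nat -> U) : 0 < T -> 0 < e -> u n @[n --> \oo] --> 0 ->
  \forall n \near \oo, good T e (u n).
Proof.
move=> T0 e0 u0; have [hc hs] := cvg_trig u0.
have fin : (@lebesgue_measure R `[0%R, T]%classic < +oo)%E.
  by rewrite lebesgue_measure_itv/= lte_fin T0 oppr0 adde0 ltry.
have Tlen : fine (@lebesgue_measure R `[0%R, T]%classic) = T.
  by rewrite lebesgue_measure_itv/= lte_fin T0/= oppr0 addr0.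
have Ic : I (c (u n)) 0 T @[n --> \oo] --> T.
  have I1 : I (fun=> 1) 0 T = T by rewrite Rintegral_cst// Tlen mul1r.
  suff : I (c (u n)) 0 T @[n --> \oo] --> I (fun=> 1) 0 T by rewrite I1.
  apply: (@bdd_cvg_Rintegral _ _ _ (@lebesgue_measure R) _ (fun n => c (u n)) (fun=> 1)).
  - exact: measurable_itv.
  - exact: fin.
  - by move=> n; apply: measurable_funTS; exact: (continuous_measurable_fun (@c_cont (u n))).
  - by move=> x _; exact: hc.
  - by move=> n x; exact: c1.
have Is : I (s (u n)) 0 T @[n --> \oo] --> (0 : R).
  have I0 : I (fun=> 0) 0 T = 0 by rewrite Rintegral_cst// mul0r.
  suff : I (s (u n)) 0 T @[n --> \oo] --> I (fun=> 0) 0 T by rewrite I0.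
  apply: (@bdd_cvg_Rintegral _ _ _ (@lebesgue_measure R) _ (fun n => s (u n)) (fun=> 0)).
  - exact: measurable_itv.
  - exact: fin.
  - by move=> n; apply: measurable_funTS; exact: (continuous_measurable_fun (@s_cont (u n))).
  - by move=> x _; exact: hs.
  - by move=> n x; exact: s1.
have T4 : 0 < T / 4 by rewrite divr_gt0.
have e2 : 0 < e / 2 by rewrite divr_gt0.
move/cvgrPdist_le/(_ _ T4): Ic => Ic; move/cvgrPdist_le/(_ _ T4): Is => Is.
have /cvgrPdist_le/(_ _ e2) cT := hc T; have /cvgrPdist_le/(_ _ e2) sT := hs T.
apply: filterS2 (filterI Ic Is) (filterI cT sT) => n [h4 h3] [h2 h1].
rewrite !sub0r !normrN in h1 h3; split => //.
  exact: three_quarters_le.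
rewrite [e in leRHS]splitr lerD//.
by rewrite (le_trans (ler_norm _)).
Qed.

(** Continuity of L(t) is given along sequences, so the radius is obtained by contradiction from
    vectors of norm at most [n.+1%:R^-1]. *)
Let good_ball (T e : R) : 0 < T -> 0 < e ->
  exists2 r : R, 0 < r & forall u, `|u| <= r -> good T e u.
Proof.
move=> T0 e0; apply: contrapT => h.
have {h} h n : exists u, `|u| <= n.+1%:R^-1 :> R /\ ~ good T e u.
  apply: contrapT => h1; apply: h; exists n.+1%:R^-1; first by rewrite invr_gt0.
  by move=> u un; apply: contrapT => ngu; apply: h1; exists u.
pose u n := projT1 (cid (h n)).
have uP n : `|u n| <= n.+1%:R^-1 :> R /\ ~ good T e (u n) by rewrite /u; case: cid.
have u0 : u n @[n --> \oo] --> 0.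
  apply/cvgrPdist_le => a a0; near=> n; rewrite sub0r normrN.
  rewrite (le_trans (uP n).1)// ltW//; near: n.
  exact: (near_infty_natSinv_lt (PosNum a0)).
have [n _ /(_ n (leqnn n))] := good_near T0 e0 u0.
exact: (uP n).2.
Unshelve. all: by end_near. Qed.

Lemma charfun_small_linear (T e : R) : 0 < T -> 0 < e ->
  exists2 r : R, 0 < r & forall (u : U) (t : R), `|u| <= r -> 0 <= t ->
    1 - E (fun w => cos (L t u w)) + `|E (fun w => sin (L t u w))| <= t * e.
Proof.
(* The factor [T / 4] cancels the [4 / T] of [semigroup_linear_bound]. *)
move=> T0 e0; have [|r r0 hr] := @good_ball T (e * T / 4) T0.
  by rewrite divr_gt0// mulr_gt0.
exists r => // u t ur t0; have [h1 h2 h3] := hr u ur.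
rewrite -cE// -sE//.
have hh := semigroup_linear_bound (@c_cont u) (@s_cont u) (c1 u) (s1 u)
  (fun x y x0 y0 => (@semigroup u x y x0 y0).1) (fun x y x0 y0 => (@semigroup u x y x0 y0).2) t0 T0 h1 h2.
apply: (le_trans hh).
apply: (@le_trans _ _ (4 * t / T * (e * T / 4))).
  by rewrite ler_wpM2l// divr_ge0 ?mulr_ge0// ltW.
rewrite le_eqVlt; apply/orP; left; apply/eqP; field; rewrite gt_eqF//.
Qed.

(** From [1 - cos 2x = 2 (1 - cos x) (1 + cos x) <= 4 (1 - cos x)] and
    [sin 2x = 2 sin x - 2 sin x (1 - cos x)]. The second form keeps the expectation of the sine
    itself on the right, not that of its absolute value. *)
Lemma charfun_doubling t u : 0 <= t ->
  1 - E (fun w => cos (L t (2 *: u) w)) <= 4 * (1 - E (fun w => cos (L t u w))) /\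
  `|E (fun w => sin (L t (2 *: u) w))| <=
    2 * `|E (fun w => sin (L t u w))| + 2 * (1 - E (fun w => cos (L t u w))).
Proof.
move=> t0; have m u' : measurable_fun setT (L t u') by exact: levy_meas HL _ _ t0.
have m2 : measurable_fun setT (fun w => 2 * L t u w) by exact: measurable_funM.
have bc := bdd_meas_cos (m u); have bs := bdd_meas_sin (m u).
have b1 : bdd_meas (fun w : Om => 1 : R) by exact: bdd_meas_cst.
have ae2 := levyZ HL 2 u t0.
have -> : E (fun w => cos (L t (2 *: u) w)) = E (fun w => cos (2 * L t u w)).
  apply: ae_eq_E; [exact: bdd_meas_cos|exact: bdd_meas_cos|].
  by apply: filterS ae2 => w ->.
have -> : E (fun w => sin (L t (2 *: u) w)) = E (fun w => sin (2 * L t u w)).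
  apply: ae_eq_E; [exact: bdd_meas_sin|exact: bdd_meas_sin|].
  by apply: filterS ae2 => w ->.
have cos2 x : cos (2 * x) = 2 * cos x ^+ 2 - 1 :> R.
  have -> : 2 * x = x *+ 2 by rewrite mulr_natl.
  by rewrite cos_mulr2n mulr_natl.
have sin2 x : sin (2 * x) = 2 * (sin x * cos x) :> R.
  by rewrite (_ : 2 * x = x + x) ?sinD; ring.
have E1 : 1 - E (fun w => cos (L t u w)) = E (fun w => 1 - cos (L t u w)).
  by rewrite EB// Ecst.
have b1c : bdd_meas (fun w => 1 - cos (L t u w)) by exact: bdd_measB.
split.
  rewrite E1 -EZ// -[X in X - _](Ecst P 1) -EB//; last exact: bdd_meas_cos.
  apply: Ele => [||w].
  - by apply: bdd_measB => //; exact: bdd_meas_cos.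
  - by apply: bdd_measM => //; exact: bdd_meas_cst.
  - by rewrite cos2; have := cos_le1 (L t u w); have := cos_geN1 (L t u w); nra.
have -> : E (fun w => sin (2 * L t u w)) = 2 * E (fun w => sin (L t u w)) -
    2 * E (fun w => sin (L t u w) * (1 - cos (L t u w))).
  rewrite -!EZ -?EB//.
  - by apply: eq_Rintegral => w _; rewrite sin2; ring.
  - by apply: bdd_measM => //; exact: bdd_meas_cst.
  - by apply: bdd_measM => //; [exact: bdd_meas_cst|exact: bdd_measM].
  - exact: bdd_measM.
rewrite (le_trans (ler_normB _ _))// !normrM ger0_norm// lerD2l ler_wpM2l//.
rewrite E1 (le_trans (Enorm P _))//; first exact: bdd_measM.
apply: Ele => // [|w].
  case: (bdd_measM bs b1c) => mm [M hM]; split; first exact: measurableT_comp.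
  by exists M => w; rewrite normr_id.
have h0 : 0 <= 1 - cos (L t u w) by rewrite subr_ge0 cos_le1.
by rewrite normrM (ger0_norm h0) -[leRHS]mul1r ler_wpM2r// normr_sin_le1.
Qed.

Lemma charfun_pow2 t u n : 0 <= t ->
  1 - E (fun w => cos (L t (2 ^+ n *: u) w)) +
    `|E (fun w => sin (L t (2 ^+ n *: u) w))| <=
  2 * 4 ^+ n * (1 - E (fun w => cos (L t u w)) + `|E (fun w => sin (L t u w))|).
Proof.
move=> t0.
set a := fun n => 1 - E (fun w => cos (L t (2 ^+ n *: u) w)).
set b := fun n => `|E (fun w => sin (L t (2 ^+ n *: u) w))|.
have ha k : a k.+1 <= 4 * a k.
  by rewrite /a exprS -scalerA; exact: (charfun_doubling _ t0).1.
have hb k : b k.+1 <= 2 * b k + 2 * a k.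
  by rewrite /a /b exprS -scalerA; exact: (charfun_doubling _ t0).2.
have b0 k : 0 <= b k by exact: normr_ge0.
(* The invariant closes because each doubling feeds [2 * a] into the sine part, and
   [2 * 4 ^ n + 2 * 4 ^ n = 4 ^ n.+1]. *)
suff main : a n <= 4 ^+ n * a 0%N /\ b n <= 2 ^+ n * b 0%N + 4 ^+ n * a 0%N.
  have h24 : 2 ^+ n <= 2 * 4 ^+ n :> R.
    rewrite -[leLHS]mul1r ler_pM ?exprn_ge0//; first by rewrite ler1n.
    by rewrite lerXn2r ?nnegrE// ler_nat.
  have h3 : 2 ^+ n * b 0%N <= 2 * 4 ^+ n * b 0%N by rewrite ler_wpM2r.
  have -> : 1 - E (fun w => cos (L t u w)) = a 0%N by rewrite /a expr0 scale1r.
  have -> : `|E (fun w => sin (L t u w))| = b 0%N by rewrite /b expr0 scale1r.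
  rewrite -/(a n) -/(b n); case: main; lra.
elim: n => [|n [IHa IHb]]; first by rewrite !expr0 !mul1r; split => //; rewrite lerDl;
  rewrite /a; have := c1 (2 ^+ 0 *: u) t; rewrite cE// ler_norml subr_ge0 => /andP[].
have := ha n; have := hb n; rewrite !exprS -!mulrA; move: IHa IHb.
move: (4 ^+ n * a 0%N) (2 ^+ n * b 0%N) (a n) (b n) (a n.+1) (b n.+1).
by move=> *; split; lra.
Qed.

(* Linear growth in time for small [u] (a sequence [u n --> 0] violating it would contradict
   [semigroup_linear_bound]); doubling [u] then costs a factor 4, which gives [`|u| ^+ 2]. *)
Lemma charfun_bound (T e : R) : 0 < T -> 0 < e -> exists2 C : R, 0 <= C &
  forall (u : U) (x y : R), 0 <= x <= y ->
    1 - E (fun w => cos (L y u w - L x u w)) + `|E (fun w => sin (L y u w - L x u w))|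
    <= (y - x) * (e + C * `|u| ^+ 2).
Proof.
move=> T0 e0; have [r r0 hr] := charfun_small_linear T0 e0.
(* If [n.+1] is the least number of halvings that brings [u] into the ball of radius [r], then
   [4 ^ n * r ^ 2 <= |u| ^ 2], while the doublings cost [2 * 4 ^ n.+1 = 8 * 4 ^ n]. *)
exists (8 * e / r ^+ 2); first by rewrite divr_ge0 ?exprn_ge0// ?mulr_ge0// ltW.
move=> u x y xy; have /andP[x0 xy'] := xy.
rewrite (levy_incr_law HL _ xy (@measurable_cosT R) (@normr_cos_le1 R)).
rewrite (levy_incr_law HL _ xy (@measurable_sinT R) (@normr_sin_le1 R)).
have t0 : 0 <= y - x by rewrite subr_ge0.
have [ur|ur] := leP `|u| r.
  apply: le_trans (hr u (y - x) ur t0) _; rewrite ler_wpM2l// lerDl.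
  by rewrite mulr_ge0 ?exprn_ge0// divr_ge0 ?exprn_ge0// ?mulr_ge0// ltW.
have ex : exists n, `|u| <= 2 ^+ n * r.
  exists (Num.bound (`|u| / r)).
  rewrite -ler_pdivrMr// (le_trans (ltW (archi_boundP _)))//.
    by rewrite divr_ge0// ltW.
  by rewrite -natrX ler_nat ltnW// ltn_expl.
have [[|n] hn nmin] := ex_minnP ex; first by move: hn; rewrite expr0 mul1r leNgt ur.
have un : 2 ^+ n * r < `|u|.
  by rewrite ltNge; apply/negP => /nmin; rewrite ltnn.
pose v := (2 ^+ n.+1)^-1 *: u.
have p0 : 0 < 2 ^+ n.+1 :> R by rewrite exprn_gt0.
have uE : u = 2 ^+ n.+1 *: v by rewrite scalerA divff ?scale1r// gt_eqF.
have vr : `|v| <= r.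
  by rewrite /v normrZ gtr0_norm ?invr_gt0// ler_pdivrMl.
rewrite {1 2}uE; apply: le_trans (charfun_pow2 _ _ t0) _.
have := hr v _ vr t0; set k := 1 - _ + _ => hk.
have p4 : 0 <= 4 ^+ n.+1 :> R by rewrite exprn_ge0.
apply: (@le_trans _ _ (2 * 4 ^+ n.+1 * ((y - x) * e))).
  by rewrite ler_wpM2l// mulr_ge0.
have h4 : 4 ^+ n * r ^+ 2 <= `|u| ^+ 2.
  rewrite (_ : 4 ^+ n = (2 ^+ n) ^+ 2).
    by rewrite -exprMn lerXn2r ?nnegrE// ?mulr_ge0 ?exprn_ge0// ltW.
  by rewrite -exprM mulnC exprM; congr (_ ^+ _); rewrite expr2 -natrM.
have : 4 ^+ n <= `|u| ^+ 2 / r ^+ 2 by rewrite ler_pdivlMr// exprn_gt0.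
move=> h5; have -> : 4 ^+ n.+1 = 4 * 4 ^+ n :> R by rewrite exprS.
rewrite (_ : 2 * (4 * 4 ^+ n) * ((y - x) * e) = (y - x) * (8 * e * 4 ^+ n)); last by ring.
rewrite ler_wpM2l// (_ : 8 * e / r ^+ 2 * `|u| ^+ 2 = 8 * e * (`|u| ^+ 2 / r ^+ 2)); last by ring.
apply: ler_wpDl; first exact: ltW.
by rewrite ler_wpM2l// mulr_ge0// ltW.
Qed.

End CharacteristicFunction.

(** * Tail probabilities from characteristic functions *)

Section TruncationInequality.
Context (R : realType) (d : measure_display) (Om : measurableType d)
  (P : probability Om R).
Local Notation E f := (\int[P]_w f w).

Lemma integral_1Bcos (K x : R) : 0 < K -> x != 0 ->
  (\int[@lebesgue_measure R]_(l in `[0%R, K]) (1 - cos (l * x))%:E =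
    (K - sin (K * x) / x)%:E)%E.
Proof.
move=> K0 x0.
pose F (l : R) : R := l - sin (l * x) / x.
have dF l : is_derive l (1 : R) F (1 - cos (l * x)).
  rewrite /F; apply: is_deriveB.
  have h : is_derive l (1 : R) (fun l => l * x) x.
    by apply: is_derive_eq; rewrite scaler0 add0r /GRing.scale/= mulr1.
  have hs := is_derive1_comp (f := sin) (g := fun l => l * x) (is_derive_sin (l * x)) h.
  have hh := @is_deriveM _ _ _ (fun _ => x^-1) l 1 _ _ hs (is_derive_cst x^-1 l 1).
  have e : sin (l * x) *: (0 : R) + x^-1 *: (cos (l * x) * x : R) = cos (l * x).
    by rewrite scaler0 add0r /GRing.scale/=; field.
  by rewrite -[X in is_derive _ _ _ X]e; exact: hh.
have cF : continuous F.
  move=> l; apply/differentiable_continuous/derivable1_diffP.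
  exact: (@ex_derive _ _ _ _ _ _ _ (dF l)).
have cc : continuous (fun l : R => cos (l * x)).
  move=> l; apply: (@continuous_comp _ _ _ (fun l : R => l * x) cos); last exact: continuous_cos.
  by apply: cvgM; [exact: cvg_id|exact: cvg_cst].
rewrite (@continuous_FTC2 _ (fun l => 1 - cos (l * x)) F)//.
- by rewrite -EFinB /F mul0r sin0 mul0r !subr0.
- by apply: continuous_subspaceT => l; apply: cvgB; [exact: cvg_cst|exact: cc].
- split.
  + by move=> l _; exact: (@ex_derive _ _ _ _ _ _ _ (dF l)).
  + by apply: cvg_at_right_filter; exact: cF.
  + by apply: cvg_at_left_filter; exact: cF.
- by move=> l _; rewrite derive1E; exact: (@derive_val _ _ _ _ _ _ _ (dF l)).
Qed.

(** Average [1 - cos (l x)] over [l] in [0, K] with [K = 2 / a]: the result [1 - sin (K x) / (K x)]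
    is at least 1/2 as soon as [|x| > a], since then [K |x| > 2]. Tonelli exchanges this average
    with the expectation. *)
Lemma truncation_inequality (X : Om -> R) (a M : R) : measurable_fun setT X ->
  0 < a ->
  (forall l, 0 <= l <= 2 / a -> 1 - E (fun w => cos (l * X w)) <= M) ->
  fine (P [set w | a < `|X w|]) <= 2 * M.
Proof.
move=> mX a0 hM; pose K := 2 / a; have K0 : 0 < K by rewrite divr_gt0.
pose A := [set w | a < `|X w|]; have mA : measurable A by exact: measurable_gt_norm.
pose D := `[0%R, K]%classic : set (measurableTypeR R).
have mD : measurable D by exact: measurable_itv.
pose f (z : measurableTypeR R * Om) : \bar R :=
  ((\1_D z.1 * (1 - cos (z.1 * X z.2)))%:E)%E.
have mf : measurable_fun setT f.
  apply/measurable_EFinP; apply: measurable_funM.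
    by apply: measurableT_comp; [exact: measurable_indic|exact: measurable_fst].
  apply: measurable_funB; first exact: measurable_cst.
  apply: measurableT_comp; first exact: measurable_cosT.
  apply: measurable_funM; first exact: measurable_fst.
  by apply: measurableT_comp; [exact: mX|exact: measurable_snd].
have f0 z : (0 <= f z)%E.
  by rewrite lee_fin mulr_ge0 ?subr_ge0 ?cos_le1// indicE.
have fub := @fubini_tonelli _ _ _ _ R (@lebesgue_measure R) P f mf f0.
have lenD : @lebesgue_measure R D = K%:E.
  by rewrite lebesgue_measure_itv/= lte_fin K0 oppr0 adde0.
have up : (\int[@lebesgue_measure R]_x \int[P]_y f (x, y) <= (K * M)%:E)%E.
  apply: (@le_trans _ _ (\int[@lebesgue_measure R]_(x in D) M%:E)%E); last first.
    rewrite integral_cst// [X in (_ * X)%E](_ : _ = K%:E); last exact: lenD.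
    by rewrite mulrC EFinM.
  rewrite [leRHS]integral_mkcond; apply: ge0_le_integral => //.
  - by move=> x _; apply: integral_ge0.
  - exact: (measurable_fun_fubini_tonelli_F f mf f0).
  - by apply/(measurable_restrictT _ _).1; [exact: mD|exact: measurable_cst].
  move=> x _; rewrite patchE; case: ifPn => xD; last first.
    by rewrite integral0_eq// => w _; rewrite /f/= indicE (negbTE xD) mul0r.
  have xK : 0 <= x <= K by move: xD; rewrite inE /D /= in_itv.
  have b : bdd_meas (fun w => 1 - cos (x * X w)).
    by apply: bdd_measB; [exact: bdd_meas_cst|apply: bdd_meas_cos; exact: measurable_funM].
  have -> : (\int[P]_y f (x, y) = (E (fun w => 1 - cos (x * X w)))%:E)%E.
    rewrite /Rintegral fineK; last by apply: integrable_fin_num => //; exact: bdd_meas_int.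
    by apply: eq_integral => w _; rewrite /f/= indicE xD mul1r.
  rewrite lee_fin EB ?Ecst ?hM//; first exact: bdd_meas_cst.
  by apply: bdd_meas_cos; exact: measurable_funM.
have low : ((K / 2)%:E * P A <= \int[P]_y \int[@lebesgue_measure R]_x f (x, y))%E.
  rewrite -integral_cst// [leLHS]integral_mkcond; apply: ge0_le_integral => //.
  - by move=> w _; rewrite patchE; case: ifP => // _; rewrite lee_fin divr_ge0// ltW.
  - by apply/(measurable_restrictT _ _).1; [exact: mA|exact: measurable_cst].
  - exact: (measurable_fun_fubini_tonelli_G f mf f0).
  move=> w _; rewrite patchE; case: ifPn => wA; last exact: integral_ge0.
  have aX : a < `|X w| by rewrite inE in wA.
  have X0 : X w != 0 by rewrite -normr_gt0 (lt_trans a0).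
  have -> : (\int[@lebesgue_measure R]_x f (x, w) =
      \int[@lebesgue_measure R]_(l in `[0%R, K]) (1 - cos (l * X w))%:E)%E.
    rewrite [RHS]integral_mkcond; apply: eq_integral => l _.
    by rewrite patchE /f/= indicE; case: ifP => _; rewrite ?mul1r ?mul0r.
  rewrite integral_1Bcos// lee_fin.
  have : sin (K * X w) / X w <= K / 2.
    rewrite (le_trans (ler_norm _))// normrM normfV ler_pdivrMr ?normr_gt0//.
    rewrite (le_trans (normr_sin_le1 _))// /K.
    rewrite (_ : 2 / a / 2 * `|X w| = `|X w| / a); last by field; rewrite gt_eqF.
    by rewrite ler_pdivlMr// mul1r ltW.
  by lra.
have Pfin : P A = (fine (P A))%:E by rewrite fineK// fin_num_measure.
have := le_trans low (eq_ind _ (fun z => (z <= _)%E) up _ fub).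
rewrite Pfin -EFinM lee_fin => h.
rewrite -(ler_pM2l (_ : 0 < K / 2)) ?divr_gt0//.
by rewrite (le_trans h)// (_ : K / 2 * (2 * M) = K * M)//; field.
Qed.

End TruncationInequality.

(** * Borel functions with values in a normed space *)

Section Borel.
Context (R : realType) (d : measure_display) (S : measurableType d)
  (U : normedModType R).
Implicit Types f : S -> U.

Definition borel_fun f := forall O : set U, open O -> measurable (f @^-1` O).

Lemma borel_cst (u : U) : borel_fun (fun=> u).
Proof.
move=> O _; have [uO|uO] := pselect (O u).
  by rewrite (_ : _ @^-1` _ = setT)//; apply/seteqP; split.
by rewrite (_ : _ @^-1` _ = set0)//; apply/seteqP; split.
Qed.

(** In a general normed space a sum of two Borel functions may fail to be Borel. Adding a constant
    on a measurable set is a case distinction between [f] and a translate of [f], and iterating it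
    adds any simple function. *)
Lemma borel_add_if f (A : set S) (u : U) : borel_fun f -> measurable A ->
  borel_fun (fun s => f s + (if s \in A then u else 0)).
Proof.
move=> bf mA O oO.
have oOu : open ((fun x => x + u) @^-1` O).
  apply: open_comp => // x _.
  by apply: cvgD; [exact: cvg_id|exact: cvg_cst].
rewrite (_ : _ @^-1` O = (A `&` f @^-1` ((fun x => x + u) @^-1` O)) `|`
                         (~` A `&` f @^-1` O)).
  apply: measurableU; apply: measurableI => //; [exact: bf|exact: measurableC|exact: bf].
apply/seteqP; split => s /=.
  by case: ifPn; [rewrite inE; left|rewrite notin_setE addr0; right].
by move=> [[sA]|[sA]]; [rewrite mem_set|rewrite memNset// addr0].
Qed.

Lemma borel_norm f : borel_fun f -> measurable_fun setT (fun s => `|f s|).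
Proof.
move=> bf; apply: (measurability _ (RGenOInfty.measurableE R)) => // _ [_ [x ->] <-].
rewrite setTI (_ : _ @^-1` _ = f @^-1` ((fun y => `|y|) @^-1` [set z | x < z])).
  by apply: bf; apply: open_comp; [move=> y _; exact: norm_continuous|exact: open_gt].
by apply/seteqP; split => s /=; rewrite in_itv/= andbT.
Qed.

Lemma borel_norm2 f (D : set S) : borel_fun f ->
  measurable_fun D (fun s => (`|f s| ^+ 2)%:E).
Proof.
move=> bf; apply: measurable_funTS; apply/measurable_EFinP.
by apply: measurable_funX; exact: borel_norm.
Qed.

Lemma borel_simple f (r : seq (U * set S)) : borel_fun f -> simple_meas r ->
  borel_fun (fun s => f s + simple_eval r s).
Proof.
elim/last_ind: r => [|r p IH] bf mr.
  by under eq_fun do rewrite /simple_eval big_nil addr0.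
rewrite (_ : (fun s => _) = (fun s => (f s + simple_eval r s) +
    (if s \in p.2 then p.1 else 0))); last first.
  by apply/funext => s; rewrite /simple_eval -cats1 big_cat big_seq1 addrA.
apply: borel_add_if; last by apply: mr; rewrite mem_rcons inE eqxx.
by apply: IH => // q qr; apply: mr; rewrite mem_rcons inE qr orbT.
Qed.

End Borel.

(** * Step functions and their integrals *)

Section StepFunctions.
Context (R : realType) (U : normedModType R).
Implicit Types (phi psi : stepfun U) (T c : R).

Definition step_add phi psi :=
  StepFun (st_itv phi ++ st_itv psi) (st_pts phi ++ st_pts psi).
Definition step_scale c phi :=
  StepFun [seq (c *: p.1.1, p.1.2, p.2) | p <- st_itv phi]
          [seq (c *: q.1, q.2) | q <- st_pts phi].

Lemma step_evalD phi psi t :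
  step_eval (step_add phi psi) t = step_eval phi t + step_eval psi t.
Proof. by rewrite /step_eval /= !big_cat addrACA. Qed.

Lemma step_evalZ c phi t : step_eval (step_scale c phi) t = c *: step_eval phi t.
Proof.
rewrite /step_eval /= !big_map scalerDr !scaler_sumr.
by congr (_ + _); apply: eq_bigr => p _ /=; case: ifP => // _; rewrite scaler0.
Qed.

Lemma admissibleD T phi psi : step_admissible T phi -> step_admissible T psi ->
  step_admissible T (step_add phi psi).
Proof.
move=> [h1 h2] [k1 k2]; split => p; rewrite /= mem_cat => /orP[].
- exact: h1.
- exact: k1.
- exact: h2.
- exact: k2.
Qed.

Lemma admissibleZ T c phi : step_admissible T phi -> step_admissible T (step_scale c phi).
Proof.
move=> [h1 h2]; split => p /mapP[q qphi ->]/=; first exact: h1.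
exact: h2.
Qed.

Lemma borel_step phi : borel_fun (step_eval phi : measurableTypeR R -> U).
Proof.
pose l := [seq (p.1.1, `]p.1.2, p.2]%classic) | p <- st_itv phi] ++
          [seq (q.1, [set q.2]) | q <- st_pts phi] : seq (U * set (measurableTypeR R)).
rewrite (_ : step_eval phi = fun t => 0 + simple_eval l t); last first.
  apply/funext => t; rewrite add0r /simple_eval /step_eval big_cat !big_map/=.
  congr (_ + _); apply: eq_bigr => p _.
    by rewrite mem_setE in_itv.
  congr (if _ then _ else _); apply/idP/idP; first by move=> /eqP ->; rewrite inE.
  by rewrite inE /= => ->.
apply: borel_simple; first exact: borel_cst.
move=> p; rewrite mem_cat => /orP[/mapP[q _ ->]|/mapP[q _ ->]] /=.
  exact: measurable_itv.
exact: measurable_set1.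
Qed.

Definition energy T (f : R -> U) : \bar R :=
  (\int[@lebesgue_measure R]_(t in `[0%R, T]) (`|f t| ^+ 2)%:E)%E.

Lemma energy_ge0 T f : (0 <= energy T f)%E.
Proof. by apply: integral_ge0 => t _; rewrite lee_fin exprn_ge0. Qed.

Lemma energy_scale T c phi :
  (energy T (step_eval (step_scale c phi)) = (c ^+ 2)%:E * energy T (step_eval phi))%E.
Proof.
rewrite /energy -ge0_integralZl_EFin ?sqr_ge0//.
  apply: eq_integral => t _.
  by rewrite step_evalZ normrZ exprMn real_normK ?num_real// EFinM.
exact: (borel_norm2 (borel_step phi)).
Qed.

Section Refinement.
Context (T : R) (phi : stepfun U) (adm : step_admissible T phi) (T0 : 0 <= T).

(** The intervals of [phi] may overlap. The times of the point values are nodes as well, so that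
    [phi] is constant strictly between consecutive nodes. *)
Definition step_nodes : seq R :=
  sort <=%O (undup (0 :: T :: [seq p.1.2 | p <- st_itv phi] ++ [seq p.2 | p <- st_itv phi] ++
    [seq q.2 | q <- st_pts phi])).
(** The default [T] keeps [step_node j] in [0, T] for every [j]. *)
Definition step_node (j : nat) : R := nth T step_nodes j.
Definition step_value (j : nat) : U := \sum_(p <- st_itv phi)
  (if (p.1.2 <= step_node j) && (step_node j.+1 <= p.2) then p.1.1 else 0).
Definition step_count : nat := (size step_nodes).-1.

Let nodes_sorted : sorted <%O step_nodes.
Proof. by rewrite sort_lt_sorted undup_uniq. Qed.

Let nodes_in x : x \in step_nodes -> 0 <= x <= T.
Proof.
rewrite mem_sort mem_undup !inE !mem_cat.
case/or4P => [/eqP->|/eqP->|/mapP[p pphi ->]|/orP[/mapP[p pphi ->]|/mapP[q qphi ->]]].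
- by rewrite lexx.
- by rewrite lexx T0.
- by case: (adm.1 p pphi) => /andP[-> /le_trans]; exact.
- by case: (adm.1 p pphi) => /andP[h1 h2 ->]; rewrite (le_trans h1).
- exact: adm.2.
Qed.

Lemma step_node_in j : 0 <= step_node j <= T.
Proof.
rewrite /step_node; case: (ltnP j (size step_nodes)) => js.
  by apply: nodes_in; rewrite mem_nth.
by rewrite nth_default// lexx T0.
Qed.

Let count_lt j : (j < step_count)%N -> (j.+1 < size step_nodes)%N.
Proof. by rewrite /step_count; case: (size _). Qed.

Lemma step_node_lt j : (j < step_count)%N -> step_node j < step_node j.+1.
Proof.
move=> /count_lt js; rewrite lt_sorted_ltn_nth// inE//; exact: ltnW.
Qed.

Let node_le i j : (i < size step_nodes)%N -> (j < size step_nodes)%N ->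
  (step_node i <= step_node j) = (i <= j)%N.
Proof. by move=> *; rewrite lt_sorted_leq_nth. Qed.

Let node_lt i j : (i < size step_nodes)%N -> (j < size step_nodes)%N ->
  (step_node i < step_node j) = (i < j)%N.
Proof. by move=> *; rewrite lt_sorted_ltn_nth. Qed.

Let node_index x : x \in step_nodes ->
  (index x step_nodes < size step_nodes)%N /\ step_node (index x step_nodes) = x.
Proof. by move=> xn; rewrite index_mem; split=> //; rewrite /step_node nth_index. Qed.

Let itv_nodes p : p \in st_itv phi -> p.1.2 \in step_nodes /\ p.2 \in step_nodes.
Proof.
move=> pphi; rewrite !mem_sort !mem_undup !inE !mem_cat.
split; first by rewrite (map_f (fun p => p.1.2) pphi) !orbT.
by rewrite (map_f (fun p => p.2) pphi) !orbT.
Qed.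

(** Both ends of an interval of [phi] are nodes, so the increment telescopes over the cells that the
    interval contains. *)
Lemma step_telescope (F : R -> R) p : p \in st_itv phi ->
  F p.2 - F p.1.2 = \sum_(j < step_count)
    (if (p.1.2 <= step_node j) && (step_node j.+1 <= p.2)
     then F (step_node j.+1) - F (step_node j) else 0).
Proof.
move=> pphi; have [an bn] := itv_nodes pphi.
have [/andP[_ ab] _] := adm.1 p pphi.
have [ia] := node_index an; move: (index _ _) ia => a ia ea.
have [ib] := node_index bn; move: (index _ _) ib => b ib eb.
have leab : (a <= b)%N by rewrite -node_le// ea eb.
transitivity (\sum_(a <= j < b) (F (step_node j.+1) - F (step_node j))).
  by rewrite (telescope_sumr (fun j => F (step_node j)))// ea eb.
have bm : (b <= step_count)%N by rewrite /step_count; case: (size _) ib.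
rewrite (big_nat_widenl a 0%N)// (big_nat_widen 0%N b step_count)// big_mkord big_mkcond/=.
apply: eq_bigr => j _; have js := count_lt (ltn_ord j).
by rewrite -ea -eb !node_le// ltnW.
Qed.

Lemma step_eval_open j t : (j < step_count)%N -> step_node j < t < step_node j.+1 ->
  step_eval phi t = step_value j.
Proof.
move=> jm /andP[tj tj1]; have js := count_lt jm; have js' := ltnW js.
rewrite /step_eval /step_value [X in _ + X]big1_seq ?addr0 => [|q /andP[_ qphi]].
  rewrite big_seq [RHS]big_seq; apply: eq_bigr => p pphi.
  have [an bn] := itv_nodes pphi.
  have -> : (p.1.2 < t) = (p.1.2 <= step_node j).
    have [ia] := node_index an; move: (index _ _) ia => a ia <-.
    rewrite node_le//; apply/idP/idP => [h|].
      by have := lt_trans h tj1; rewrite node_lt.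
    by rewrite -node_le// => /le_lt_trans; exact.
  have -> // : (t <= p.2) = (step_node j.+1 <= p.2).
  have [ib] := node_index bn; move: (index _ _) ib => b ib <-.
  rewrite node_le//; apply/idP/idP => [h|].
    by have := lt_le_trans tj h; rewrite node_lt.
  by rewrite -node_le// => h; rewrite ltW// (lt_le_trans tj1).
case: eqP => // tq.
have qn : q.2 \in step_nodes.
  by rewrite mem_sort mem_undup !inE !mem_cat (map_f (fun q => q.2) qphi) !orbT.
have [iq] := node_index qn; move: (index _ _) iq => i iq qE.
by move: tj tj1; rewrite tq -qE !node_lt// ltnS => h1; rewrite leqNgt h1.
Qed.

(** An inequality is enough for the tail bounds; it permits integrating over the open cells and
    discarding the nodes. *)
Lemma step_energy_le :
  ((\sum_(j < step_count) (step_node j.+1 - step_node j) * `|step_value j| ^+ 2)%:E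
    <= energy T (step_eval phi))%E.
Proof.
pose f (t : R) := ((`|step_eval phi t| ^+ 2)%:E)%E.
have f0 (D : set R) t : D t -> (0 <= f t)%E by rewrite lee_fin exprn_ge0.
have mf D : measurable_fun (D : set (measurableTypeR R)) f.
  exact: (borel_norm2 (borel_step phi)).
suff main k : (k <= step_count)%N ->
  ((\sum_(j < k) (step_node j.+1 - step_node j) * `|step_value j| ^+ 2)%:E <=
    \int[@lebesgue_measure R]_(t in `[0%R, step_node k]) f t)%E.
  apply: le_trans (main _ (leqnn _)) _; apply: ge0_subset_integral => //.
  - exact: f0.
  - by apply: subset_itvl; rewrite bnd_simp; case/andP: (step_node_in step_count).
elim: k => [_|k IH km]; first by rewrite big_ord0; apply: integral_ge0 => t; exact: f0.
have [/andP[tk0 _] /andP[tk1 _]] := (step_node_in k, step_node_in k.+1).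
have ltk := step_node_lt km.
rewrite big_ord_recr/= EFinD.
apply: (@le_trans _ _ (\int[@lebesgue_measure R]_(t in `[0%R, step_node k] `|`
    `]step_node k, step_node k.+1[) f t)%E); last first.
  apply: ge0_subset_integral => //; [exact: measurableU|exact: f0|].
  move=> t /=; rewrite !in_itv/= => -[/andP[-> h]|/andP[h1 h2]].
    by rewrite (le_trans h)// ltW.
  by rewrite (ltW h2) (le_trans tk0 (ltW h1)).
rewrite ge0_integral_setU//; last 2 first.
- exact: f0.
- rewrite disj_set2E; apply/eqP/seteqP; split => // t [] /=; rewrite !in_itv/=.
  by move=> /andP[_ h] /andP[h1 _]; move: (le_lt_trans h h1); rewrite ltxx.
apply: leeD; first exact: IH (ltnW km).
rewrite (eq_integral (fun=> (`|step_value k| ^+ 2)%:E)); last first.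
  move=> t; rewrite inE /= in_itv/= => tk.
  by rewrite /f (step_eval_open km tk).
have len : @lebesgue_measure R `]step_node k, step_node k.+1[%classic =
    (step_node k.+1 - step_node k)%:E.
  by rewrite lebesgue_measure_itv/= lte_fin ltk.
rewrite integral_cst// [X in (_ * X)%E](_ : _ = (step_node k.+1 - step_node k)%:E); last exact: len.
by rewrite -EFinM mulrC.
Qed.

End Refinement.

End StepFunctions.

Section StepIntegralBound.
Context (R : realType) (U : normedModType R).
Context (d : measure_display) (Om : measurableType d) (P : probability Om R).
Context (L : R -> U -> Om -> R) (HL : cyl_levy P L).
Implicit Types (phi psi : stepfun U) (T a : R).
Local Notation E f := (\int[P]_w f w).

Lemma measurable_step_int T phi : step_admissible T phi ->
  measurable_fun setT (step_int L phi).
Proof.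
move=> [adm _]; rewrite /step_int.
under eq_fun do rewrite big_seq big_mkcond/=.
pose h p w := if p \in st_itv phi then L p.2 p.1.1 w - L p.1.2 p.1.1 w else 0.
apply: (@measurable_sum _ _ _ _ _ (st_itv phi) h) => p; rewrite /h.
have [pphi|pphi] := boolP (p \in st_itv phi); last exact: measurable_cst.
have [/andP[p0 pp] _] := adm p pphi.
by apply: (levy_incr_meas HL) => //; exact: le_trans p0 pp.
Qed.

Lemma step_intD phi psi w :
  step_int L (step_add phi psi) w = step_int L phi w + step_int L psi w.
Proof. by rewrite /step_int /= big_cat. Qed.

Lemma step_intZ T c phi : step_admissible T phi ->
  {ae P, forall w, step_int L (step_scale c phi) w = c * step_int L phi w}.
Proof.
move=> [adm _]; rewrite /step_int /=.
elim: (st_itv phi) adm => [|p r IH] adm.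
  by apply: aeW => w; rewrite !big_nil mulr0.
have [/andP[p0 pp] _] := adm p (mem_head _ _).
have {}IH : {ae P, forall w, \sum_(q <- [seq (c *: q.1.1, q.1.2, q.2) | q <- r])
    (L q.2 q.1.1 w - L q.1.2 q.1.1 w) = c * \sum_(q <- r) (L q.2 q.1.1 w - L q.1.2 q.1.1 w)}.
  by apply: IH => q qr; apply: adm; rewrite inE qr orbT.
apply: filterS3 IH (levyZ HL c p.1.1 p0) (levyZ HL c p.1.1 (le_trans p0 pp)) => w.
by rewrite /= !big_cons => -> /= -> ->; ring.
Qed.

Let levy_comb t (I : Type) (r : seq I) (b : I -> bool) (F : I -> U) l : 0 <= t ->
  {ae P, forall w, L t (l *: \sum_(i <- r) (if b i then F i else 0)) w =
    l * \sum_(i <- r) (if b i then L t (F i) w else 0)}.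
Proof.
move=> t0; have hZ := levyZ HL l (\sum_(i <- r) (if b i then F i else 0)) t0.
suff hS : {ae P, forall w, L t (\sum_(i <- r) (if b i then F i else 0)) w =
    \sum_(i <- r) (if b i then L t (F i) w else 0)}.
  by apply: filterS2 hZ hS => w -> ->.
elim: r {hZ} => [|i r IH].
  by apply: filterS (levy_u0 HL t0) => w; rewrite !big_nil => ->.
apply: filterS3 IH (levy_u0 HL t0)
  (levyD HL (if b i then F i else 0) (\sum_(i <- r) (if b i then F i else 0)) t0) => w.
rewrite !big_cons => h1 h0 ->; rewrite h1; congr (_ + _).
by case: (b i).
Qed.

(** The intervals of [phi] may overlap, so the terms of [step_int] need not be independent; those
    over the cells are. The factor [l] is moved into the vectors, so that characteristic functions
    are only ever evaluated at 1. *)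
Lemma step_int_nodes T phi l : step_admissible T phi -> 0 <= T ->
  let t := step_node T phi in let v := step_value T phi in
  {ae P, forall w, l * step_int L phi w = \sum_(j < step_count T phi)
    (L (t j.+1) (l *: v j) w - L (t j) (l *: v j) w)}.
Proof.
move=> adm T0 t v.
have t0 j : 0 <= t j by case/andP: (step_node_in adm T0 j).
pose b j (p : U * R * R) := (p.1.2 <= t j) && (t j.+1 <= p.2).
have h1 : {ae P, forall w, forall j, L (t j.+1) (l *: v j) w =
    l * \sum_(p <- st_itv phi) (if b j p then L (t j.+1) p.1.1 w else 0)}.
  by apply: ae_foralln => j; exact: levy_comb.
have h0 : {ae P, forall w, forall j, L (t j) (l *: v j) w =
    l * \sum_(p <- st_itv phi) (if b j p then L (t j) p.1.1 w else 0)}.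
  by apply: ae_foralln => j; exact: levy_comb.
apply: filterS2 h1 h0 => w h1 h0.
under eq_bigr do rewrite h1 h0 -mulrBr -sumrB.
rewrite -mulr_sumr; congr (_ * _); rewrite exchange_big/= /step_int.
rewrite big_seq [RHS]big_seq; apply: eq_bigr => p pphi.
rewrite (step_telescope adm (fun s => L s p.1.1 w) pphi).
by apply: eq_bigr => j _; rewrite -/(t j) -/(t j.+1) -/(b j p); case: ifP => //; rewrite subrr.
Qed.

Lemma step_int_charfun T e : 0 < T -> 0 < e -> exists2 C : R, 0 <= C &
  forall phi, step_admissible T phi -> forall l : R,
  (((1 - E (fun w => cos (l * step_int L phi w)))%:E <=
    (T * e)%:E + (C * l ^+ 2)%:E * energy T (step_eval phi))%E).
Proof.
move=> T0 e0; have [C C0 hC] := charfun_bound HL T0 e0; exists C => // phi adm l.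
have T0' := ltW T0.
set t := step_node T phi; set v := step_value T phi; set m := step_count T phi.
have t0 j : 0 <= t j by case/andP: (step_node_in adm T0' j).
have tlt j : (j < m)%N -> t j < t j.+1 by exact: step_node_lt.
pose X j w := L (t j.+1) (l *: v j) w - L (t j) (l *: v j) w.
have mX j : measurable_fun setT (X j) by apply: (levy_incr_meas HL).
have mphi := measurable_step_int adm.
have -> : E (fun w => cos (l * step_int L phi w)) = E (fun w => cos (\sum_(j < m) X j w)).
  apply: ae_eq_E.
  - by apply: bdd_meas_cos; exact: measurable_funM.
  - by apply: bdd_meas_cos; exact: measurable_sum.
  - by apply: filterS (step_int_nodes l adm T0') => w ->.
apply: (@le_trans _ _ (T * e + C * l ^+ 2 * \sum_(j < m) (t j.+1 - t j) * `|v j| ^+ 2)%:E).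
  rewrite lee_fin.
  have := indep_cos_sum_ge mX (levy_incr_indep HL (fun j => l *: v j) t0 tlt) (leqnn m).
  move=> /le_trans; apply.
  apply: (@le_trans _ _ (\sum_(j < m) ((t j.+1 - t j) * e +
      C * l ^+ 2 * ((t j.+1 - t j) * `|v j| ^+ 2)))).
    apply: ler_sum => j _.
    apply: le_trans (hC (l *: v j) (t j) (t j.+1) _) _.
      by rewrite t0/= ltW// tlt.
    rewrite normrZ exprMn real_normK ?num_real// le_eqVlt; apply/orP; left.
    by apply/eqP; ring.
  rewrite big_split/= -mulr_sumr lerD2r -mulr_suml ler_wpM2r//; first exact: ltW.
  (* The lengths of the cells telescope to at most [T], which is the origin of [T * e]. *)
  rewrite -(big_mkord xpredT (fun j => t j.+1 - t j)) telescope_sumr//.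
  case/andP: (step_node_in adm T0' m) => _ h; rewrite lerBlDr (le_trans h)// lerDl//.
rewrite EFinD leeD2l// EFinM lee_wpmul2l//.
  by rewrite lee_fin mulr_ge0// sqr_ge0.
exact: step_energy_le.
Qed.

Lemma step_eval_bounded phi : exists2 M : R, 0 <= M & forall t, `|step_eval phi t| <= M.
Proof.
exists (\sum_(p <- st_itv phi) `|p.1.1| + \sum_(q <- st_pts phi) `|q.1|).
  by rewrite addr_ge0// sumr_ge0.
move=> t; rewrite (le_trans (ler_normD _ _))// lerD//.
  rewrite (le_trans (ler_norm_sum _ _ _))// ler_sum// => p _.
  by case: ifP => // _; rewrite normr0.
rewrite (le_trans (ler_norm_sum _ _ _))// ler_sum// => p _.
by case: ifP => // _; rewrite normr0.
Qed.

Lemma energy_le_cst T (f : R -> U) (M : R) : 0 <= T -> 0 <= M ->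
  measurable_fun (`[0%R, T]%classic : set (measurableTypeR R)) (fun t => (`|f t| ^+ 2)%:E) ->
  (forall t, 0 <= t <= T -> `|f t| <= M) ->
  (energy T f <= (M ^+ 2 * T)%:E)%E.
Proof.
move=> T0 M0 mf fM.
have len : @lebesgue_measure R `[0%R, T]%classic = T%:E.
  rewrite lebesgue_measure_itv/= lte_fin.
  by case: ltgtP T0 => // [T0 _|<- _] //; rewrite ?oppr0 ?adde0.
apply: (@le_trans _ _ (\int[@lebesgue_measure R]_(t in `[0%R, T]) (M ^+ 2)%:E)%E).
  apply: ge0_le_integral => //.
  by move=> t /=; rewrite in_itv/= => tT; rewrite lee_fin lerXn2r ?nnegrE// fM.
rewrite integral_cst// [X in (_ * X)%E](_ : _ = T%:E); last exact: len.
by rewrite EFinM.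
Qed.

Lemma energy_step_fin T phi : 0 <= T -> energy T (step_eval phi) \is a fin_num.
Proof.
move=> T0; have [M M0 hM] := step_eval_bounded phi.
rewrite ge0_fin_numE ?energy_ge0//.
apply: le_lt_trans (energy_le_cst T0 M0 _ (fun t _ => hM t)) _; last exact: ltry.
exact: (borel_norm2 (borel_step phi)).
Qed.

Lemma step_int_prob T e a : 0 < T -> 0 < e -> 0 < a -> exists2 C : R, 0 <= C &
  forall phi, step_admissible T phi ->
    fine (P [set w | a < `|step_int L phi w|]) <= e + C * fine (energy T (step_eval phi)).
Proof.
(* The bound [T * e] of [step_int_charfun] is doubled by the truncation inequality, hence
   [e / (2 * T)]. Frequencies go up to [2 / a], hence the square of [2 / a] in the constant. *)
move=> T0 e0 a0; have e2 : 0 < e / (2 * T) by rewrite divr_gt0// mulr_gt0.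
have [C C0 hC] := step_int_charfun T0 e2.
exists (2 * (C * (2 / a) ^+ 2)); first by rewrite mulr_ge0// mulr_ge0// sqr_ge0.
move=> phi adm; set en := energy _ _.
have enE : en = (fine en)%:E by rewrite fineK// energy_step_fin// ltW.
have en0 : 0 <= fine en by rewrite fine_ge0// energy_ge0.
apply: le_trans (truncation_inequality (M := T * (e / (2 * T)) + C * (2 / a) ^+ 2 * fine en)
  (measurable_step_int adm) a0 _) _.
  move=> l /andP[l0 la]; have := hC phi adm l; rewrite -/en enE -EFinM -EFinD lee_fin.
  move=> /le_trans; apply; rewrite lerD2l ler_wpM2r// ler_wpM2l// lerXn2r ?nnegrE//.
  by rewrite divr_ge0// ltW.
rewrite le_eqVlt; apply/orP; left; apply/eqP; field.
by rewrite !gt_eqF.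
Qed.

End StepIntegralBound.

(** * The square function *)

Section RademacherAverages.
Context (R : realType).

(* The average of [F] over all [x +- y_1 +- ... +- y_n], for [l = [:: y_1; ...; y_n]]. *)
Fixpoint rademacher (V : Type) (add sub : V -> V -> V) (l : seq V) (x : V) (F : V -> R) : R :=
  if l is y :: l' then
    (rademacher add sub l' (add x y) F + rademacher add sub l' (sub x y) F) / 2
  else F x.

Lemma rademacher_le (V : Type) (add sub : V -> V -> V) l x F G :
  (forall z, F z <= G z) -> rademacher add sub l x F <= rademacher add sub l x G.
Proof.
move=> FG; elim: l x => [|y l IH] x /=; first exact: FG.
by rewrite ler_pM2r ?invr_gt0// lerD.
Qed.

Lemma rademacher_lin (V : Type) (add sub : V -> V -> V) l x F G (a b c : R) :
  rademacher add sub l x (fun z => a * F z + b * G z + c) =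
  a * rademacher add sub l x F + b * rademacher add sub l x G + c.
Proof.
by elim: l x => [|y l IH] x //=; rewrite !IH; field.
Qed.

Local Notation radR := (@rademacher R (fun x y : R => x + y) (fun x y => x - y)).

Lemma rademacher_sqr l x : radR l x (fun z => z ^+ 2) = x ^+ 2 + \sum_(y <- l) y ^+ 2.
Proof.
elim: l x => [|y l IH] x /=; first by rewrite big_nil addr0.
by rewrite !IH big_cons; field.
Qed.

(** The fourth-moment case of the Khintchine inequality, started at [x]. Averaging over one more
    sign leaves a slack of exactly [2 * y ^ 4]. *)
Lemma rademacher_pow4 l x (S := \sum_(y <- l) y ^+ 2) :
  radR l x (fun z => z ^+ 4) <= x ^+ 4 + 6 * x ^+ 2 * S + 3 * S ^+ 2.
Proof.
rewrite /S {S}; elim: l x => [|y l IH] x /=.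
  by rewrite big_nil mulr0 expr0n/= mulr0 !addr0.
rewrite big_cons; have := IH (x + y); have := IH (x - y).
set S := \sum_(_ <- l) _; set A := radR _ _ _; set B := radR _ _ _ => hA hB.
apply: (@le_trans _ _ ((((x + y) ^+ 4 + 6 * (x + y) ^+ 2 * S + 3 * S ^+ 2) +
  ((x - y) ^+ 4 + 6 * (x - y) ^+ 2 * S + 3 * S ^+ 2)) / 2)).
  by rewrite ler_pM2r ?invr_gt0// lerD.
rewrite -subr_ge0 [X in 0 <= X](_ : _ = 2 * y ^+ 4); last by field.
by rewrite mulr_ge0// exprn_even_ge0.
Qed.

(* Paley-Zygmund: with [q = z^2 / S], one has [(q - 1/2)/3 - q^2/36 <= 1_(q > 1/2)], and
   the moments [E q = 1], [E q^2 <= 3] give expectation at least 1/12 to the left-hand side. *)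
Lemma rademacher_anticoncentration (l : seq R) (a : R) : 0 <= a ->
  2 * a ^+ 2 < \sum_(y <- l) y ^+ 2 ->
  1 / 12 <= radR l 0 (fun z => (a < `|z|)%R%:R).
Proof.
move=> a0; set S := \sum_(_ <- _) _ => aS.
have S0 : 0 < S by rewrite (le_lt_trans _ aS)// mulr_ge0// sqr_ge0.
apply: le_trans (@rademacher_le _ _ _ l 0
  (fun z => (3 * S)^-1 * z ^+ 2 + (- (36 * S ^+ 2)^-1) * z ^+ 4 + (- 6^-1)) _ _); last first.
  move=> z; set q := z ^+ 2 / S.
  have -> : (3 * S)^-1 * z ^+ 2 + - (36 * S ^+ 2)^-1 * z ^+ 4 + - 6^-1 =
    (q - 2^-1) / 3 - q ^+ 2 / 36 by rewrite /q; field; rewrite gt_eqF.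
  case: ltP => /= za.
    have : 0 <= (q / 6 - 1) ^+ 2 by exact: sqr_ge0.
    by lra.
  have : q <= 2^-1.
    rewrite ler_pdivrMr// -real_normK ?num_real//.
    have : `|z| ^+ 2 <= a ^+ 2 by rewrite lerXn2r ?nnegrE.
    by lra.
  by have := sqr_ge0 q; lra.
rewrite rademacher_lin rademacher_sqr -/S.
have := rademacher_pow4 l 0; rewrite -/S; set Q := radR _ _ _ => hQ.
have hQ' : (36 * S ^+ 2)^-1 * Q <= 12^-1.
  rewrite mulrC ler_pdivrMr ?mulr_gt0 ?exprn_gt0//.
  by move: hQ; rewrite !expr0n/= !mulr0 mul0r !add0r; lra.
rewrite expr0n/= add0r (_ : (3 * S)^-1 * S = 3^-1); last by field; rewrite gt_eqF.
by lra.
Qed.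

End RademacherAverages.

Section SquareFunction.
Context (R : realType) (U : normedModType R).
Hypothesis parallelogram : forall u v : U,
  `|u + v| ^+ 2 + `|u - v| ^+ 2 = 2 * (`|u| ^+ 2 + `|v| ^+ 2).
Context (d : measure_display) (Om : measurableType d) (P : probability Om R).
Context (L : R -> U -> Om -> R) (HL : cyl_levy P L).
Implicit Types (phi psi : stepfun U) (T a : R).
Local Notation E f := (\int[P]_w f w).
Local Notation radR := (@rademacher R R (fun x y : R => x + y) (fun x y => x - y)).
Let step_sub phi psi := step_add phi (step_scale (-1) psi).
Local Notation radS := (rademacher (@step_add R U) step_sub).

Let adm_sub T phi psi : step_admissible T phi -> step_admissible T psi ->
  step_admissible T (step_sub phi psi).
Proof. by move=> *; apply: admissibleD => //; exact: admissibleZ. Qed.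

Lemma energy_parallelogram T phi psi : 0 <= T ->
  fine (energy T (step_eval (step_add phi psi))) +
  fine (energy T (step_eval (step_sub phi psi))) =
  2 * (fine (energy T (step_eval phi)) + fine (energy T (step_eval psi))).
Proof.
move=> T0; have f phi' := energy_step_fin phi' T0.
have m phi' := borel_norm2 (D := `[0%R, T]%classic) (borel_step phi').
have p0 phi' (t : R) : (0 <= (`|step_eval phi' t| ^+ 2)%:E)%E.
  by rewrite lee_fin exprn_ge0.
suff /(congr1 fine) : (energy T (step_eval (step_add phi psi)) +
    energy T (step_eval (step_sub phi psi)) =
    2%:E * (energy T (step_eval phi) + energy T (step_eval psi)))%E.
  rewrite fineM//; last by rewrite fin_numD !f.
  rewrite (fineD (f (step_add phi psi)) (f (step_sub phi psi))) (fineD (f phi) (f psi)) => h.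
  exact: h.
rewrite /energy -!ge0_integralD//.
rewrite -ge0_integralZl_EFin//.
- apply: eq_integral => t _; rewrite !step_evalD step_evalZ scaleN1r.
  by rewrite -!EFinD parallelogram EFinM.
- by move=> t _; apply: adde_ge0; exact: p0.
- by apply: emeasurable_funD; exact: m.
all: exact: m.
Qed.

Lemma rademacher_energy T l phi : 0 <= T ->
  radS l phi (fun psi => fine (energy T (step_eval psi))) =
  fine (energy T (step_eval phi)) + \sum_(psi <- l) fine (energy T (step_eval psi)).
Proof.
move=> T0; elim: l phi => [|psi l IH] phi /=; first by rewrite big_nil addr0.
rewrite !IH big_cons; have := energy_parallelogram phi psi T0; lra.
Qed.

(** The tail bound holds for admissible step functions only; these are stable under the sums and
    differences that the average visits. *)
Lemma rademacher_step_le T (l : seq (stepfun U)) phi (F G : stepfun U -> R) :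
  (forall psi, step_admissible T psi -> F psi <= G psi) ->
  (forall psi, List.In psi l -> step_admissible T psi) -> step_admissible T phi ->
  radS l phi F <= radS l phi G.
Proof.
move=> FG; elim: l phi => [|psi l IH] phi adml admphi /=; first exact: FG.
rewrite ler_pM2r ?invr_gt0// lerD// IH//.
- by move=> psi' h; apply: adml; right.
- by apply: admissibleD => //; apply: adml; left.
- by move=> psi' h; apply: adml; right.
- by apply: adm_sub => //; apply: adml; left.
Qed.

Let bdd_meas_gt a (X : Om -> R) : measurable_fun setT X ->
  bdd_meas (fun w => (a < `|X w|)%R%:R : R).
Proof.
move=> mX; rewrite (_ : (fun w => _) = \1_[set w | a < `|X w|]).
  by apply: bdd_meas_indic; exact: measurable_gt_norm.
apply/funext => w; rewrite indicE; congr (nat_of_bool _)%:R.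
by apply/idP/idP; rewrite inE.
Qed.

Let bdd_meas_rad a (l : seq (Om -> R)) (X : Om -> R) :
  (forall Y, List.In Y l -> measurable_fun setT Y) -> measurable_fun setT X ->
  bdd_meas (fun w => radR [seq Y w | Y <- l] (X w) (fun z => (a < `|z|)%R%:R)).
Proof.
elim: l X => [|Y l IH] X ml mX /=; first exact: bdd_meas_gt.
have mY : measurable_fun setT Y by apply: ml; left.
apply: bdd_measM; last exact: bdd_meas_cst.
apply: bdd_measD; apply: IH; [|exact: measurable_funD| |exact: measurable_funB];
  by move=> Z h; apply: ml; right.
Qed.

(** Exchanges the average over signs with the expectation: afterwards [w] is fixed, the integrals
    are real numbers, and anticoncentration applies pointwise. *)
Lemma rademacher_prob T a (l : seq (stepfun U)) phi :
  (forall psi, List.In psi l -> step_admissible T psi) -> step_admissible T phi ->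
  radS l phi (fun psi => fine (P [set w | a < `|step_int L psi w|])) =
  E (fun w => radR [seq step_int L psi w | psi <- l] (step_int L phi w)
    (fun z => (a < `|z|)%R%:R)).
Proof.
have mstep psi : step_admissible T psi -> measurable_fun setT (step_int L psi).
  exact: (measurable_step_int HL).
have brad (l' : seq (stepfun U)) (X : Om -> R) : (forall psi, List.In psi l' -> step_admissible T psi) ->
    measurable_fun setT X ->
    bdd_meas (fun w => radR [seq step_int L psi w | psi <- l'] (X w) (fun z => (a < `|z|)%R%:R)).
  move=> adml mX.
  rewrite (_ : (fun w => _) = (fun w => radR [seq Y w | Y <- map (step_int L) l'] (X w)
    (fun z => (a < `|z|)%R%:R))); last by apply/funext => w; rewrite -map_comp.
  apply: bdd_meas_rad => // Y /List.in_map_iff[psi [<- hpsi]].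
  by apply: mstep; exact: adml.
elim: l phi => [|psi l IH] phi adml admphi /=.
  rewrite -Eindic; last by apply: measurable_gt_norm; exact: mstep.
  apply: eq_Rintegral => w _; rewrite indicE; congr (nat_of_bool _)%:R.
  by apply/idP/idP; rewrite inE.
have admpsi : step_admissible T psi by apply: adml; left.
have adml' psi' : List.In psi' l -> step_admissible T psi' by move=> h; apply: adml; right.
have mD : measurable_fun setT (fun w => step_int L phi w + step_int L psi w).
  by apply: measurable_funD; exact: mstep.
have mB : measurable_fun setT (fun w => step_int L phi w - step_int L psi w).
  by apply: measurable_funB; exact: mstep.
rewrite !IH//; [|exact: adm_sub|exact: admissibleD].
have -> : E (fun w => radR [seq step_int L p w | p <- l] (step_int L (step_sub phi psi) w)
      (fun z => (a < `|z|)%R%:R)) =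
    E (fun w => radR [seq step_int L p w | p <- l] (step_int L phi w - step_int L psi w)
      (fun z => (a < `|z|)%R%:R)).
  apply: ae_eq_E.
  - by apply: brad => //; apply: mstep; exact: adm_sub.
  - exact: brad.
  apply: filterS (step_intZ HL (-1) admpsi) => w h.
  by rewrite step_intD h mulN1r.
under eq_Rintegral do rewrite step_intD.
have b1 := brad l _ adml' mD; have b2 := brad l _ adml' mB.
move: b1 b2; set F1 := fun w => _; set F2 := fun w => _ => b1 b2.
have -> : E (fun w => (F1 w + F2 w) / 2) = E (fun w => 2^-1 * (F1 w + F2 w)).
  by apply: eq_Rintegral => w _; rewrite mulrC.
by rewrite EZ ?ED 1?mulrC//; exact: bdd_measD.
Qed.

(* For every choice of signs [step_int_prob] controls the signed sum, the parallelogram law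
   averages its energy, and anticoncentration recovers the square function. *)
Lemma square_function_prob T e a : 0 < T -> 0 < e -> 0 < a -> exists2 C : R, 0 <= C &
  forall l : seq (stepfun U), (forall psi, List.In psi l -> step_admissible T psi) ->
    fine (P [set w | a < \sum_(psi <- l) step_int L psi w ^+ 2]) <=
    e + C * \sum_(psi <- l) fine (energy T (step_eval psi)).
Proof.
(* [b] is chosen so that [2 * b ^ 2 = a], the threshold of [rademacher_anticoncentration]; its 1/12
   is paid for by [e / 12] and [12 * C]. *)
move=> T0 e0 a0; pose b := Num.sqrt (a / 2).
have b0 : 0 < b by rewrite sqrtr_gt0 divr_gt0.
have b2 : 2 * b ^+ 2 = a by rewrite sqr_sqrtr; [field|rewrite divr_ge0// ltW].
have [C C0 hC] := step_int_prob HL T0 (divr_gt0 e0 (ltr0n _ 12)) b0.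
exists (12 * C); first by rewrite mulr_ge0.
move=> l adml; pose phi0 : stepfun U := StepFun [::] [::].
have adm0 : step_admissible T phi0 by split.
set A := [set w | _].
have mS : measurable_fun setT (fun w => \sum_(psi <- l) step_int L psi w ^+ 2).
  elim: l adml {A} => [|psi l IH] adml.
    by under eq_fun do rewrite big_nil; exact: measurable_cst.
  under eq_fun do rewrite big_cons.
  apply: measurable_funD; last by apply: IH => p h; apply: adml; right.
  by apply: measurable_funX; apply: (measurable_step_int HL (T := T)); apply: adml; left.
have mA : measurable A.
  rewrite (_ : A = (fun w => \sum_(psi <- l) step_int L psi w ^+ 2) @^-1` `]a, +oo[).
    by rewrite -[_ @^-1` _]setTI; exact: mS.
  by apply/seteqP; split => w /=; rewrite in_itv/= andbT.
have low : 12^-1 * fine (P A) <= radS l phi0 (fun psi => fine (P [set w | b < `|step_int L psi w|])).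
  rewrite (rademacher_prob _ adml adm0) -(Eindic P mA) -EZ; last exact: bdd_meas_indic.
  apply: Ele.
  - by apply: bdd_measM; [exact: bdd_meas_cst|exact: bdd_meas_indic].
  - rewrite (_ : (fun w => _) = (fun w => radR [seq Y w | Y <- map (step_int L) l]
      (step_int L phi0 w) (fun z => (b < `|z|)%R%:R))); last by apply/funext => w; rewrite -map_comp.
    apply: bdd_meas_rad => [Y /List.in_map_iff[psi [<- hpsi]]|].
      by apply: (measurable_step_int HL (T := T)); exact: adml.
    exact: (measurable_step_int HL adm0).
  move=> w; rewrite indicE.
  have -> : step_int L phi0 w = 0 by rewrite /step_int big_nil.
  have [wA|wA] := boolP (w \in A); last first.
    rewrite mulr0 -[X in X <= _](_ : radR [seq step_int L psi w | psi <- l] 0 (fun=> 0) = 0).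
      exact: rademacher_le.
    by have := @rademacher_lin R R (fun x y : R => x + y) (fun x y => x - y)
      [seq step_int L psi w | psi <- l] 0 (fun=> 0) (fun=> 0) 0 0 0; rewrite !mul0r !addr0.
  rewrite mulr1 -[12^-1]mul1r; apply: rademacher_anticoncentration; first exact: ltW.
  by rewrite b2 big_map; rewrite inE in wA.
have up := rademacher_step_le (F := fun psi => fine (P [set w | b < `|step_int L psi w|]))
  hC adml adm0.
have : radS l phi0 (fun psi => e / 12 + C * fine (energy T (step_eval psi))) =
    e / 12 + C * \sum_(psi <- l) fine (energy T (step_eval psi)).
  have := rademacher_lin (@step_add R U) step_sub l phi0
    (fun psi => fine (energy T (step_eval psi))) (fun=> 0) C 0 (e / 12).
  rewrite (rademacher_energy l phi0 (ltW T0)) [0 * radS _ _ _]mul0r addr0.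
  rewrite [fine (energy T (step_eval phi0))](_ : _ = 0) ?add0r => [h|]; last first.
    rewrite /energy integral0_eq// => t _.
    by rewrite /step_eval !big_nil addr0 normr0 expr0n.
  by rewrite [RHS]addrC -h; congr radS; apply/funext => psi; rewrite mul0r addr0 addrC.
lra.
Qed.

End SquareFunction.

(** * Bochner integrals *)

Section InnerProduct.
Context (R : realType) (U : normedModType R) (ip : U -> U -> R) (e : nat -> U).
Hypothesis onb : hilbert_onb ip e.

Let ipC u v : ip u v = ip v u. Proof. by case: onb. Qed.
Let ipL a u v w : ip (a *: u + v) w = a * ip u w + ip v w. Proof. by case: onb. Qed.
Let ipE u : ip u u = `|u| ^+ 2. Proof. by case: onb. Qed.

Lemma ip0l w : ip 0 w = 0.
Proof.
have := ipL 1 0 0 w; rewrite scale1r addr0 mul1r => /eqP.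
by rewrite -subr_eq subrr => /eqP.
Qed.

Lemma ipDl u v w : ip (u + v) w = ip u w + ip v w.
Proof. by rewrite -[u]scale1r ipL mul1r scale1r. Qed.

Lemma ipZl a u w : ip (a *: u) w = a * ip u w.
Proof. by rewrite -[a *: u]addr0 ipL ip0l addr0. Qed.

Lemma ip_suml (I : Type) (r : seq I) (F : I -> U) w :
  ip (\sum_(i <- r) F i) w = \sum_(i <- r) ip (F i) w.
Proof.
by elim: r => [|i r IH]; rewrite ?big_nil ?ip0l// !big_cons ipDl IH.
Qed.

Lemma ipDr u v w : ip w (u + v) = ip w u + ip w v.
Proof. by rewrite ipC ipDl (ipC u) (ipC v). Qed.

Lemma ipZr a u w : ip w (a *: u) = a * ip w u.
Proof. by rewrite ipC ipZl ipC. Qed.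

Lemma norm_addZ_sqr (a : R) (u v : U) :
  `|u + a *: v| ^+ 2 = `|u| ^+ 2 + 2 * a * ip u v + a ^+ 2 * `|v| ^+ 2.
Proof.
rewrite -[LHS]ipE ipDl !ipDr !ipZl !ipZr !ipE (ipC v u).
by ring.
Qed.

Lemma hilbert_parallelogram (u v : U) :
  `|u + v| ^+ 2 + `|u - v| ^+ 2 = 2 * (`|u| ^+ 2 + `|v| ^+ 2).
Proof.
have := norm_addZ_sqr 1 u v; have := norm_addZ_sqr (-1) u v.
by rewrite scale1r scaleN1r => -> ->; ring.
Qed.

Lemma cauchy_schwarz (u v : U) : `|ip u v| <= `|u| * `|v|.
Proof.
have [->|v0] := eqVneq v 0; first by rewrite ipC ip0l !normr0 mulr0.
have v20 : 0 < `|v| ^+ 2 by rewrite exprn_gt0// normr_gt0.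
have := sqr_ge0 `|u + (- (ip u v / `|v| ^+ 2)) *: v|.
rewrite norm_addZ_sqr [X in 0 <= X](_ : _ = `|u| ^+ 2 - ip u v ^+ 2 / `|v| ^+ 2); last first.
  by field; rewrite normr_eq0.
rewrite subr_ge0 ler_pdivrMr// -exprMn => h.
by rewrite -(@ler_pXn2r _ 2)// ?nnegrE ?mulr_ge0// real_normK ?num_real.
Qed.

End InnerProduct.

Lemma measurable_sum_in (R : realType) (d : measure_display) (S : measurableType d)
  (I : eqType) (r : seq I) (h : I -> S -> R) :
  (forall i, i \in r -> measurable_fun setT (h i)) ->
  measurable_fun setT (fun s => \sum_(i <- r) h i s).
Proof.
elim: r => [|i r IH] mh.
  by under eq_fun do rewrite big_nil; exact: measurable_cst.
under eq_fun do rewrite big_cons.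
apply: measurable_funD; first by apply: mh; exact: mem_head.
by apply: IH => j jr; apply: mh; rewrite inE jr orbT.
Qed.

Lemma ereal_cvg0_near (R : realType) (T : Type) (F : set_system T) (FF : Filter F)
  (u : T -> \bar R) (a : R) : u x @[x --> F] --> 0%E -> 0 < a ->
  \forall x \near F, (u x < a%:E)%E.
Proof.
move=> uF a0; apply: (uF [set x | (x < a%:E)%E]).
by apply: open_nbhs_nbhs; split; [exact: open_ereal_lt_ereal|rewrite /= lte_fin].
Qed.

(* The integral of a nonnegative function is a supremum over simple minorants, hence monotone
   without measurability of the larger function; the one-sided limits in [L2_regulated] need
   not be Borel. *)
Section LowerIntegral.
Context (R : realType) (d : measure_display) (S : measurableType d)
  (mu : {measure set S -> \bar R}).
Local Open Scope ereal_scope.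

Lemma ge0_le_lower_integral (f1 f2 : S -> \bar R) : (forall x, 0 <= f1 x) ->
  (forall x, f1 x <= f2 x) -> \int[mu]_x f1 x <= \int[mu]_x f2 x.
Proof.
move=> f10 f12; have f20 x : 0 <= f2 x by exact: le_trans (f12 x).
rewrite !ge0_integralTE//; apply: ereal_sup_le => _ [h hf1 <-].
exists h => // x.
exact: le_trans (hf1 x) (f12 x).
Qed.

Lemma ge0_ae_le_lower_integral (f1 f2 : S -> \bar R) (N : set S) :
  (forall x, 0 <= f1 x) -> (forall x, 0 <= f2 x) -> measurable_fun setT f1 ->
  measurable N -> mu N = 0 -> (forall x, ~ N x -> f1 x <= f2 x) ->
  \int[mu]_x f1 x <= \int[mu]_x f2 x.
Proof.
move=> f10 f20 mf1 mN N0 f12.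
rewrite (ge0_negligible_integral mN)// integral_mkcond.
apply: ge0_le_lower_integral => x; rewrite patchE; case: ifPn => //.
by rewrite inE => -[_ /f12].
Qed.

End LowerIntegral.

Section BochnerIntegral.
Context (R : realType) (U : completeNormedModType R) (ip : U -> U -> R) (e : nat -> U).
Hypothesis onb : hilbert_onb ip e.
Context (d : measure_display) (S : measurableType d)
  (mu : {finite_measure set S -> \bar R}).
Implicit Types (r q : seq (U * set S)) (f h : S -> U).

Definition simple_opp r : seq (U * set S) := [seq (- p.1, p.2) | p <- r].

Lemma simple_eval_cat r q s : simple_eval (r ++ q) s = simple_eval r s + simple_eval q s.
Proof. by rewrite /simple_eval big_cat. Qed.

Lemma simple_eval_opp r s : simple_eval (simple_opp r) s = - simple_eval r s.
Proof.
rewrite /simple_eval big_map -sumrN; apply: eq_bigr => p _ /=.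
by case: ifP => // _; rewrite oppr0.
Qed.

Lemma simple_integral_cat r q :
  simple_integral mu (r ++ q) = simple_integral mu r + simple_integral mu q.
Proof. by rewrite /simple_integral big_cat. Qed.

Lemma simple_integral_opp r : simple_integral mu (simple_opp r) = - simple_integral mu r.
Proof.
by rewrite /simple_integral big_map -sumrN; apply: eq_bigr => p _ /=; rewrite scalerN.
Qed.

Lemma simple_meas_cat r q : simple_meas r -> simple_meas q -> simple_meas (r ++ q).
Proof. by move=> mr mq p; rewrite mem_cat => /orP[/mr|/mq]. Qed.

Lemma simple_meas_opp r : simple_meas r -> simple_meas (simple_opp r).
Proof. by move=> mr p /mapP[q qr ->]; exact: (mr q qr). Qed.

Definition simple_restrict (A : set S) r : seq (U * set S) := [seq (p.1, p.2 `&` A) | p <- r].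

Lemma simple_restrict_in A r s : A s -> simple_eval (simple_restrict A r) s = simple_eval r s.
Proof.
move=> As; rewrite /simple_eval big_map; apply: eq_bigr => p _ /=.
by rewrite in_setI (mem_set As) andbT.
Qed.

Lemma simple_restrict_out A r s : ~ A s -> simple_eval (simple_restrict A r) s = 0.
Proof.
move=> As; rewrite /simple_eval big_map big1// => p _ /=.
by rewrite in_setI (memNset As) andbF.
Qed.

Lemma simple_meas_restrict A r : measurable A -> simple_meas r -> simple_meas (simple_restrict A r).
Proof. by move=> mA mr p /mapP[q qr ->]; apply: measurableI => //; exact: mr. Qed.

Lemma borel_simple_eval r : simple_meas r -> borel_fun (simple_eval r).
Proof.
move=> mr; rewrite (_ : simple_eval r = (fun s => 0 + simple_eval r s)).
  by apply: borel_simple => //; exact: borel_cst.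
by apply/funext => s; rewrite add0r.
Qed.

Lemma borel_sub_simple f r : borel_fun f -> simple_meas r ->
  borel_fun (fun s => f s - simple_eval r s).
Proof.
move=> bf mr; under eq_fun do rewrite -simple_eval_opp.
by apply: borel_simple => //; exact: simple_meas_opp.
Qed.

Lemma simple_eval_bounded r s : `|simple_eval r s| <= \sum_(p <- r) `|p.1|.
Proof.
rewrite (le_trans (ler_norm_sum _ _ _))// ler_sum// => p _.
by case: ifP => // _; rewrite normr0.
Qed.

Lemma bounded_integrable (f : S -> R) (M : R) : measurable_fun setT f ->
  (forall s, `|f s| <= M) -> mu.-integrable setT (EFin \o f).
Proof.
move=> mf fM; apply: measurable_bounded_integrable => //.
  exact: fin_num_fun_lty.
exists M; split; first exact: num_real.
by move=> N MN w _; exact: le_trans (fM w) (ltW MN).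
Qed.

Lemma ip_simple_integral r v : simple_meas r ->
  ip (simple_integral mu r) v = \int[mu]_s ip (simple_eval r s) v.
Proof.
move=> mr; rewrite (ip_suml onb).
have -> : \int[mu]_s ip (simple_eval r s) v =
    \int[mu]_s (\sum_(p <- r) (ip p.1 v * \1_(p.2) s)).
  apply: eq_Rintegral => s _; rewrite (ip_suml onb); apply: eq_bigr => p _.
  by rewrite indicE; case: ifP => _; rewrite ?mulr1// (ip0l onb) mulr0.
have ii (p : U * set S) : measurable p.2 ->
    mu.-integrable setT (EFin \o (fun s => ip p.1 v * \1_(p.2) s)).
  move=> mp; apply: (@bounded_integrable _ `|ip p.1 v|).
    by apply: measurable_funM; [exact: measurable_cst|exact: measurable_indic].
  move=> s; rewrite normrM ler_piMr// indicE normr_nat lern1.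
  by case: (_ \in _).
elim: r mr => [|p r IH] mr.
  rewrite big_nil; under eq_Rintegral do rewrite big_nil.
  by rewrite Rintegral_cst// mul0r.
have mp : measurable p.2 by apply: mr; exact: mem_head.
have mr' : simple_meas r by move=> q qr; apply: mr; rewrite inE qr orbT.
rewrite big_cons IH//; under [RHS]eq_Rintegral do rewrite big_cons.
rewrite RintegralD//; last 2 first.
- exact: ii.
- apply: (@bounded_integrable _ (\sum_(q <- r) `|ip q.1 v|)).
    apply: measurable_sum_in => q qr.
    by apply: measurable_funM; [exact: measurable_cst|apply: measurable_indic; exact: (mr' q qr)].
  move=> s; rewrite (le_trans (ler_norm_sum _ _ _))// ler_sum// => q _.
  by rewrite normrM ler_piMr// indicE normr_nat lern1; case: (_ \in _).
congr (_ + _); rewrite RintegralZl//; last first.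
  apply: (@bounded_integrable _ 1); first exact: measurable_indic.
  by move=> s; rewrite indicE normr_nat lern1; case: (_ \in _).
by rewrite (ipZl onb) mulrC /Rintegral integral_indic// setIT.
Qed.

(** The sets of [r] may overlap, so the estimate cannot be made term by term. Pairing with the
    integral [v] itself and Cauchy-Schwarz bound [|v| ^ 2] by [|v|] times the integral of the
    norm. *)
Lemma norm_simple_integral r : simple_meas r ->
  (`|simple_integral mu r|%:E <= \int[mu]_s (`|simple_eval r s|)%:E)%E.
Proof.
move=> mr; set v := simple_integral mu r.
have mn : measurable_fun setT (fun s => `|simple_eval r s|).
  by apply: borel_norm; exact: borel_simple_eval.
have i1 : mu.-integrable setT (EFin \o (fun s => `|simple_eval r s|)).
  apply: (@bounded_integrable _ (\sum_(p <- r) `|p.1|)) => // s.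
  by rewrite normr_id; exact: simple_eval_bounded.
have mip : measurable_fun setT (fun s => ip (simple_eval r s) v).
  rewrite (_ : (fun s => _) = fun s => \sum_(q <- r) (ip q.1 v * \1_(q.2) s)).
    apply: measurable_sum_in => q qr.
    by apply: measurable_funM; [exact: measurable_cst|apply: measurable_indic; exact: (mr q qr)].
  apply/funext => s; rewrite (ip_suml onb); apply: eq_bigr => q _.
  by rewrite indicE; case: ifP => _; rewrite ?mulr1// (ip0l onb) mulr0.
have ipb s : `|ip (simple_eval r s) v| <= `|v| * `|simple_eval r s|.
  by rewrite mulrC; exact: cauchy_schwarz onb _ _.
have i2 : mu.-integrable setT (EFin \o (fun s => ip (simple_eval r s) v)).
  apply: (@bounded_integrable _ (`|v| * \sum_(p <- r) `|p.1|)) => // s.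
  by rewrite (le_trans (ipb s))// ler_wpM2l//; exact: simple_eval_bounded.
have i3 : mu.-integrable setT (EFin \o (fun s => `|v| * `|simple_eval r s|)).
  apply: (@bounded_integrable _ (`|v| * \sum_(p <- r) `|p.1|)).
    by apply: measurable_funM; [exact: measurable_cst|].
  move=> s; rewrite normrM !normr_id ler_wpM2l//; exact: simple_eval_bounded.
have main : `|v| ^+ 2 <= `|v| * \int[mu]_s `|simple_eval r s|.
  have -> : `|v| ^+ 2 = ip v v by case: onb => _ _ ->.
  rewrite {1}/v ip_simple_integral// -RintegralZl//.
  by apply: le_Rintegral => // s _; exact: le_trans (ler_norm _) (ipb s).
have -> : (\int[mu]_s (`|simple_eval r s|)%:E = (\int[mu]_s `|simple_eval r s|)%:E)%E.
  by rewrite fineK//; exact: integrable_fin_num.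
rewrite lee_fin; have [v0|v0] := eqVneq `|v| 0.
  by rewrite v0; apply: Rintegral_ge0.
by move: main; rewrite expr2 ler_pM2l// lt_neqAle eq_sym v0 normr_ge0.
Qed.

(* The [+ 1] keeps [mass] positive when [mu = 0]. *)
Definition mass : R := fine (mu setT) + 1.

Lemma mass_gt0 : 0 < mass.
Proof. by rewrite /mass ltr_wpDl// fine_ge0. Qed.

Lemma mass_ge : (mu setT <= mass%:E)%E.
Proof.
rewrite -[leLHS]fineK; last exact: fin_num_measure.
by rewrite lee_fin /mass lerDl.
Qed.

(** Cauchy-Schwarz against the constant 1, obtained by integrating [a <= (c + a ^ 2 / c) / 2]. The
    choice [c = 1] shows that the integral of [a] is finite, and [c] equal to this integral over
    [mass] gives the bound. *)
Lemma integral_norm_le_sqrt (a : S -> R) (J : R) : measurable_fun setT a ->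
  (forall s, 0 <= a s) -> (\int[mu]_s (a s ^+ 2)%:E <= J%:E)%E ->
  (\int[mu]_s (a s)%:E <= (Num.sqrt (mass * J))%:E)%E.
Proof.
move=> ma a0 aJ; have m0 := mass_gt0.
have J0 : 0 <= J.
  by rewrite -lee_fin (le_trans _ aJ)// integral_ge0// => s _; rewrite lee_fin sqr_ge0.
have ma2 : measurable_fun setT (fun s => (a s ^+ 2)%:E).
  by apply/measurable_EFinP; exact: measurable_funX.
have bound c : 0 < c -> (\int[mu]_s (a s)%:E <= (2^-1 * (c * mass + c^-1 * J))%:E)%E.
  move=> c0; apply: (@le_trans _ _
      (\int[mu]_s ((2^-1 * c)%:E + (2^-1 * c^-1)%:E * (a s ^+ 2)%:E))%E).
    apply: ge0_le_integral => //.
    - by move=> s _; rewrite lee_fin.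
    - exact/measurable_EFinP.
    - apply: emeasurable_funD => //; exact: measurable_funeM.
    move=> s _; rewrite -EFinM -EFinD lee_fin.
    rewrite -subr_ge0 [X in 0 <= X](_ : _ = 2^-1 * c^-1 * (a s - c) ^+ 2); last first.
      by field; rewrite gt_eqF.
    by rewrite mulr_ge0 ?sqr_ge0// mulr_ge0// invr_ge0 ltW.
  have h0 : 0 <= 2^-1 * c^-1 by rewrite mulr_ge0// invr_ge0 ltW.
  have h1 : 0 <= 2^-1 * c by rewrite mulr_ge0// ltW.
  rewrite ge0_integralD//; last 2 first.
  - by move=> s _; rewrite mule_ge0// lee_fin// sqr_ge0.
  - exact: measurable_funeM.
  rewrite integral_cst// ge0_integralZl_EFin//; last by move=> s _; rewrite lee_fin sqr_ge0.
  rewrite (_ : 2^-1 * (c * mass + c^-1 * J) = 2^-1 * c * mass + 2^-1 * c^-1 * J); last by ring.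
  rewrite EFinD !(EFinM _ mass) !(EFinM _ J); apply: leeD.
    by rewrite lee_wpmul2l ?lee_fin//; exact: mass_ge.
  by rewrite lee_wpmul2l ?lee_fin.
set A := (\int[mu]_s (a s)%:E)%E in bound *.
have A0 : (0 <= A)%E by apply: integral_ge0 => s _; rewrite lee_fin.
have Afin : A \is a fin_num.
  by rewrite ge0_fin_numE// (le_lt_trans (bound 1 ltr01))// ltry.
rewrite -(fineK Afin) lee_fin.
have [A00|An0] := eqVneq (fine A) 0; first by rewrite A00 sqrtr_ge0.
have Ap : 0 < fine A by rewrite lt_neqAle eq_sym An0 fine_ge0.
have := bound _ (divr_gt0 Ap m0); rewrite -(fineK Afin) lee_fin /=.
move: (fine A) Ap => x x0; rewrite divfK ?gt_eqF// invf_div => h.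
have h2 : x <= mass * J / x by move: h; rewrite mulrAC; lra.
have h3 : x ^+ 2 <= mass * J by rewrite expr2 -ler_pdivlMr.
by rewrite -[leLHS]gtr0_norm// -sqrtr_sqr ler_wsqrtr.
Qed.

(** Convergence is required at every point: for a measure that need not be complete, an almost
    everywhere limit of measurable functions may fail to be measurable. *)
Definition lim_simple f := exists2 r : nat -> seq (U * set S), (forall n, simple_meas (r n)) &
  forall s, simple_eval (r n) s @[n --> \oo] --> f s.

Lemma measurable_norm_sub_lim_simple f h : borel_fun f -> lim_simple h ->
  measurable_fun setT (fun s => `|f s - h s|).
Proof.
move=> bf [r mr rh].
have h1 n : measurable_fun setT (fun s => `|f s - simple_eval (r n) s|).
  by apply: borel_norm; exact: borel_sub_simple.
have h2 s : setT s -> `|f s - simple_eval (r n) s| @[n --> \oo] --> `|f s - h s|.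
  by move=> _; apply: cvg_norm; apply: cvgB; [exact: cvg_cst|exact: rh].
exact: measurable_fun_cvg h1 h2.
Qed.

Lemma measurable_norm_lim_simple h : lim_simple h -> measurable_fun setT (fun s => `|h s|).
Proof.
move=> lh; have := measurable_norm_sub_lim_simple (@borel_cst _ _ S U 0) lh.
by under eq_fun do rewrite sub0r normrN.
Qed.

Lemma strongly_measurable_lim_simple h : strongly_measurable mu h ->
  exists h' (N : set S), [/\ lim_simple h', measurable N, mu N = 0 &
    forall s, ~ N s -> h s = h' s].
Proof.
move=> [r [mr [N [mN N0 hN]]]].
exists (fun s => if s \in N then 0 else h s), N; split=> //; last first.
  by move=> s Ns; rewrite memNset.
exists (fun n => simple_restrict (~` N) (r n)) => [n|s].
  by apply: simple_meas_restrict => //; exact: measurableC.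
case: ifPn => sN.
  rewrite inE in sN; rewrite (_ : (fun n => _) = fun=> 0); first exact: cvg_cst.
  by apply/funext => n; rewrite simple_restrict_out//= => /(_ sN).
rewrite notin_setE in sN; rewrite (_ : (fun n => _) = fun n => simple_eval (r n) s).
  by apply: contrapT => h1; apply: sN; apply: hN.
by apply/funext => n; rewrite simple_restrict_in.
Qed.

(** Setting [r n] to 0 where its norm exceeds [2 |f|] preserves the pointwise limit, and then
    [(3 |f|) ^ 2] dominates the squared errors. Where [f] vanishes the truncated functions vanish
    too. *)
Lemma lim_simple_L2_approx f : lim_simple f -> (\int[mu]_s ((`|f s| ^+ 2)%:E) < +oo)%E ->
  exists r : nat -> seq (U * set S), [/\ forall n, simple_meas (r n),
    forall s, simple_eval (r n) s @[n --> \oo] --> f s &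
    (\int[mu]_s ((`|simple_eval (r n) s - f s| ^+ 2)%:E))%E @[n --> \oo] --> 0%E].
Proof.
move=> lf ffin; have [r mr rf] := lf.
have mnf := measurable_norm_lim_simple lf.
pose B n := [set s | `|simple_eval (r n) s| <= 2 * `|f s|].
have mB n : measurable (B n).
  have := measurable_fun_ler (borel_norm (borel_simple_eval (mr n)))
    (measurable_funM (measurable_cst (2 : R)) mnf) measurableT (Y := [set true]) I.
  by rewrite setTI; congr measurable; apply/seteqP; split.
pose r' n := simple_restrict (B n) (r n).
have mr' n : simple_meas (r' n) by exact: simple_meas_restrict.
have r'b n s : `|simple_eval (r' n) s| <= 2 * `|f s|.
  have [Bs|Bs] := pselect (B n s); first by rewrite /r' simple_restrict_in.
  by rewrite /r' simple_restrict_out// normr0 mulr_ge0.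
have r'f s : simple_eval (r' n) s @[n --> \oo] --> f s.
  have [f0|f0] := eqVneq (f s) 0.
    rewrite f0 (_ : (fun n => _) = fun=> 0); first exact: cvg_cst.
    by apply/funext => n; apply/eqP; rewrite -normr_le0 (le_trans (r'b n s))// f0 normr0 mulr0.
  apply: cvg_trans (rf s); apply: near_eq_cvg.
  have fp : 0 < `|f s| by rewrite normr_gt0.
  have /cvgrPdist_le/(_ _ fp) := rf s; apply: filterS => n hn.
  rewrite /r' simple_restrict_in// /B /=.
  have -> : simple_eval (r n) s = f s - (f s - simple_eval (r n) s) by rewrite opprB addrC subrK.
  by rewrite (le_trans (ler_normB _ _))// mulr_natl mulr2n lerD2l.
exists r'; split => //.
have mdiff n : measurable_fun setT (fun s => `|simple_eval (r' n) s - f s|).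
  by apply: measurable_norm_sub_lim_simple => //; exact: borel_simple_eval.
have [|||||_ _] := @dominated_convergence _ _ _ mu setT measurableT
  (fun n s => (`|simple_eval (r' n) s - f s| ^+ 2)%:E) (fun=> 0%E)
  (fun s => (9%:E * (`|f s| ^+ 2)%:E)%E).
- by move=> n; apply/measurable_EFinP; exact: measurable_funX.
- exact: measurable_cst.
- apply: aeW => s _; apply: cvg_EFin; first exact: nearW.
  have hc : `|simple_eval (r' n) s - f s| @[n --> \oo] --> `|f s - f s|.
    by apply: cvg_norm; apply: cvgB; [exact: r'f|exact: cvg_cst].
  rewrite subrr normr0 in hc.
  rewrite (_ : fine \o _ = (fun n => `|simple_eval (r' n) s - f s| * `|simple_eval (r' n) s - f s|)).
    by rewrite -[X in _ --> X](mulr0 0); apply: cvgM; exact: hc.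
  by apply/funext => n /=; rewrite expr2.
- apply: integrableZl => //; apply/integrableP; split.
    by apply/measurable_EFinP; exact: measurable_funX.
  by under eq_integral do rewrite gee0_abs ?lee_fin ?exprn_ge0//.
- apply: aeW => s n _; rewrite gee0_abs; last by rewrite lee_fin exprn_ge0.
  rewrite -EFinM lee_fin.
  rewrite (_ : 9 * `|f s| ^+ 2 = (3 * `|f s|) ^+ 2); last by rewrite exprMn -natrX.
  rewrite lerXn2r ?nnegrE ?mulr_ge0// (le_trans (ler_normB _ _))//.
  by have := r'b n s; lra.
by rewrite integral0.
Qed.

Lemma L2U_simple_approx f : borel_fun f -> L2U mu f ->
  exists r : nat -> seq (U * set S), [/\ forall n, simple_meas (r n),
    {ae mu, forall s, simple_eval (r n) s @[n --> \oo] --> f s} &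
    (\int[mu]_s ((`|f s - simple_eval (r n) s| ^+ 2)%:E))%E @[n --> \oo] --> 0%E].
Proof.
move=> bf [sf ffin].
have [f' [N [lf' mN N0 ff']]] := strongly_measurable_lim_simple sf.
have aeff' : {ae mu, forall s, f s = f' s}.
  by exists N; split=> // s /= h; apply: contrapT => Ns; apply: h; exact: ff'.
have [r [mr rf' ri]] : exists r : nat -> seq (U * set S), [/\ forall n, simple_meas (r n),
    forall s, simple_eval (r n) s @[n --> \oo] --> f' s &
    (\int[mu]_s ((`|simple_eval (r n) s - f' s| ^+ 2)%:E))%E @[n --> \oo] --> 0%E].
  apply: lim_simple_L2_approx => //; apply: le_lt_trans ffin.
  apply: (@ge0_ae_le_lower_integral _ _ _ _ _ _ N) => //.
    by apply/measurable_EFinP/measurable_funX; exact: measurable_norm_lim_simple.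
  by move=> s Ns; rewrite ff'.
exists r; split => //.
  by apply: filterS aeff' => s ->.
apply: cvg_trans ri; apply: near_eq_cvg; near=> n.
apply: ge0_ae_eq_integral => //.
- apply/measurable_EFinP/measurable_funX; apply: measurable_norm_sub_lim_simple => //.
  exact: borel_simple_eval.
- by apply: borel_norm2; exact: borel_sub_simple.
- by apply: filterS aeff' => s -> _; rewrite distrC.
Unshelve. all: by end_near. Qed.

Lemma sqr_norm_add_le (V : normedModType R) (u v : V) :
  `|u + v| ^+ 2 <= 2 * `|u| ^+ 2 + 2 * `|v| ^+ 2.
Proof.
apply: (@le_trans _ _ ((`|u| + `|v|) ^+ 2)).
  by rewrite lerXn2r ?nnegrE ?addr_ge0//; exact: ler_normD.
rewrite -subr_ge0 [X in 0 <= X](_ : _ = (`|u| - `|v|) ^+ 2); last by ring.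
exact: sqr_ge0.
Qed.

(** Meant for [h] a one-sided limit of [g] in L^2(S): a single simple function, chosen from [h]
    alone, serves all slices [f] close to [h]. [h] is replaced by an everywhere limit of simple
    functions, at the cost of a null set. *)
Lemma L2U_near_simple h (a : R) : L2U mu h -> 0 < a ->
  exists2 r : seq (U * set S), simple_meas r & forall f, borel_fun f ->
    (\int[mu]_s ((`|f s - simple_eval r s| ^+ 2)%:E) <=
     2%:E * \int[mu]_s ((`|f s - h s| ^+ 2)%:E) + a%:E)%E.
Proof.
move=> [sh hfin] a0.
have [h' [N [lh' mN N0 hh']]] := strongly_measurable_lim_simple sh.
have [r [mr _ ri]] : exists r : nat -> seq (U * set S), [/\ forall n, simple_meas (r n),
    forall s, simple_eval (r n) s @[n --> \oo] --> h' s &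
    (\int[mu]_s ((`|simple_eval (r n) s - h' s| ^+ 2)%:E))%E @[n --> \oo] --> 0%E].
  apply: lim_simple_L2_approx => //; apply: le_lt_trans hfin.
  apply: (@ge0_ae_le_lower_integral _ _ _ _ _ _ N) => //.
    by apply/measurable_EFinP/measurable_funX; exact: measurable_norm_lim_simple.
  by move=> s Ns; rewrite hh'.
have [n hn] : exists n, (\int[mu]_s ((`|simple_eval (r n) s - h' s| ^+ 2)%:E) <= (a / 2)%:E)%E.
  have a2 : 0 < a / 2 by rewrite divr_gt0.
  have [n _ /(_ n (leqnn n)) /ltW] := ereal_cvg0_near _ ri a2.
  by exists n.
exists (r n) => // f bf.
have m1 : measurable_fun setT (fun s => (`|f s - h' s| ^+ 2)%:E).
  by apply/measurable_EFinP/measurable_funX; exact: measurable_norm_sub_lim_simple.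
have m2 : measurable_fun setT (fun s => (`|simple_eval (r n) s - h' s| ^+ 2)%:E).
  apply/measurable_EFinP/measurable_funX; apply: measurable_norm_sub_lim_simple => //.
  exact: borel_simple_eval.
apply: (@le_trans _ _ (\int[mu]_s (2%:E * (`|f s - h' s| ^+ 2)%:E +
    2%:E * (`|simple_eval (r n) s - h' s| ^+ 2)%:E))%E).
  apply: ge0_le_integral => //.
  - by apply: borel_norm2; exact: borel_sub_simple.
  - by apply: emeasurable_funD; exact: measurable_funeM.
  move=> s _; rewrite -!EFinM -EFinD lee_fin.
  have -> : f s - simple_eval (r n) s = (f s - h' s) + - (simple_eval (r n) s - h' s).
    by rewrite opprB addrA subrK.
  by rewrite (le_trans (sqr_norm_add_le _ _))// normrN.
have p0 (k : S -> U) s : (0 <= (`|k s| ^+ 2)%:E)%E by rewrite lee_fin exprn_ge0.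
rewrite ge0_integralD; [|exact: measurableT|by move=> s _; rewrite mule_ge0|
  exact: measurable_funeM|by move=> s _; rewrite mule_ge0|exact: measurable_funeM].
rewrite !ge0_integralZl_EFin//.
apply: leeD.
  rewrite lee_wpmul2l//; apply: (@ge0_ae_le_lower_integral _ _ _ _ _ _ N) => // s Ns.
  by rewrite hh'.
apply: (@le_trans _ _ (2%:E * (a / 2)%:E)%E); first by rewrite lee_wpmul2l.
by rewrite -EFinM lee_fin mulrC divfK.
Qed.

(** The simple functions that define [v] converge to [f] in L^1, and the L^1 distance from [f] to
    [r] is at most the square root of [mass * J]. Both the regularity of the mean and its
    approximation in time rest on this estimate. *)
Lemma bochner_simple_dist f v r (J : R) : borel_fun f -> bochner_integral mu f v ->
  simple_meas r -> (\int[mu]_s ((`|f s - simple_eval r s| ^+ 2)%:E) <= J%:E)%E ->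
  `|v - simple_integral mu r| <= Num.sqrt (mass * J).
Proof.
move=> bf [q [mq qf qi qv]] mr hJ.
set K := Num.sqrt _.
have h1 : (\int[mu]_s (`|f s - simple_eval r s|)%:E <= K%:E)%E.
  by apply: integral_norm_le_sqrt => //; apply: borel_norm; exact: borel_sub_simple.
have h2 n : (`|simple_integral mu (q n) - simple_integral mu r|%:E <=
    \int[mu]_s (`|simple_eval (q n) s - f s|)%:E + K%:E)%E.
  rewrite -simple_integral_opp -simple_integral_cat.
  have mc : simple_meas (q n ++ simple_opp r).
    by apply: simple_meas_cat => //; exact: simple_meas_opp.
  apply: le_trans (norm_simple_integral mc) _.
  have mqf : measurable_fun setT (fun s => (`|simple_eval (q n) s - f s|)%:E).
    apply/measurable_EFinP; under eq_fun do rewrite distrC.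
    by apply: borel_norm; exact: borel_sub_simple.
  have mfr : measurable_fun setT (fun s => (`|f s - simple_eval r s|)%:E).
    by apply/measurable_EFinP; apply: borel_norm; exact: borel_sub_simple.
  apply: (@le_trans _ _ (\int[mu]_s ((`|simple_eval (q n) s - f s|)%:E +
      (`|f s - simple_eval r s|)%:E))%E).
    apply: ge0_le_integral => //.
    - by apply/measurable_EFinP; apply: borel_norm; exact: borel_simple_eval.
    - exact: emeasurable_funD.
    move=> s _; rewrite -EFinD lee_fin simple_eval_cat simple_eval_opp.
    have -> : simple_eval (q n) s - simple_eval r s =
      (simple_eval (q n) s - f s) + (f s - simple_eval r s) by rewrite addrA subrK.
    exact: ler_normD.
  by rewrite ge0_integralD//; apply: leeD.
have cv : (`|simple_integral mu (q n) - simple_integral mu r|%:E @[n --> \oo] -->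
    `|v - simple_integral mu r|%:E)%E.
  apply: cvg_EFin; first exact: nearW.
  by apply: cvg_norm; apply: cvgB => //; exact: cvg_cst.
have ci : (\int[mu]_s (`|simple_eval (q n) s - f s|)%:E + K%:E @[n --> \oo] --> K%:E)%E.
  rewrite -[X in _ --> X]add0e; apply: cvgeD => //; exact: cvg_cst.
rewrite -lee_fin -(cvg_lim _ cv)// -(cvg_lim _ ci)//.
apply: lee_lim; [by apply/cvg_ex; eexists; exact: cv|by apply/cvg_ex; eexists; exact: ci|].
exact: nearW.
Qed.

Lemma bochner_exists f : borel_fun f -> L2U mu f -> exists v, bochner_integral mu f v.
Proof.
move=> bf l2; have [r [mr rf ri]] := L2U_simple_approx bf l2.
have m0 := mass_gt0.
have mfr n : measurable_fun setT (fun s => `|f s - simple_eval (r n) s|).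
  by apply: borel_norm; exact: borel_sub_simple.
have small a : 0 < a -> \forall n \near \oo,
    (\int[mu]_s (`|f s - simple_eval (r n) s|)%:E <= a%:E)%E.
  move=> a0; have a2 : 0 < a ^+ 2 / mass by rewrite divr_gt0// exprn_gt0.
  have : \forall n \near \oo,
      (\int[mu]_s ((`|f s - simple_eval (r n) s| ^+ 2)%:E) < (a ^+ 2 / mass)%:E)%E.
    exact: ereal_cvg0_near ri a2.
  apply: filterS => n /ltW hn.
  have := integral_norm_le_sqrt (mfr n) (fun s => normr_ge0 _) hn.
  by rewrite mulrC divfK ?gt_eqF// sqrtr_sqr gtr0_norm.
have cI : cvgn (fun n => simple_integral mu (r n)).
  apply/cauchy_cvgP/cauchy_exP => a a0.
  have a4 : 0 < a / 4 by rewrite divr_gt0.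
  have [n _ hn] := small _ a4.
  exists (simple_integral mu (r n)); exists n => // k /= nk.
  rewrite -ball_normE /= -simple_integral_opp -simple_integral_cat.
  have mc : simple_meas (r n ++ simple_opp (r k)).
    by apply: simple_meas_cat => //; exact: simple_meas_opp.
  rewrite -lte_fin; apply: le_lt_trans (norm_simple_integral mc) _.
  apply: (@le_lt_trans _ _ ((a / 4)%:E + (a / 4)%:E)%E); last first.
    by rewrite -EFinD lte_fin; lra.
  apply: (@le_trans _ _ (\int[mu]_s ((`|f s - simple_eval (r n) s|)%:E +
      (`|f s - simple_eval (r k) s|)%:E))%E).
    apply: ge0_le_integral => //.
    - by apply/measurable_EFinP; apply: borel_norm; exact: borel_simple_eval.
    - by apply: emeasurable_funD; exact/measurable_EFinP.
    move=> s _; rewrite -EFinD lee_fin simple_eval_cat simple_eval_opp.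
    have -> : simple_eval (r n) s - simple_eval (r k) s =
      (f s - simple_eval (r k) s) - (f s - simple_eval (r n) s).
      by rewrite opprB [RHS]addrC addrA subrK.
    by rewrite (le_trans (ler_normB _ _))// addrC.
  rewrite ge0_integralD//; [|exact/measurable_EFinP|exact/measurable_EFinP].
  by apply: leeD; [exact: (hn n (leqnn n))|exact: (hn k nk)].
exists (limn (fun n => simple_integral mu (r n))), r; split => //.
apply/(@fine_cvgP _ _ _ _ _ 0); split.
  have := small 1 ltr01; apply: filterS => n hn.
  rewrite ge0_fin_numE; last by apply: integral_ge0 => s _; rewrite lee_fin.
  by under eq_integral do rewrite distrC; rewrite (le_lt_trans hn)// ltry.
apply/cvgrPdist_le => a a0; have := small a a0; apply: filterS => n hn /=.
rewrite sub0r normrN ger0_norm; last by apply: fine_ge0; apply: integral_ge0 => s _; rewrite lee_fin.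
under eq_integral do rewrite distrC.
rewrite -lee_fin fineK// ge0_fin_numE; last by apply: integral_ge0 => s _; rewrite lee_fin.
by rewrite (le_lt_trans hn)// ltry.
Qed.

End BochnerIntegral.

Lemma mem_In (T : eqType) (x : T) (l : seq T) : x \in l -> List.In x l.
Proof.
by elim: l => [|y l IH] //; rewrite inE => /predU1P[->|/IH]; [left|right].
Qed.

(** * Regulated functions *)

Section Tiling.
Context (R : realType).

(** The labels are of an arbitrary type: vectors when a regulated function is approximated, simple
    functions on [S] when the integrand is. *)
Fixpoint tiling (V : Type) (x : R) (l : seq (V * R * R)) (T : R) : Prop :=
  if l is p :: l' then [/\ p.1.2 = x, x < p.2 & tiling p.2 l' T] else x = T.

Lemma tiling_le (V : Type) x (l : seq (V * R * R)) T : tiling x l T -> x <= T.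
Proof.
elim: l x => [|p l IH] x /=; first by move=> ->.
by move=> [_ xp /IH]; apply: le_trans; exact: ltW.
Qed.

Lemma tiling_in (V : Type) x (l : seq (V * R * R)) T p : tiling x l T -> List.In p l ->
  [/\ x <= p.1.2, p.1.2 < p.2 & p.2 <= T].
Proof.
elim: l x => [|q l IH] x //= [qx xq ql] [<-|pl].
  by rewrite qx xq lexx (tiling_le ql).
have [h1 h2 h3] := IH _ ql pl; split => //.
by rewrite (le_trans _ h1)// ltW.
Qed.

Lemma tiling_rcons (V : Type) x (l : seq (V * R * R)) t v t' : tiling x l t -> t < t' ->
  tiling x (rcons l (v, t, t')) t'.
Proof. by elim: l x => [|q l IH] x /= => [->|[qx xq ql] tt']; split => //; exact: IH. Qed.

(** Compactness of [0, T] by a supremum: consider all times up to which a tiling exists. Nothing is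
    claimed at the nodes, since one-sided limits give no information there. *)
Lemma tiling_exists (V : Type) (Q : V -> R -> Prop) (T : R) : 0 <= T ->
  (forall t, 0 <= t < T -> exists2 a : R, 0 < a & exists v, forall t', t < t' < t + a -> Q v t') ->
  (forall t, 0 < t <= T -> exists2 a : R, 0 < a & exists v, forall t', t - a < t' < t -> Q v t') ->
  exists l : seq (V * R * R), tiling 0 l T /\
    forall p, List.In p l -> forall t, p.1.2 < t < p.2 -> Q p.1.1 t.
Proof.
move=> T0 Qr Ql.
pose ok t := exists l : seq (V * R * R), tiling 0 l t /\
    forall p, List.In p l -> forall t', p.1.2 < t' < p.2 -> Q p.1.1 t'.
have okS t t' v : ok t -> t < t' -> (forall s, t < s < t' -> Q v s) -> ok t'.
  move=> [l [lt lQ]] tt' vQ; exists (rcons l (v, t, t')); split; first exact: tiling_rcons.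
  move=> p; rewrite -cats1 => /List.in_app_iff[/lQ//|[<-|//]] s /=.
  exact: vQ.
have ok0 : ok 0 by exists [::].
pose A := [set t | t <= T /\ ok t].
have A0 : A 0 by [].
have supA : has_sup A by split; [exists 0|exists T => t []].
pose s := sup A.
have s0 : 0 <= s by exact: (sup_upper_bound supA).
have sT : s <= T by apply: ge_sup => //; [exists 0|move=> t []].
(* The left-hand condition shows that the supremum is attained; the right-hand one then rules out
   [s < T]. *)
have oks : ok s.
  move: s0; rewrite le_eqVlt => /predU1P[<- //|s0].
  have [|a a0 [v vQ]] := Ql s; first by rewrite s0.
  have [t [tT okt] st] := sup_adherent a0 supA.
  have : t <= s by exact: (sup_upper_bound supA).
  rewrite le_eqVlt => /predU1P[<- //|ts].
  apply: (okS t s v) => // t' /andP[tt' t's]; apply: vQ.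
  by rewrite t's (lt_trans st).
move: sT; rewrite le_eqVlt => /predU1P[<- //|sT].
have [|a a0 [v vQ]] := Qr s; first by rewrite s0.
pose s' := Num.min T (s + a / 2).
have ss' : s < s' by rewrite /s' lt_min sT ltrDl divr_gt0.
have oks' : ok s'.
  apply: (okS s s' v) => // t' /andP[st' t's']; apply: vQ; rewrite st'/=.
  rewrite (lt_le_trans t's')// ge_min; apply/orP; right.
  by rewrite lerD2l ler_pdivrMr// ler_peMr ?ltW// ltr1n.
have : s' <= s by apply: (sup_upper_bound supA); split => //; rewrite /s' ge_min lexx.
by rewrite leNgt ss'.
Qed.

(** The tile [p] is chosen before [F'], so the same tile serves every evaluation of the labels, in
    particular all [s] at once. *)
Lemma tiling_sum (V : Type) (W : zmodType) (F : V -> W) x (l : seq (V * R * R)) T t :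
  tiling x l T ->
  (t <= x -> \sum_(p <- l) (if (p.1.2 < t) && (t <= p.2) then F p.1.1 else 0) = 0) /\
  (x < t <= T -> exists2 p, List.In p l /\ p.1.2 < t <= p.2 &
    forall F' : V -> W, \sum_(q <- l) (if (q.1.2 < t) && (t <= q.2) then F' q.1.1 else 0) = F' p.1.1).
Proof.
have zero (F' : V -> W) y l' : tiling y l' T -> t <= y ->
    \sum_(p <- l') (if (p.1.2 < t) && (t <= p.2) then F' p.1.1 else 0) = 0.
  elim: l' y => [|p l' IH] y /=; first by rewrite big_nil.
  move=> [py yp pl] ty; rewrite big_cons py ltNge ty add0r.
  by apply: IH pl _; rewrite (le_trans ty)// ltW.
move=> xl; split; first exact: zero xl.
elim: l x xl => [|p l IH] x /=; first by move=> -> /andP[/lt_le_trans/[apply]]; rewrite ltxx.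
move=> [px xp pl] /andP[xt tT].
have [tp|pt] := leP t p.2.
  exists p; first by split; [left|rewrite px xt].
  by move=> F'; rewrite big_cons px xt tp /= (zero _ _ _ pl)// addr0.
have [|q [ql qt] qF] := IH _ pl; first by rewrite pt.
exists q; first by split => //; right.
by move=> F'; rewrite big_cons leNgt pt andbF add0r qF.
Qed.

End Tiling.

Section RegulatedApproximation.
Context (R : realType) (U : normedModType R).
Implicit Types (f : R -> U) (T : R).

Lemma at_right_ball (t : R) (Q : R -> Prop) : (\forall x \near t^'+, Q x) ->
  exists2 a : R, 0 < a & forall x, t < x < t + a -> Q x.
Proof.
rewrite near_withinE => /nbhs_ballP[a /= a0 ha]; exists a => // x /andP[tx xt].
apply: ha => //; rewrite -ball_normE /= distrC gtr0_norm ?subr_gt0//.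
by rewrite ltrBlDl.
Qed.

Lemma at_left_ball (t : R) (Q : R -> Prop) : (\forall x \near t^'-, Q x) ->
  exists2 a : R, 0 < a & forall x, t - a < x < t -> Q x.
Proof.
rewrite near_withinE => /nbhs_ballP[a /= a0 ha]; exists a => // x /andP[tx xt].
apply: ha => //; rewrite -ball_normE /= gtr0_norm ?subr_gt0//.
by rewrite ltrBlDl addrC -ltrBlDl.
Qed.

(** The point values make the step function agree with [f] at the nodes: at [p.2] the tile ending
    there already contributes [p.1.1], whereas no tile contains 0. *)
Let step_of f (l : seq (U * R * R)) : stepfun U :=
  StepFun l ((f 0, 0) :: [seq (f p.2 - p.1.1, p.2) | p <- l]).

Lemma regulated_step_approx f T a : 0 <= T -> regulated T f -> 0 < a ->
  exists phi, step_admissible T phi /\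
    forall t, 0 <= t <= T -> `|step_eval phi t - f t| < a.
Proof.
move=> T0 [fr fl] a0.
have [l [lT lQ]] : exists l : seq (U * R * R), tiling 0 l T /\
    forall p, List.In p l -> forall t, p.1.2 < t < p.2 -> `|p.1.1 - f t| < a.
  apply: (tiling_exists (Q := fun v t => `|v - f t| < a)) => // t tT.
    have [v /cvgrPdist_lt/(_ _ a0)/at_right_ball[b b0 hb]] := fr t tT.
    by exists b => //; exists v.
  have [v /cvgrPdist_lt/(_ _ a0)/at_left_ball[b b0 hb]] := fl t tT.
  by exists b => //; exists v.
exists (step_of f l); split.
  split => p /=.
    by move=> /mem_In pl; have [h1 h2 h3] := tiling_in lT pl; rewrite h1 ltW.
  rewrite inE => /predU1P[-> /=|/mapP[q ql ->]/=]; first by rewrite lexx.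
  have [h1 h2 ->] := tiling_in lT (mem_In ql).
  by rewrite andbT (le_trans h1)// ltW.
move=> t /andP[t0 tT].
rewrite /step_eval /= big_cons /= big_map /=.
have itv0 : t = 0 -> \sum_(p <- l) (if (p.1.2 < t) && (t <= p.2) then p.1.1 else 0) = 0.
  by move=> t00; apply: (tiling_sum (fun v => v) t lT).1; rewrite t00.
have pts y l' : tiling y l' T -> t <= y ->
    \sum_(q <- l') (if t == q.2 then f q.2 - q.1.1 else 0) = 0.
  elim: l' y => [|p l' IH] y /=; first by rewrite big_nil.
  move=> [py yp pl] ty; rewrite big_cons lt_eqF ?add0r; last exact: le_lt_trans yp.
  by apply: IH pl _; rewrite (le_trans ty)// ltW.
have itvz y (l' : seq (U * R * R)) : tiling y l' T -> t <= y ->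
    \sum_(p <- l') (if (p.1.2 < t) && (t <= p.2) then p.1.1 else 0) = 0.
  by move=> yl ty; exact: (tiling_sum (fun v => v) t yl).1.
move: t0; rewrite le_eqVlt => /predU1P[t00|t0].
  by rewrite -t00 in itv0 pts itvz tT *; rewrite itv0// eqxx (pts 0)// add0r addr0 subrr normr0.
rewrite gt_eqF// add0r.
elim: l 0 t0 lT lQ {itv0} => [|p l IH] y yt /=.
  by move=> yT; move: (lt_le_trans yt tT); rewrite yT ltxx.
move=> [py yp pl] lQ; rewrite !big_cons py yt /=.
have [tp|pt|tp] := ltgtP t p.2.
- rewrite (itvz _ _ pl (ltW tp)) (pts _ _ pl (ltW tp)) !addr0.
  by apply: lQ; [left|rewrite py yt].
- rewrite !add0r; apply: IH pt pl _ => q ql; apply: lQ; by right.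
- have tle : t <= p.2 by rewrite tp.
  rewrite (itvz _ _ pl tle) (pts _ _ pl tle) !addr0 -tp.
  by rewrite [p.1.1 + _]addrC subrK subrr normr0.
Qed.

End RegulatedApproximation.

(** * Simple integrands *)

(* [G] stands for the integrand [\sum_((A, (u, a, b)) <- G) 1_A(s) 1_(a, b](t) u]. *)
Section SimpleIntegrands.
Context (R : realType) (U : completeNormedModType R).
Context (dS : measure_display) (S : measurableType dS)
  (eta : {finite_measure set S -> \bar R}).
Implicit Types (G H : seq (set S * (U * R * R))) (T : R).

Definition section_step G (s : S) : stepfun U :=
  StepFun [seq q.2 | q <- [seq q <- G | s \in q.1]] [::].

Definition mean_step G : stepfun U :=
  StepFun [seq (fine (eta q.1) *: q.2.1.1, q.2.1.2, q.2.2) | q <- G] [::].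

Definition time_cut G (t : R) : seq (U * set S) :=
  [seq (q.2.1.1, q.1) | q <- [seq q <- G | (q.2.1.2 < t) && (t <= q.2.2)]].

Definition integrand_opp G : seq (set S * (U * R * R)) :=
  [seq (q.1, (- q.2.1.1, q.2.1.2, q.2.2)) | q <- G].

Definition integrand_ok T G := forall q, List.In q G ->
  measurable q.1 /\ (0 <= q.2.1.2 <= q.2.2 /\ q.2.2 <= T).

Lemma integrand_ok_cat T G H : integrand_ok T G -> integrand_ok T H -> integrand_ok T (G ++ H).
Proof. by move=> okG okH q /List.in_app_iff[/okG|/okH]. Qed.

Lemma integrand_ok_opp T G : integrand_ok T G -> integrand_ok T (integrand_opp G).
Proof. by move=> okG q /List.in_map_iff[p [<- /okG]]. Qed.

Lemma section_step_eval G s t : step_eval (section_step G s) t = simple_eval (time_cut G t) s.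
Proof.
rewrite /step_eval /= big_nil addr0 /simple_eval !big_map !big_filter big_mkcond [RHS]big_mkcond.
by apply: eq_bigr => q _ /=; do 2 case: ifP.
Qed.

Lemma mean_step_eval G t : step_eval (mean_step G) t = simple_integral eta (time_cut G t).
Proof.
rewrite /step_eval /= big_nil addr0 /simple_integral !big_map big_filter [RHS]big_mkcond.
by apply: eq_bigr.
Qed.

Lemma section_step_evalB G H s t :
  step_eval (section_step (G ++ integrand_opp H) s) t =
  step_eval (section_step G s) t - step_eval (section_step H s) t.
Proof.
rewrite /step_eval /= !big_nil !addr0 filter_cat map_cat big_cat; congr (_ + _).
rewrite !big_map !big_filter big_map -sumrN; apply: eq_bigr => q _ /=.
by case: ifP => // _; rewrite oppr0.
Qed.

Lemma section_admissible T G s : integrand_ok T G -> step_admissible T (section_step G s).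
Proof.
move=> okG; split => // p /mapP[q]; rewrite mem_filter => /andP[_ qG] ->.
by have [] := okG q (mem_In qG).
Qed.

Lemma mean_admissible T G : integrand_ok T G -> step_admissible T (mean_step G).
Proof.
by move=> okG; split => // p /mapP[q qG ->]; have [] := okG q (mem_In qG).
Qed.

Lemma time_cut_meas T G t : integrand_ok T G -> simple_meas (time_cut G t).
Proof.
move=> okG p /mapP[q]; rewrite mem_filter => /andP[_ qG] ->.
by have [] := okG q (mem_In qG).
Qed.

Section Atoms.

Let push (phi : stepfun U) (p : U * R * R) := StepFun (rcons (st_itv phi) p) (st_pts phi).
(** [phi] collects the terms whose sets have already been decided to contain [s]; this
    generalization is what the induction over [G] needs. *)
Let glue (phi : stepfun U) G s :=
  StepFun (st_itv phi ++ st_itv (section_step G s)) (st_pts phi).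

(* [s |-> section_step G s] is constant on the atoms of the algebra generated by the sets
   of [G]. *)
Fixpoint atoms G (D : set S) (phi : stepfun U) : seq (set S * stepfun U) :=
  if G is q :: G' then atoms G' (D `&` q.1) (push phi q.2) ++ atoms G' (D `\` q.1) phi
  else [:: (D, phi)].

Let glueE q G phi s : glue phi (q :: G) s =
  if s \in q.1 then glue (push phi q.2) G s else glue phi G s.
Proof. by rewrite /glue /=; case: ifP => _ //=; rewrite cat_rcons. Qed.

Let measurable_glue T G phi (F : stepfun U -> \bar R) : integrand_ok T G ->
  measurable_fun setT (fun s => F (glue phi G s)).
Proof.
elim: G phi => [|q G IH] phi okG.
  rewrite (_ : (fun s => _) = fun=> F phi); first exact: measurable_cst.
  by apply/funext => s; rewrite /glue /= cats0; case: phi.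
have okG' : integrand_ok T G by move=> p pG; apply: okG; right.
have [mq _] : measurable q.1 /\ _ := okG q (or_introl erefl).
under eq_fun do rewrite glueE fun_if.
apply: measurable_fun_ifT; [|exact: IH|exact: IH].
apply: (measurable_fun_bool true).
rewrite setTI (_ : _ @^-1` _ = q.1)//.
by apply/seteqP; split => s /= => [/set_mem|/mem_set].
Qed.

Lemma atoms_integral T G (D : set S) phi (F : stepfun U -> \bar R) : integrand_ok T G ->
  measurable D -> (forall psi, (0 <= F psi)%E) ->
  (\int[eta]_(s in D) F (glue phi G s) =
   \sum_(x <- atoms G D phi) (F x.2 * eta x.1))%E.
Proof.
move=> + + F0; elim: G D phi => [|q G IH] D phi okG mD.
  rewrite /= big_seq1 -integral_cst//; apply: eq_integral => s _.
  by rewrite /glue /= cats0; case: phi.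
have okG' : integrand_ok T G by move=> p pG; apply: okG; right.
have [mq _] : measurable q.1 /\ _ := okG q (or_introl erefl).
have mDq : measurable (D `&` q.1) by exact: measurableI.
have mDq' : measurable (D `\` q.1) by exact: measurableD.
rewrite /= big_cat /= -!IH// -{1}(setUIDK D q.1) ge0_integral_setU//; last 2 first.
- by apply: measurable_funTS; exact: measurable_glue okG.
- by rewrite disj_set2E; apply/eqP/seteqP; split => // s [[_ ?] [_]].
congr (_ + _)%E; apply: eq_integral => s; rewrite inE => -[_ sq]; rewrite glueE.
  by rewrite mem_set.
by rewrite memNset.
Qed.

Lemma atoms_ok T G (D : set S) phi : integrand_ok T G -> measurable D ->
  step_admissible T phi -> forall x, List.In x (atoms G D phi) ->
  measurable x.1 /\ step_admissible T x.2.
Proof.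
elim: G D phi => [|q G IH] D phi okG mD adm x; first by move=> [<-|].
have okG' : integrand_ok T G by move=> p pG; apply: okG; right.
have [mq hq] : measurable q.1 /\ _ := okG q (or_introl erefl).
move=> /= /List.in_app_iff[|].
  apply: IH => //; first exact: measurableI.
  split; last exact: adm.2.
  by move=> p; rewrite mem_rcons inE => /predU1P[-> //|]; exact: adm.1.
by apply: IH => //; exact: measurableD.
Qed.

End Atoms.

Definition null_step : stepfun U := StepFun [::] [::].

Lemma section_integral T G (F : stepfun U -> \bar R) : integrand_ok T G ->
  (forall psi, (0 <= F psi)%E) ->
  (\int[eta]_s F (section_step G s) = \sum_(x <- atoms G setT null_step) (F x.2 * eta x.1))%E.
Proof. by move=> okG F0; rewrite -(atoms_integral null_step okG). Qed.

(** [F] is arbitrary because [section_step G] takes finitely many values, each on a measurable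
    set. *)
Lemma section_measurable T G (F : stepfun U -> \bar R) : integrand_ok T G ->
  measurable_fun setT (fun s => F (section_step G s)).
Proof.
elim: G F => [|q G IH] F okG.
  by rewrite (_ : (fun s => _) = fun=> F null_step)//; exact: measurable_cst.
have okG' : integrand_ok T G by move=> p pG; apply: okG; right.
have [mq _] : measurable q.1 /\ _ := okG q (or_introl erefl).
rewrite (_ : (fun s => _) = fun s => if s \in q.1
    then F (StepFun (q.2 :: st_itv (section_step G s)) [::]) else F (section_step G s)).
  apply: measurable_fun_ifT; [|exact: (IH (fun phi => F (StepFun (q.2 :: st_itv phi) [::])))|exact: IH].
  apply: (measurable_fun_bool true).
  rewrite setTI (_ : _ @^-1` _ = q.1)//.
  by apply/seteqP; split => s /= => [/set_mem|/mem_set].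
by apply/funext => s; rewrite /section_step /=; case: ifP.
Qed.

Section Integrals.
Hypothesis parallelogram : forall u v : U,
  `|u + v| ^+ 2 + `|u - v| ^+ 2 = 2 * (`|u| ^+ 2 + `|v| ^+ 2).
Context (d : measure_display) (Om : measurableType d) (P : probability Om R).
Context (L : R -> U -> Om -> R) (HL : cyl_levy P L).

Definition pathwise G (s : S) (w : Om) : R := step_int L (section_step G s) w.

Lemma pathwiseE G s w : pathwise G s w =
  \sum_(q <- G) (\1_(q.1) s * (L q.2.2 q.2.1.1 w - L q.2.1.2 q.2.1.1 w)).
Proof.
rewrite /pathwise /step_int /= big_map big_filter big_mkcond; apply: eq_bigr => q _.
by rewrite indicE; case: ifP => _; rewrite ?mul1r ?mul0r.
Qed.

Lemma measurable_pathwise T G : integrand_ok T G ->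
  measurable_fun setT (fun z : S * Om => pathwise G z.1 z.2).
Proof.
move=> okG; under eq_fun do rewrite pathwiseE.
elim: G okG => [|q G IH] okG.
  by under eq_fun do rewrite big_nil; exact: measurable_cst.
have okG' : integrand_ok T G by move=> p pG; apply: okG; right.
have [mq [/andP[a0 ab] _]] := okG q (or_introl erefl).
under eq_fun do rewrite big_cons.
apply: measurable_funD; last exact: IH.
apply: measurable_funM.
  by apply: measurableT_comp; [exact: measurable_indic|exact: measurable_fst].
have mi : measurable_fun setT (fun w => L q.2.2 q.2.1.1 w - L q.2.1.2 q.2.1.1 w).
  by apply: (levy_incr_meas HL) => //; exact: le_trans a0 ab.
exact: (measurableT_comp mi measurable_snd).
Qed.

Lemma pathwise_cat G H s w : pathwise (G ++ H) s w = pathwise G s w + pathwise H s w.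
Proof. by rewrite !pathwiseE big_cat. Qed.

(** The exceptional set does not depend on [s]: only the finitely many variables [L t u] that occur
    in [G] are involved. *)
Lemma pathwise_opp T G : integrand_ok T G ->
  {ae P, forall w, forall s, pathwise (integrand_opp G) s w = - pathwise G s w}.
Proof.
elim: G => [|q G IH] okG.
  by apply: aeW => w s; rewrite !pathwiseE !big_nil oppr0.
have okG' : integrand_ok T G by move=> p pG; apply: okG; right.
have [_ [/andP[a0 ab] _]] := okG q (or_introl erefl).
apply: filterS3 (IH okG') (levyZ HL (-1) q.2.1.1 a0) (levyZ HL (-1) q.2.1.1 (le_trans a0 ab)).
move=> w h ha hb s; have := h s; rewrite !pathwiseE /= !big_cons => ->.
by rewrite -scaleN1r ha hb; ring.
Qed.

(** For every [w] the left-hand side is a finite sum weighted by the measures of the sets; only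
    moving these weights into the vectors costs a null set. *)
Lemma pathwise_integral T G : integrand_ok T G ->
  {ae P, forall w, (\int[eta]_s (pathwise G s w)%:E = (step_int L (mean_step G) w)%:E)%E /\
    eta.-integrable setT (EFin \o (fun s => pathwise G s w)) }.
Proof.
move=> okG.
have ii G' w : integrand_ok T G' -> eta.-integrable setT (EFin \o (fun s => pathwise G' s w)).
  move=> okG'; have mz := measurable_fun_pair1 w (measurable_pathwise okG').
  apply: (@bounded_integrable _ _ _ eta _ (\sum_(q <- G') `|L q.2.2 q.2.1.1 w - L q.2.1.2 q.2.1.1 w|)).
    exact: mz.
  move=> s; rewrite pathwiseE (le_trans (ler_norm_sum _ _ _))// ler_sum// => q _.
  by rewrite normrM ler_piMl// indicE normr_nat lern1; case: (_ \in _).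
have exact_int w : (\int[eta]_s (pathwise G s w)%:E =
    (\sum_(q <- G) fine (eta q.1) * (L q.2.2 q.2.1.1 w - L q.2.1.2 q.2.1.1 w))%:E)%E.
  elim: G okG => [|q G IH] okG.
    by rewrite big_nil; apply: integral0_eq => s _; rewrite pathwiseE big_nil.
  have okG' : integrand_ok T G by move=> p pG; apply: okG; right.
  have [mq _] : measurable q.1 /\ _ := okG q (or_introl erefl).
  rewrite big_cons EFinD -IH//.
  have -> : (\int[eta]_s (pathwise (q :: G) s w)%:E =
      \int[eta]_s ((L q.2.2 q.2.1.1 w - L q.2.1.2 q.2.1.1 w)%:E * (\1_(q.1) s)%:E +
        (pathwise G s w)%:E))%E.
    by apply: eq_integral => s _; rewrite !pathwiseE big_cons -EFinM -EFinD mulrC.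
  have i1 : eta.-integrable setT (EFin \o (\1_(q.1) : S -> R)).
    apply: (@bounded_integrable _ _ _ eta _ 1); first exact: measurable_indic.
    by move=> s; rewrite indicE normr_nat lern1; case: (_ \in _).
  rewrite integralD//; [|exact: integrableZl|exact: ii].
  rewrite integralZl// integral_indic// setIT mulrC EFinM fineK//.
  exact: fin_num_measure.
have hl : {ae P, forall w, step_int L (mean_step G) w =
    \sum_(q <- G) fine (eta q.1) * (L q.2.2 q.2.1.1 w - L q.2.1.2 q.2.1.1 w)}.
  elim: G okG {exact_int} => [|q G IH] okG.
    by apply: aeW => w; rewrite /step_int !big_nil.
  have okG' : integrand_ok T G by move=> p pG; apply: okG; right.
  have [_ [/andP[a0 ab] _]] := okG q (or_introl erefl).
  apply: filterS3 (IH okG') (levyZ HL (fine (eta q.1)) q.2.1.1 a0)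
    (levyZ HL (fine (eta q.1)) q.2.1.1 (le_trans a0 ab)) => w h ha hb.
  by rewrite /step_int /= !big_cons /= ha hb -h mulrBr.
by apply: filterS hl => w ->; split; [exact: exact_int|exact: ii].
Qed.

(* Over the atoms [A_x] of [G], with values [phi_x], the integral of [pathwise G ^+ 2] is
   [\sum_x step_int L (sqrt (eta A_x) phi_x) ^+ 2]. *)
Lemma pathwise_L2_prob T e a : 0 < T -> 0 < e -> 0 < a -> exists2 C : R, 0 <= C &
  forall G, integrand_ok T G ->
    fine (P [set w | (a%:E < \int[eta]_s (pathwise G s w ^+ 2)%:E)%E]) <=
    e + C * fine (\int[eta]_s energy T (step_eval (section_step G s)))%E.
Proof.
move=> T0 e0 a0; have [C C0 hC] := square_function_prob parallelogram HL T0 e0 a0.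
exists C => // G okG.
pose at0 := atoms G setT null_step.
have adm0 : step_admissible T null_step by split.
have at_ok x : List.In x at0 -> measurable x.1 /\ step_admissible T x.2.
  exact: atoms_ok.
pose c (x : set S * stepfun U) := Num.sqrt (fine (eta x.1)).
have c2 x : c x ^+ 2 = fine (eta x.1) by rewrite sqr_sqrtr// fine_ge0.
pose l := [seq step_scale (c x) x.2 | x <- at0].
have adml psi : List.In psi l -> step_admissible T psi.
  by move=> /List.in_map_iff[x [<- /at_ok[_ ?]]]; exact: admissibleZ.
have etaE x : List.In x at0 -> eta x.1 = (c x ^+ 2)%:E.
  by move=> /at_ok[mx _]; rewrite c2 fineK// fin_num_measure.
have sumE (F : stepfun U -> R) : (forall psi, 0 <= F psi) ->
    (\int[eta]_s (F (section_step G s))%:E = (\sum_(x <- at0) c x ^+ 2 * F x.2)%:E)%E.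
  move=> F0; rewrite (section_integral (F := fun psi => (F psi)%:E) okG)//.
  rewrite -/at0; elim: at0 etaE {at_ok l adml} => [|x at1 IH] etaE; first by rewrite !big_nil.
  rewrite !big_cons IH; last by move=> y hy; apply: etaE; right.
  by rewrite etaE; [rewrite -EFinM -EFinD mulrC|left].
have -> : (\int[eta]_s energy T (step_eval (section_step G s)) =
    (\sum_(psi <- l) fine (energy T (step_eval psi)))%:E)%E.
  under eq_integral do rewrite -(@fineK _ (energy T _)) ?energy_step_fin ?ltW//.
  rewrite (sumE (fun psi => fine (energy T (step_eval psi)))); last first.
    by move=> psi; rewrite fine_ge0// energy_ge0.
  congr (_%:E); rewrite big_map; apply: eq_bigr => x _.
  by rewrite energy_scale fineM// energy_step_fin// ltW.
have -> : [set w | (a%:E < \int[eta]_s (pathwise G s w ^+ 2)%:E)%E] =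
    [set w | a < \sum_(x <- at0) c x ^+ 2 * step_int L x.2 w ^+ 2].
  apply/funext => w /=; rewrite (sumE (fun psi => step_int L psi w ^+ 2)); last first.
    by move=> psi; exact: sqr_ge0.
  by rewrite lte_fin.
rewrite /= -[X in _ <= X]addr0 addr0; apply: le_trans (hC l adml); rewrite le_eqVlt.
apply/orP; left; apply/eqP.
have ae_l : {ae P, forall w, \sum_(psi <- l) step_int L psi w ^+ 2 =
    \sum_(x <- at0) c x ^+ 2 * step_int L x.2 w ^+ 2}.
  rewrite /l; elim: at0 at_ok {etaE sumE l adml} => [|x at1 IH] at_ok.
    by apply: aeW => w; rewrite !big_nil.
  have [_ admx] := at_ok x (or_introl erefl).
  have {}IH : {ae P, forall w, \sum_(psi <- [seq step_scale (c x) x.2 | x <- at1]) step_int L psi w ^+ 2 =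
      \sum_(x <- at1) c x ^+ 2 * step_int L x.2 w ^+ 2}.
    by apply: IH => y hy; apply: at_ok; right.
  apply: filterS2 IH (step_intZ HL (c x) admx) => w h1 h2.
  by rewrite /= !big_cons h1 h2 exprMn.
have msum (I : Type) (r : seq I) (phi : I -> stepfun U) (b : I -> R) :
    (forall i, List.In i r -> step_admissible T (phi i)) ->
    measurable_fun setT (fun w => \sum_(i <- r) b i * step_int L (phi i) w ^+ 2).
  elim: r => [|i r IH] hr; first by under eq_fun do rewrite big_nil; exact: measurable_cst.
  under eq_fun do rewrite big_cons.
  apply: measurable_funD; last by apply: IH => j jr; apply: hr; right.
  apply: measurable_funM; first exact: measurable_cst.
  by apply: measurable_funX; apply: (measurable_step_int HL (hr i (or_introl erefl))).
have mset (X : Om -> R) : measurable_fun setT X -> measurable [set w | a < X w].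
  move=> mX; rewrite (_ : [set w | _] = X @^-1` `]a, +oo[).
    by rewrite -[_ @^-1` _]setTI; exact: mX.
  by apply/seteqP; split => w /=; rewrite in_itv/= andbT.
have m1 := mset _ (msum _ at0 snd (fun x => c x ^+ 2) (fun x hx => (at_ok x hx).2)).
have m2 : measurable [set w | a < \sum_(psi <- l) step_int L psi w ^+ 2].
  have := mset _ (msum _ l id (fun=> 1) adml).
  by under eq_fun do under eq_bigr do rewrite mul1r.
rewrite -(Eindic P m1) -(Eindic P m2); apply: ae_eq_E.
- exact: bdd_meas_indic.
- exact: bdd_meas_indic.
apply: filterS ae_l => w hw; rewrite !indicE; congr (nat_of_bool _)%:R.
by apply/idP/idP; rewrite !inE /= hw.
Qed.

End Integrals.

End SimpleIntegrands.

Lemma map_f_In (V : Type) (W : eqType) (f : V -> W) (l : seq V) p :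
  List.In p l -> f p \in [seq f q | q <- l].
Proof. by elim: l => //= q l IH [->|/IH h]; rewrite inE ?eqxx// h orbT. Qed.

Section OneSided.
Context (R : realType).

Lemma near_at_right (t b : R) (Q : R -> Prop) : 0 < b ->
  (forall x, t < x < t + b -> Q x) -> \forall x \near t^'+, Q x.
Proof.
move=> b0 h; near=> x; apply: h; apply/andP; split; near: x; first exact: nbhs_right_gt.
by apply: nbhs_right_lt; rewrite ltrDl.
Unshelve. all: end_near. Qed.

Lemma near_at_left (t b : R) (Q : R -> Prop) : 0 < b ->
  (forall x, t - b < x < t -> Q x) -> \forall x \near t^'-, Q x.
Proof.
move=> b0 h; near=> x; apply: h; apply/andP; split; near: x; last exact: nbhs_left_lt.
by apply: nbhs_left_gt; rewrite ltrBlDr ltrDl.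
Unshelve. all: end_near. Qed.

End OneSided.

(** * Approximation of the integrand in L^2(S x [0, T]) *)

Section Approximation.
Context (R : realType) (U : completeNormedModType R).
Context (dS : measure_display) (S : measurableType dS)
  (eta : {finite_measure set S -> \bar R}).
Context (T : R) (T0 : 0 < T).
Implicit Types (g : S -> R -> U) (G : seq (set S * (U * R * R))).

(* Joint measurability of [g] is only assumed on [S x [0, T]]. *)
Definition zero_extend g (s : S) (t : R) : U := if 0 <= t <= T then g s t else 0.

Lemma borel_pair1 (h : S * measurableTypeR R -> U) t : borel_fun h -> borel_fun (fun s => h (s, t)).
Proof.
move=> bh O oO; rewrite (_ : _ @^-1` _ = ysection (h @^-1` O) t).
  by apply: measurable_ysection; exact: bh.
by apply/seteqP; split => s; rewrite /ysection/= inE.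
Qed.

Lemma borel_pair2 (h : S * measurableTypeR R -> U) s : borel_fun h -> borel_fun (fun t => h (s, t)).
Proof.
move=> bh O oO; rewrite (_ : _ @^-1` _ = xsection (h @^-1` O) s).
  by apply: measurable_xsection; exact: bh.
by apply/seteqP; split => t; rewrite /xsection/= inE.
Qed.

Lemma borel_zero_extend g : jointly_measurable T g ->
  borel_fun (fun z : S * measurableTypeR R => zero_extend g z.1 z.2).
Proof.
move=> mg O oO.
have mD : measurable (setT `*` `[0, T] : set (S * measurableTypeR R)).
  by apply: measurableX => //; exact: measurable_itv.
have [zO|zO] := pselect (O 0%R).
  rewrite (_ : _ @^-1` _ = (setT `*` `[0, T] `&` ((fun p : S * R => g p.1 p.2) @^-1` O)) `|`
      ~` (setT `*` `[0, T])).
    by apply: measurableU; [exact: mg|exact: measurableC].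
  apply/seteqP; split => [[s t]|[s t]] /=; rewrite /zero_extend in_itv /=.
    by case: ifPn => [_ h|/negP h _]; [left|right => -[_]].
  by case: ifPn => [_ [[]//|/not_andP[]//]|].
rewrite (_ : _ @^-1` _ = setT `*` `[0, T] `&` ((fun p : S * R => g p.1 p.2) @^-1` O)).
  exact: mg.
apply/seteqP; split => [[s t]|[s t]] /=; rewrite /zero_extend in_itv /=.
  by case: ifPn.
by move=> [[_ ->]].
Qed.

Lemma borel_section_sub (h : S * measurableTypeR R -> U) G : borel_fun h -> integrand_ok T G ->
  borel_fun (fun z : S * measurableTypeR R => h z - step_eval (section_step G z.1) z.2).
Proof.
elim: G h => [|q G IH] h bh okG.
  rewrite (_ : (fun z => _) = h)//; apply/funext => z.
  by rewrite /step_eval /= !big_nil addr0 subr0.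
have okG' : integrand_ok T G by move=> p pG; apply: okG; right.
have [mq _] : measurable q.1 /\ _ := okG q (or_introl erefl).
have mD : measurable (q.1 `*` `]q.2.1.2, q.2.2] : set (S * measurableTypeR R)).
  by apply: measurableX => //; exact: measurable_itv.
rewrite (_ : (fun z => _) = fun z : S * measurableTypeR R =>
    (h z + (if z \in (q.1 `*` `]q.2.1.2, q.2.2] : set (S * measurableTypeR R)) then - q.2.1.1 else 0))
    - step_eval (section_step G z.1) z.2).
  by apply: IH => //; exact: borel_add_if.
apply/funext => -[s t]; rewrite !section_step_eval /time_cut /simple_eval /=.
rewrite (_ : ((s, t) \in _) = (s \in q.1) && ((q.2.1.2 < t) && (t <= q.2.2))).
  case: ifP => [ht|ht] /=; last by rewrite andbF addr0.
  by rewrite big_cons /= andbT; case: ifP => _; rewrite ?add0r ?addr0// opprD addrA.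
apply/idP/idP; rewrite inE /= in_itv /=; first by move=> [/mem_set -> ->].
by move=> /andP[/set_mem ? ->].
Qed.

Section Error.
Variable g : S -> R -> U.
Hypothesis mg : jointly_measurable T g.
Definition slice_error G (t : R) : \bar R :=
  (\int[eta]_s (`|zero_extend g s t - step_eval (section_step G s) t| ^+ 2)%:E)%E.

Lemma slice_error_ge0 G t : (0 <= slice_error G t)%E.
Proof. by apply: integral_ge0 => s _; rewrite lee_fin sqr_ge0. Qed.

Let joint_error G := fun z : S * measurableTypeR R =>
  (`|zero_extend g z.1 z.2 - step_eval (section_step G z.1) z.2| ^+ 2)%:E.

Let measurable_joint_error G : integrand_ok T G -> measurable_fun setT (joint_error G).
Proof.
by move=> okG; apply: borel_norm2; apply: borel_section_sub => //; exact: borel_zero_extend.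
Qed.

Let joint_error_ge0 G z : (0 <= joint_error G z)%E.
Proof. by rewrite lee_fin sqr_ge0. Qed.

Lemma measurable_slice_error G : integrand_ok T G ->
  measurable_fun setT (slice_error G : measurableTypeR R -> \bar R).
Proof.
move=> okG.
exact: (measurable_fun_fubini_tonelli_G (m1 := eta) _ (measurable_joint_error okG) (joint_error_ge0 G)).
Qed.

Lemma step_eval_out phi t : step_admissible T phi -> ~~ (0 <= t <= T) ->
  step_eval phi t = 0 :> U.
Proof.
move=> [h1 h2] ht; rewrite /step_eval !big_seq !big1 ?addr0// => q hq.
  by case: eqP => // tq; move: ht; rewrite tq h2.
have [/andP[q0 _] qT] := h1 q hq.
case: ifP => // /andP[qt tq]; move: ht.
by rewrite (le_trans q0 (ltW qt)) (le_trans tq qT).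
Qed.

Let restrict_error G s t : integrand_ok T G -> t \notin (`[0, T]%classic : set R) ->
  joint_error G (s, t) = 0%E.
Proof.
move=> okG; rewrite mem_setE in_itv /= => ht.
rewrite /joint_error /zero_extend /= (negbTE ht) step_eval_out//.
  by rewrite subr0 normr0 expr0n.
exact: section_admissible.
Qed.

(** The approximation is constructed slice by slice in t, whereas the stochastic integrals see the
    energy of the path at fixed s; this identity links the two. *)
Lemma slice_error_tonelli G : integrand_ok T G ->
  (\int[eta]_s energy T (fun t => (zero_extend g s t - step_eval (section_step G s) t)%R) =
   \int[@lebesgue_measure R]_(t in `[0%R, T]) slice_error G t)%E.
Proof.
move=> okG; rewrite [RHS]integral_mkcond.
have -> : (slice_error G \_ [set` `[0, T]]) = slice_error G.
  apply/funext => t; rewrite patchE; case: ifPn => // ht.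
  by rewrite /slice_error integral0_eq// => s _; exact: restrict_error.
have tonelli := fubini_tonelli (m1 := eta) (m2 := @lebesgue_measure R) (joint_error G)
  (measurable_joint_error okG) (joint_error_ge0 G).
transitivity (\int[@lebesgue_measure R]_t \int[eta]_s joint_error G (s, t))%E; last first.
  by apply: eq_integral => t _; rewrite /slice_error.
rewrite -tonelli.
apply: eq_integral => s _; rewrite /energy integral_mkcond; apply: eq_integral => t _.
by rewrite patchE; case: ifPn => // ht; rewrite restrict_error.
Qed.

Lemma measurable_section_energy G : integrand_ok T G ->
  measurable_fun setT (fun s => energy T (fun t => zero_extend g s t - step_eval (section_step G s) t)).
Proof.
move=> okG.
have := measurable_fun_fubini_tonelli_F (m2 := @lebesgue_measure R) _ (measurable_joint_error okG) (joint_error_ge0 G).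
apply: eq_measurable_fun => s _; rewrite /fubini_F /energy [RHS]integral_mkcond; apply: eq_integral => t _.
by rewrite patchE; case: ifPn => // ht; rewrite restrict_error.
Qed.

Lemma borel_slice t : borel_fun (fun s => zero_extend g s t).
Proof. exact: (borel_pair1 t (borel_zero_extend mg)). Qed.

Lemma borel_path_sub G s : integrand_ok T G ->
  borel_fun (fun t : measurableTypeR R => zero_extend g s t - step_eval (section_step G s) t).
Proof. by move=> okG; exact: (borel_pair2 s (borel_section_sub (borel_zero_extend mg) okG)). Qed.

Hypothesis rg : L2_regulated eta T g.

Let near_simple a r t := simple_meas r /\
  (\int[eta]_s (`|zero_extend g s t - simple_eval r s| ^+ 2)%:E <= a%:E)%E.

Let near_simple_of (h : S -> U) r t a : 0 < a -> simple_meas r -> 0 <= t <= T ->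
  (forall f, borel_fun f ->
    (\int[eta]_s ((`|f s - simple_eval r s| ^+ 2)%:E) <=
     2%:E * \int[eta]_s ((`|f s - h s| ^+ 2)%:E) + (a / 2)%:E)%E) ->
  (\int[eta]_s (`|g s t - h s| ^+ 2)%:E <= (a / 4)%:E)%E -> near_simple a r t.
Proof.
move=> a0 mr tT hr ht; split => //; apply: (le_trans (hr _ (borel_slice t))).
have -> : a%:E = (2%:E * (a / 4)%:E + (a / 2)%:E)%E.
  by rewrite -EFinM -EFinD; congr EFin; field.
rewrite leeD2r// lee_pmul2l//.
by move: ht; rewrite /zero_extend tT.
Qed.

Lemma local_simple_right t a : 0 <= t < T -> 0 < a -> exists2 b : R, 0 < b &
  exists r, forall t', t < t' < t + b -> t' <= T /\ near_simple a r t'.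
Proof.
move=> /andP[t0 tT] a0; have [_ + _] := rg; move=> /(_ t); rewrite t0 tT => /(_ isT)[h [l2h hh]].
have a2 : 0 < a / 2 by rewrite divr_gt0.
have a4 : 0 < a / 4 by rewrite divr_gt0.
have [r mr hr] := L2U_near_simple l2h a2.
have FF : ProperFilter (t^'+) by exact: at_right_proper_filter.
have [b b0 hb] := at_right_ball (ereal_cvg0_near FF hh a4).
exists (Num.min b (T - t)); first by rewrite lt_min b0 subr_gt0.
exists r => t' /andP[tt']; rewrite -ltrBlDl lt_min !ltrBlDl => /andP[tb tT'].
have {}tT' : t' <= T by rewrite ltW// (lt_le_trans tT')// addrC subrK.
split => //; apply: (near_simple_of (h := h)) => //.
  by rewrite tT' (le_trans t0)// ltW.
by apply/ltW/hb; rewrite tt' tb.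
Qed.

Lemma local_simple_left t a : 0 < t <= T -> 0 < a -> exists2 b : R, 0 < b &
  exists r, forall t', t - b < t' < t -> 0 <= t' /\ near_simple a r t'.
Proof.
move=> /andP[t0 tT] a0; have [_ _ +] := rg; move=> /(_ t); rewrite t0 tT => /(_ isT)[h [l2h hh]].
have a2 : 0 < a / 2 by rewrite divr_gt0.
have a4 : 0 < a / 4 by rewrite divr_gt0.
have [r mr hr] := L2U_near_simple l2h a2.
have FF : ProperFilter (t^'-) by exact: at_left_proper_filter.
have [b b0 hb] := at_left_ball (ereal_cvg0_near FF hh a4).
exists (Num.min b t); first by rewrite lt_min b0.
exists r => t' /andP[tb t't].
have [tb1 tb2] : t - b < t' /\ 0 <= t'.
  have h1 : Num.min b t <= b by rewrite ge_min lexx.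
  have h2 : Num.min b t <= t by rewrite ge_min lexx orbT.
  by split; lra.
split => //; apply: (near_simple_of (h := h)) => //.
  by rewrite tb2 (le_trans _ tT)// ltW.
by apply/ltW/hb; rewrite tb1.
Qed.

Definition tiled_integrand (l : seq (seq (U * set S) * R * R)) : seq (set S * (U * R * R)) :=
  flatten [seq [seq (x.2, (x.1, p.1.2, p.2)) | x <- p.1.1] | p <- l].

Lemma tiled_integrand_eval l s t : step_eval (section_step (tiled_integrand l) s) t =
  \sum_(p <- l) (if (p.1.2 < t) && (t <= p.2) then simple_eval p.1.1 s else 0).
Proof.
rewrite section_step_eval /time_cut /simple_eval big_map big_filter big_flatten big_map.
apply: eq_bigr => p _; rewrite big_map /=; case: ifP => ht //.
by rewrite big_pred0.
Qed.

(** Regularity in L^2(S) yields a tiling on each open tile of which one simple function is close to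
    all the slices. The nodes, where nothing is known, form a finite and hence negligible set
    [N]. *)
Lemma integrand_approx a : 0 < a -> exists G, integrand_ok T G /\
  (\int[@lebesgue_measure R]_(t in `[0%R, T]) slice_error G t <= a%:E)%E.
Proof.
move=> a0; have b0 : 0 < a / T by rewrite divr_gt0.
have [l [lT lQ]] : exists l, tiling 0 l T /\
    forall p, List.In p l -> forall t, p.1.2 < t < p.2 -> near_simple (a / T) p.1.1 t.
  apply: tiling_exists; [exact: ltW| |] => t tT.
    have [b bb [r hr]] := local_simple_right tT b0.
    by exists b => //; exists r => t' /hr[].
  have [b bb [r hr]] := local_simple_left tT b0.
  by exists b => //; exists r => t' /hr[].
have okG : integrand_ok T (tiled_integrand l).
  move=> q; rewrite /tiled_integrand => qG.
  have [p [pl [x [xp ->]]]] : exists p, List.In p l /\ exists x, List.In x p.1.1 /\ q = (x.2, (x.1, p.1.2, p.2)).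
    elim: l qG {lT lQ} => //= p l IH /List.in_app_iff[/List.in_map_iff[x [<- xp]]|/IH[p' [pl h]]].
      by exists p; split; [left|exists x].
    by exists p'; split => //; right.
  have [h1 h2 h3] := tiling_in lT pl; rewrite /= h1 h3 (ltW h2); split => //.
  (* Any interior time would do; the midpoint is used only to read off that the label is a simple
     function on measurable sets. *)
  have [mr _] : near_simple (a / T) p.1.1 ((p.1.2 + p.2) / 2) by apply: lQ => //; rewrite !midf_lt.
  apply: mr; elim: p.1.1 xp => //= y r IH [->|/IH h]; first by rewrite mem_head.
  by rewrite inE h orbT.
exists (tiled_integrand l); split => //.
pose N := [set` (0 :: [seq p.2 | p <- l])] : set R.
have N0 : @lebesgue_measure R N = 0%E.
  by apply: countable_lebesgue_measure0; apply: finite_set_countable; exact: finite_seq.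
have hN t : 0 <= t <= T -> ~ N t -> (slice_error (tiled_integrand l) t <= (a / T)%:E)%E.
  move=> /andP[t0 tT] Nt.
  have t0' : 0 < t.
    by rewrite lt_neqAle t0 andbT; apply/eqP => t00; apply: Nt; rewrite /N /= -t00 mem_head.
  have [p [pl /andP[pt tp]] hp] : exists2 p, List.In p l /\ p.1.2 < t <= p.2 &
      forall F' : seq (U * set S) -> U,
      \sum_(q <- l) (if (q.1.2 < t) && (t <= q.2) then F' q.1.1 else 0) = F' p.1.1.
    by apply: (tiling_sum (fun=> 0) t lT).2; rewrite t0'.
  have tp' : t < p.2.
    rewrite lt_neqAle tp andbT; apply/eqP => tp2; apply: Nt; rewrite /N /= inE tp2.
    by apply/orP; right; exact: map_f_In.
  have [_] : near_simple (a / T) p.1.1 t by apply: lQ => //; rewrite pt.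
  apply: le_trans; rewrite le_eqVlt; apply/orP; left; apply/eqP; apply: eq_integral => s _.
  by rewrite tiled_integrand_eval (hp (fun r => simple_eval r s)).
have len : @lebesgue_measure R `[0, T]%classic = T%:E.
  by rewrite lebesgue_measure_itv /= lte_fin T0 oppr0 adde0.
have -> : a%:E = (\int[@lebesgue_measure R]_(t in `[0%R, T]) (a / T)%:E)%E.
  rewrite integral_cst; last exact: measurable_itv.
  rewrite [X in (_ * X)%E](_ : _ = T%:E); last exact: len.
  by rewrite -EFinM divfK// gt_eqF.
apply: ae_ge0_le_integral.
- exact: measurable_itv.
- by move=> t _; exact: slice_error_ge0.
- by apply: measurable_funTS; exact: measurable_slice_error.
- by move=> t _; rewrite lee_fin ltW.
- exact: measurable_cst.
- exists N; split => //.
    apply: countable_measurable; first by move=> t; exact: measurable_set1.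
    by apply: finite_set_countable; exact: finite_seq.
  move=> t /= /not_implyP[]; rewrite in_itv /= => tT h; apply: contrapT => Nt.
  by apply: h; exact: hN.
Qed.

Variables (ip : U -> U -> R) (e : nat -> U).
Hypothesis onb : hilbert_onb ip e.
Variable m : R -> U.
Hypothesis hm : forall t, 0 <= t <= T -> bochner_integral eta (fun s => g s t) (m t).

Let hmT t : 0 <= t <= T -> bochner_integral eta (fun s => zero_extend g s t) (m t).
Proof.
move=> tT; rewrite (_ : (fun s => _) = (fun s => g s t)); first exact: hm.
by apply/funext => s; rewrite /zero_extend tT.
Qed.

Lemma mean_step_dist G t : integrand_ok T G -> 0 <= t <= T ->
  ((`|step_eval (mean_step eta G) t - m t| ^+ 2)%:E <= (mass eta)%:E * slice_error G t)%E.
Proof.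
move=> okG tT.
have m0 := mass_gt0 eta.
have := slice_error_ge0 G t; case hE : (slice_error G t) => [J| |]//; last first.
  by rewrite gt0_muley ?leey// lte_fin.
rewrite lee_fin => J0; rewrite -EFinM lee_fin mean_step_eval distrC.
rewrite -(sqr_sqrtr (mulr_ge0 (ltW m0) J0)) lerXn2r ?nnegrE ?sqrtr_ge0//.
apply: (bochner_simple_dist onb (borel_slice t) (hmT tT)); first exact: time_cut_meas okG.
by rewrite -hE /slice_error; under [leRHS]eq_integral do rewrite section_step_eval.
Qed.

Let cauchy_limit (F : set_system R) (FF : ProperFilter F) :
  (forall a, 0 < a -> exists v : U, \forall t \near F, `|v - m t| <= a) -> exists l : U, m @ F --> l.
Proof.
move=> h; apply/cvg_ex; apply/cauchy_cvgP; apply: cauchy_exP => a a0.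
have a2 : 0 < a / 2 by rewrite divr_gt0.
have [v hv] := h _ a2; exists v.
apply: (filterS _ hv) => t; rewrite -ball_normE /= => /le_lt_trans; apply.
by rewrite ltr_pdivrMr// ltr_pMr// ltr1n.
Qed.

(** On either side of [t] one simple function approximates all nearby slices, so [m] stays close to
    the single vector that is its integral. This is the Cauchy property, and [U] is complete. *)
Lemma mean_regulated : regulated T m.
Proof.
have m0 := mass_gt0 eta.
have key a r t : 0 < a -> 0 <= t <= T -> near_simple (a ^+ 2 / mass eta) r t ->
    `|simple_integral eta r - m t| <= a.
  move=> a0 tT [mr hr]; rewrite distrC.
  rewrite (le_trans (bochner_simple_dist onb (borel_slice t) (hmT tT) mr hr))//.
  by rewrite mulrC divfK ?gt_eqF// sqrtr_sqr gtr0_norm.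
have pos a : 0 < a -> 0 < a ^+ 2 / mass eta by move=> a0; rewrite divr_gt0// exprn_gt0.
split => t tT; apply: cauchy_limit => a a0.
  have [b b0 [r hr]] := local_simple_right tT (pos _ a0).
  exists (simple_integral eta r); apply: (near_at_right b0) => t' tt'.
  have [t'T ns] := hr _ tt'; apply: key => //; rewrite t'T andbT.
  by move: tt' tT => /andP[/ltW h _] /andP[h' _]; exact: le_trans h' h.
have [b b0 [r hr]] := local_simple_left tT (pos _ a0).
exists (simple_integral eta r); apply: (near_at_left b0) => t' tt'.
have [t'0 ns] := hr _ tt'; apply: key => //; rewrite t'0 /=.
by move: tt' tT => /andP[_ /ltW h] /andP[_ h']; exact: le_trans h h'.
Qed.

End Error.

End Approximation.

(** * Limits along rapidly convergent sequences *)

Section GeometricSeries.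
Context (R : realType).

Definition half_pow (k : nat) : R := 2^-1 ^+ k.

Lemma half_pow_gt0 k : 0 < half_pow k.
Proof. by rewrite exprn_gt0. Qed.

Lemma half_powS k : half_pow k.+1 = half_pow k / 2.
Proof. by rewrite /half_pow exprSr. Qed.

Lemma half_pow_cvg0 (c : R) : c * half_pow k @[k --> \oo] --> (0 : R).
Proof.
rewrite -(mulr0 c); apply: cvgM; first exact: cvg_cst.
by apply: cvg_expr; rewrite ger0_norm// invf_lt1// ltr1n.
Qed.

Lemma nneseries_half_pow (c : R) (u : nat -> \bar R) : (forall k, 0 <= u k)%E ->
  (forall k, u k <= (c * half_pow k)%:E)%E -> (\sum_(0 <= k <oo) u k < +oo)%E.
Proof.
move=> u0 uc; apply: (@le_lt_trans _ _ (\sum_(0 <= k <oo) (c * half_pow k)%:E)%E).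
  by apply: lee_nneseries.
have -> : (fun n => \sum_(0 <= k < n) (c * half_pow k)%:E)%E =
    eseries (fun k => ((c * 2) / (2 ^ (k + 1))%:R)%:E).
  apply/funext => n; rewrite /eseries /=; apply: eq_bigr => k _; congr EFin.
  by rewrite addn1 expnSr natrM natrX /half_pow exprVn; field; rewrite expf_neq0.
by rewrite (cvg_lim _ (@cvg_geometric_eseries_half R (c * 2) 0)) ?ltry.
Qed.

(** [x n - 2 r half_pow n] increases and [x n + 2 r half_pow n] decreases; these envelopes give the
    limit and the rate together. *)
Lemma cvg_of_half_pow (x : nat -> R) (r : R) : 0 <= r ->
  (forall k, `|x k.+1 - x k| <= half_pow k * r) ->
  exists l : R, x n @[n --> \oo] --> l /\ forall n, `|x n - l| <= 2 * r * half_pow n.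
Proof.
move=> r0 hx.
have p0 n := half_pow_gt0 n.
pose a n := x n - 2 * r * half_pow n; pose b n := x n + 2 * r * half_pow n.
have step n : - (half_pow n * r) <= x n.+1 - x n <= half_pow n * r by rewrite -ler_norml.
have a_incr : nondecreasing_seq a.
  apply/nondecreasing_seqP => n; rewrite /a half_powS; have /andP[h1 h2] := step n.
  by move: (p0 n) h1 h2; set p := half_pow n; lra.
have Nb_incr : nondecreasing_seq (fun n => - b n).
  apply/nondecreasing_seqP => n; rewrite /b half_powS; have /andP[h1 h2] := step n.
  by move: (p0 n) h1 h2; set p := half_pow n; lra.
have ab n m : a n <= b m.
  have hab k : a k <= b k.
    have : 0 <= r * half_pow k by rewrite mulr_ge0// ltW.
    by rewrite /a /b -!mulrA; lra.
  have [nm|mn] := leqP n m; first exact: le_trans (a_incr _ _ nm) (hab m).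
  by apply: le_trans (hab n) _; rewrite -lerN2; exact: Nb_incr _ _ (ltnW mn).
have ca : cvgn a.
  by apply: nondecreasing_is_cvgn => //; exists (b 0%N) => _ [n _ <-]; exact: ab.
pose l := limn a; exists l.
have xl : x n @[n --> \oo] --> l.
  rewrite (_ : x = fun n => a n + 2 * r * half_pow n); last by apply/funext => n; rewrite /a subrK.
  by rewrite -(addr0 l); apply: cvgD; [exact: ca|exact: half_pow_cvg0].
split=> // n; rewrite ler_distl; apply/andP; split.
  have : l <= b n by apply: limr_le => //; apply: nearW => k; exact: ab.
  by rewrite /b; lra.
have : a n <= l by exact: nondecreasing_cvgn_le.
by rewrite /a; lra.
Qed.

End GeometricSeries.
Arguments half_pow {R}.

Section AlmostEverywhere.
Context (R : realType) (d : measure_display) (S : measurableType d)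
  (mu : {measure set S -> \bar R}).

Lemma ae_fin_integral (f : S -> \bar R) : (forall s, 0 <= f s)%E -> measurable_fun setT f ->
  (\int[mu]_s f s < +oo)%E -> {ae mu, forall s, f s \is a fin_num}.
Proof.
move=> f0 mf fi.
have int_f : mu.-integrable setT f.
  by apply/integrableP; split => //; under eq_integral do rewrite gee0_abs//.
by have := integrable_ae measurableT int_f; apply: filterS => s; exact.
Qed.

(** The sum over [n] has a finite integral, hence converges almost everywhere, and its terms tend to
    0 along the whole sequence. *)
Lemma ae_cvg0_integral (f : nat -> S -> \bar R) (c : R) : (forall n s, 0 <= f n s)%E ->
  (forall n, measurable_fun setT (f n)) ->
  (forall n, \int[mu]_s f n s <= (c * half_pow n)%:E)%E ->
  {ae mu, forall s, f n s @[n --> \oo] --> 0%E}.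
Proof.
move=> f0 mf fc.
have mser : measurable_fun setT (fun s => \sum_(0 <= n <oo) f n s)%E.
  by apply: ge0_emeasurable_sum => // n s _ _; exact: f0.
have hfin : (\int[mu]_s (\sum_(0 <= n <oo) f n s) < +oo)%E.
  rewrite integral_nneseries//; apply: nneseries_half_pow fc => n.
  exact: integral_ge0.
apply: filterS (ae_fin_integral _ mser hfin); last first.
  by move=> s; apply: nneseries_ge0 => n _ _; exact: f0.
move=> s fs.
have {}fs : (\sum_(0 <= n <oo) f n s < +oo)%E by rewrite ltey_eq fs.
have := nneseries_tail_cvg fs (fun n _ => f0 n s).
apply: squeeze_cvge; last exact: cvg_cst.
apply: nearW => N; rewrite f0 /=.
have := @nneseries_lim_ge R (fun n => f n s) xpredT N N.+1 (fun n _ _ => f0 n s).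
by rewrite big_nat1.
Qed.

Lemma borel_cantelli_near (A : nat -> set S) (c : R) : (forall n, measurable (A n)) ->
  (forall n, mu (A n) <= (c * half_pow n)%:E)%E ->
  {ae mu, forall s, \forall n \near \oo, ~ A n s}.
Proof.
move=> mA hA; exists (lim_sup_set A); split.
- by apply: bigcap_measurable => // k _; apply: bigcup_measurable => j _; exact: mA.
- by apply: lim_sup_set_cvg0 => //; apply: nneseries_half_pow hA.
- move=> s /= hs n _; apply: contrapT => hn; apply: hs; exists n => // k /= nk Ak.
  by apply: hn; exists k.
Qed.

End AlmostEverywhere.

Section AlmostEverywhereSwap.
Context (R : realType) (d1 d2 : measure_display) (S : measurableType d1) (W : measurableType d2)
  (m1 : {sigma_finite_measure set S -> \bar R}) (m2 : {sigma_finite_measure set W -> \bar R}).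

(** By Tonelli both statements say that the complement of [E] is null for the product measure.
    Stochastic integrals are identified for fixed [s] up to a P-null set, while the conclusions
    concern fixed [w]. *)
Lemma ae_swap (E : set (S * W)) : measurable E ->
  {ae m1, forall x, {ae m2, forall y, E (x, y)}} <-> {ae m2, forall y, {ae m1, forall x, E (x, y)}}.
Proof.
move=> mE; have mE' : measurable (~` E) by exact: measurableC.
pose f (z : S * W) : \bar R := (\1_(~` E) z)%:E.
have mf : measurable_fun setT f by apply/measurable_EFinP; exact: measurable_indic.
have f0 z : (0 <= f z)%E by rewrite lee_fin.
have fE z : f z = 0%E <-> E z.
  rewrite /f indicE; split => [[/eqP]|Ez].
    by rewrite pnatr_eq0 eqb0 => /negP h; apply: contrapT => nE; apply: h; rewrite inE.
  by rewrite memNset// => /(_ Ez).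
have hx x : {ae m2, forall y, E (x, y)} <-> (\int[m2]_y f (x, y) = 0)%E.
  have := ae_eq_integral_abs m2 measurableT (measurable_fun_pair2 x mf).
  under eq_integral do rewrite gee0_abs//.
  move=> [h1 h2]; split.
    by move=> hE; apply: h2; apply: filterS hE => y /fE h _.
  by move=> /h1; apply: filterS => y /(_ I)/fE.
have hy y : {ae m1, forall x, E (x, y)} <-> (\int[m1]_x f (x, y) = 0)%E.
  have := ae_eq_integral_abs m1 measurableT (measurable_fun_pair1 y mf).
  under eq_integral do rewrite gee0_abs//.
  move=> [h1 h2]; split.
    by move=> hE; apply: h2; apply: filterS hE => x /fE h _.
  by move=> /h1; apply: filterS => x /(_ I)/fE.
have HX : {ae m1, forall x, {ae m2, forall y, E (x, y)}} <-> (\int[m1]_x \int[m2]_y f (x, y) = 0)%E.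
  have := ae_eq_integral_abs m1 measurableT (measurable_fun_fubini_tonelli_F (m2 := m2) f mf f0).
  under eq_integral do rewrite gee0_abs ?integral_ge0//.
  move=> [h1 h2]; split.
    by move=> hE; apply: h2; apply: filterS hE => x /hx h _.
  by move=> /h1; apply: filterS => x /(_ I)/hx.
have HY : {ae m2, forall y, {ae m1, forall x, E (x, y)}} <-> (\int[m2]_y \int[m1]_x f (x, y) = 0)%E.
  have := ae_eq_integral_abs m2 measurableT (measurable_fun_fubini_tonelli_G (m1 := m1) f mf f0).
  under eq_integral do rewrite gee0_abs ?integral_ge0//.
  move=> [h1 h2]; split.
    by move=> hE; apply: h2; apply: filterS hE => y /hy h _.
  by move=> /h1; apply: filterS => y /(_ I)/hy.
by rewrite HX HY (fubini_tonelli (m1 := m1) (m2 := m2) f mf f0).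
Qed.

End AlmostEverywhereSwap.

Section L2Limit.
Context (R : realType) (d : measure_display) (S : measurableType d)
  (mu : {finite_measure set S -> \bar R}).

Lemma L2R_integrable (f : S -> R) : L2R mu f -> mu.-integrable setT (EFin \o f).
Proof.
move=> [mf f2]; apply/integrableP; split; first exact/measurable_EFinP.
have m2 : measurable_fun setT (fun s => (f s ^+ 2)%:E).
  by apply/measurable_EFinP; exact: measurable_funX.
apply: (@le_lt_trans _ _ (\int[mu]_s (1 + (f s ^+ 2)%:E))%E).
  apply: ge0_le_integral => //=.
  - by apply/measurable_EFinP; exact: measurableT_comp.
  - by apply: emeasurable_funD.
  - move=> s _; rewrite -EFinD lee_fin.
    have := sqr_ge0 (`|f s| - 1); rewrite sqrrB1 real_normK ?num_real//.
    by have := normr_ge0 (f s); lra.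
rewrite ge0_integralD//; last by move=> s _; rewrite lee_fin sqr_ge0.
apply: lte_add_pinfty => //; rewrite integral_cst// mul1e.
by rewrite ltey_eq fin_num_measure.
Qed.

(* [w = \sum_n 4^n (y_(n+1) - y_n)^2] is integrable and [`|y_n - z| <= 2 * 2^-n * sqrt w]. *)
Lemma L2_half_pow_limit (y : nat -> S -> R) (z : S -> R) :
  (forall n, L2R mu (y n)) -> measurable_fun setT z ->
  (forall s l, y n s @[n --> \oo] --> l -> z s = l) ->
  (forall n, \int[mu]_s ((y n.+1 s - y n s) ^+ 2)%:E <= (8^-1 ^+ n)%:E)%E ->
  [/\ {ae mu, forall s, y n s @[n --> \oo] --> z s}, L2R mu z &
    \int[mu]_s y n s @[n --> \oo] --> \int[mu]_s z s].
Proof.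
move=> l2y mz zlim hy.
have my n : measurable_fun setT (y n) by have [] := l2y n.
pose h n s := (4 ^+ n * (y n.+1 s - y n s) ^+ 2)%:E.
have h0 n s : (0 <= h n s)%E by rewrite lee_fin mulr_ge0 ?sqr_ge0// exprn_ge0.
have mh n : measurable_fun setT (h n).
  apply/measurable_EFinP; apply: measurable_funM; first exact: measurable_cst.
  by apply: measurable_funX; exact: measurable_funB.
pose w s := (\sum_(0 <= n <oo) h n s)%E.
have w0 s : (0 <= w s)%E by apply: nneseries_ge0 => n _ _; exact: h0.
have mw : measurable_fun setT w by apply: ge0_emeasurable_sum => // n s _ _; exact: h0.
have wfin : (\int[mu]_s w s < +oo)%E.
  rewrite integral_nneseries//; apply: (@nneseries_half_pow _ 1) => n; first exact: integral_ge0.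
  have -> : (\int[mu]_s h n s = (4 ^+ n)%:E * \int[mu]_s ((y n.+1 s - y n s) ^+ 2)%:E)%E.
    under eq_integral do rewrite /h EFinM.
    rewrite ge0_integralZl//.
      by apply/measurable_EFinP/measurable_funX; exact: measurable_funB.
    by move=> s _; rewrite lee_fin sqr_ge0.
  apply: (@le_trans _ _ ((4 ^+ n)%:E * (8^-1 ^+ n)%:E)%E).
    by apply: lee_wpmul2l; [rewrite lee_fin exprn_ge0|exact: hy].
  rewrite -EFinM -exprMn mul1r lee_fin /half_pow.
  by rewrite (_ : 4 * 8^-1 = 2^-1 :> R)//; field.
have dist : {ae mu, forall s, w s \is a fin_num /\ y n s @[n --> \oo] --> z s /\
    forall n, `|y n s - z s| <= 2 * Num.sqrt (fine (w s)) * half_pow n}.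
  apply: filterS (ae_fin_integral w0 mw wfin) => s ws; split => //.
  have [l [yl hl]] : exists l : R, y n s @[n --> \oo] --> l /\
      forall n, `|y n s - l| <= 2 * Num.sqrt (fine (w s)) * half_pow n.
    apply: cvg_of_half_pow; first exact: sqrtr_ge0.
    move=> k; have hw : (h k s <= w s)%E.
      have := @nneseries_lim_ge R (fun n => h n s) xpredT 0%N k.+1 (fun n _ _ => h0 n s).
      by apply: le_trans; rewrite big_nat_recr//= leeDr// sume_ge0.
    have {}hw : 4 ^+ k * (y k.+1 s - y k s) ^+ 2 <= fine (w s) by rewrite -lee_fin fineK.
    have p0 := half_pow_gt0 R k.
    rewrite -sqrtr_sqr -(gtr0_norm p0) -sqrtr_sqr -sqrtrM ?sqr_ge0// ler_wsqrtr//.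
    have -> : half_pow k ^+ 2 = (4 ^+ k)^-1 :> R.
      by rewrite /half_pow -exprM mulnC exprM -exprVn; congr (_ ^+ _); field.
    by rewrite ler_pdivlMl// exprn_gt0.
  by rewrite (zlim s l yl).
have cv : {ae mu, forall s, y n s @[n --> \oo] --> z s} by apply: filterS dist => s [_ []].
have l2z : L2R mu z.
  split => //.
  (* The distance bound at [n = 0] gives [(y 0 - z) ^ 2 <= 4 * w], hence
     [z ^ 2 <= 2 * (y 0) ^ 2 + 8 * w]. *)
  apply: (@le_lt_trans _ _ (\int[mu]_s (2%:E * (y 0%N s ^+ 2)%:E + 8%:E * w s))%E).
    apply: ae_ge0_le_integral => //.
    - by move=> s _; rewrite lee_fin sqr_ge0.
    - by apply/measurable_EFinP; exact: measurable_funX.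
    - by move=> s _; rewrite adde_ge0// mule_ge0// lee_fin sqr_ge0.
    - apply: emeasurable_funD; apply: measurable_funeM => //.
      by apply/measurable_EFinP; exact: measurable_funX.
    - apply: filterS dist => s [ws [_ /(_ 0%N)]] + _.
      rewrite /half_pow expr0 mulr1 => hs; rewrite -[w s]fineK// -!EFinM -EFinD lee_fin.
      have w0' : 0 <= fine (w s) by rewrite fine_ge0.
      have : (y 0%N s - z s) ^+ 2 <= 4 * fine (w s).
        rewrite -real_normK ?num_real//.
        have -> : 4 * fine (w s) = (2 * Num.sqrt (fine (w s))) ^+ 2.
          by rewrite exprMn sqr_sqrtr// -natrX.
        by rewrite lerXn2r ?nnegrE ?mulr_ge0 ?sqrtr_ge0.
      have := sqr_ge0 (2 * y 0%N s - z s).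
      by move: (y 0%N s) (z s) (fine (w s)) => a b c; nra.
  rewrite ge0_integralD//.
  - rewrite !ge0_integralZl//.
    + apply: lte_add_pinfty; apply: lte_mul_pinfty => //.
      by have [] := l2y 0%N.
    + by apply/measurable_EFinP; exact: measurable_funX.
    + by move=> s _; rewrite lee_fin sqr_ge0.
  - by move=> s _; rewrite mule_ge0// lee_fin sqr_ge0.
  - by apply: measurable_funeM; apply/measurable_EFinP; exact: measurable_funX.
  - by move=> s _; rewrite mule_ge0.
  - exact: measurable_funeM.
split => //.
pose K := (fine (\int[mu]_s (1 + w s))%E).
have Kfin : (\int[mu]_s (1 + w s) < +oo)%E.
  rewrite ge0_integralD//; apply: lte_add_pinfty => //; rewrite integral_cst// mul1e.
  by rewrite ltey_eq fin_num_measure.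
have Kfin' : (\int[mu]_s (1 + w s))%E \is a fin_num.
  by rewrite ge0_fin_numE// integral_ge0// => s _; rewrite adde_ge0.
have iz := L2R_integrable l2z.
have bound n : `|\int[mu]_s z s - \int[mu]_s y n s| <= 2 * K * half_pow n.
  have iy := L2R_integrable (l2y n).
  rewrite -RintegralB// (le_trans (le_normr_Rintegral _ _))//.
    by have := integrableB measurableT iz iy; apply: eq_integrable.
  rewrite /Rintegral -lee_fin fineK; last first.
    have := integrableB measurableT iz iy => /integrable_abse/integrable_fin_num.
    by move=> /(_ measurableT).
  have -> : (2 * K * half_pow n)%:E = (\int[mu]_s ((2 * half_pow n)%:E * (1 + w s)))%E.
    rewrite ge0_integralZl//.
    - by rewrite -[X in (_ * X)%E]fineK// -EFinM /K mulrAC.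
    - by apply: emeasurable_funD.
    - by move=> s _; rewrite adde_ge0.
    - by rewrite lee_fin mulr_ge0// ltW// half_pow_gt0.
  apply: ae_ge0_le_integral => //.
  - apply/measurable_EFinP; apply: measurableT_comp => //; exact: measurable_funB.
  - by move=> s _; rewrite mule_ge0// ?adde_ge0// lee_fin mulr_ge0// ltW// half_pow_gt0.
  - by apply: measurable_funeM; exact: emeasurable_funD.
  - apply: filterS dist => s [ws [_ /(_ n)]] hs _.
    rewrite -[w s]fineK// -EFinD -EFinM lee_fin distrC (le_trans hs)//.
    rewrite mulrAC ler_wpM2l//; first by rewrite mulr_ge0// ltW// half_pow_gt0.
    have w0' : 0 <= fine (w s) by rewrite fine_ge0.
    rewrite -{2}(sqr_sqrtr w0'); have := sqrtr_ge0 (fine (w s)).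
    by move: (Num.sqrt _) => x x0; nra.
apply/cvgrPdist_le => a a0.
have /cvgrPdist_le/(_ _ a0) := half_pow_cvg0 (2 * K).
apply: filterS => n; rewrite sub0r normrN; apply: le_trans.
by rewrite (le_trans (bound n))// ler_norm.
Qed.

End L2Limit.

(** * Convergence in probability *)

Section ConvergenceInProbability.
Context (R : realType) (d : measure_display) (Om : measurableType d) (P : probability Om R).
Implicit Types (Y Z : Om -> R).

Lemma measurable_dist_gt (X Y : Om -> R) (a : R) : measurable_fun setT X -> measurable_fun setT Y ->
  measurable [set w | a < `|X w - Y w|].
Proof.
move=> mX mY; rewrite (_ : [set w | _] = (fun w => `|X w - Y w|) @^-1` `]a, +oo[).
  rewrite -[_ @^-1` _]setTI.
  have : measurable_fun setT (fun w => `|X w - Y w|).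
    by apply: measurableT_comp => //; exact: measurable_funB.
  by apply.
by apply/seteqP; split => w /=; rewrite in_itv/= andbT.
Qed.

Lemma prob_dist_le (X Y Z : Om -> R) (a : R) : measurable_fun setT X -> measurable_fun setT Y ->
  measurable_fun setT Z ->
  fine (P [set w | a < `|X w - Z w|]) <=
  fine (P [set w | a / 2 < `|X w - Y w|]) + fine (P [set w | a / 2 < `|Y w - Z w|]).
Proof.
move=> mX mY mZ.
have m1 := measurable_dist_gt (a / 2) mX mY.
have m2 := measurable_dist_gt (a / 2) mY mZ.
have m3 := measurable_dist_gt a mX mZ.
have pf A : measurable A -> P A \is a fin_num by move=> mA; exact: fin_num_measure.
rewrite -fineD ?pf// fine_le//; [exact: pf|by rewrite fin_numD !pf|].
apply: (@le_trans _ _ (P ([set w | a / 2 < `|X w - Y w|] `|` [set w | a / 2 < `|Y w - Z w|]))).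
  apply: le_measure; rewrite ?inE//; first exact: measurableU.
  move=> w /= h; apply: contrapT => /not_orP[/negP + /negP]; rewrite -!leNgt => h1 h2.
  move: h; rewrite ltNge => /negP; apply.
  rewrite (_ : X w - Z w = (X w - Y w) + (Y w - Z w)); last by ring.
  by rewrite (le_trans (ler_normD _ _))// [leRHS]splitr lerD.
exact: measureU2.
Qed.

Lemma cvg_prob_fine (u : nat -> set Om) : (forall n, measurable (u n)) ->
  (forall a : R, 0 < a -> \forall n \near \oo, fine (P (u n)) <= a) ->
  P (u n) @[n --> \oo] --> 0%E.
Proof.
move=> mu h; have pf n : P (u n) \is a fin_num by exact: fin_num_measure.
apply/fine_cvgP; split; first by apply: nearW.
apply/cvgrPdist_le => a a0; apply: filterS (h a a0) => n hn.
by rewrite sub0r normrN ger0_norm// fine_ge0.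
Qed.

Lemma cvg_prob_ae (X : nat -> Om -> R) Z : (forall n, measurable_fun setT (X n)) ->
  measurable_fun setT Z -> {ae P, forall w, X n w @[n --> \oo] --> Z w} -> cvg_in_prob P X Z.
Proof.
move=> mX mZ XZ a a0.
pose A n := [set w | a < `|X n w - Z w|].
have mA n : measurable (A n) by exact: measurable_dist_gt.
have := @dominated_convergence _ _ R P setT measurableT (fun n w => (\1_(A n) w)%:E) (cst 0%E) (cst 1%E).
case.
- by move=> n; apply/measurable_EFinP; exact: measurable_indic.
- exact: measurable_cst.
- apply: filterS XZ => w XZ _; apply: cvg_near_cst.
  have /cvgrPdist_le/(_ _ a0) := XZ; apply: filterS => n; rewrite distrC => hn.
  by rewrite indicE memNset// => /(lt_le_trans); move=> /(_ _ hn); rewrite ltxx.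
- apply/integrableP; split; first exact: measurable_cst.
  under eq_integral do rewrite /= normr1.
  rewrite integral_cst// mul1e; apply: le_lt_trans (probability_le1 P measurableT) _.
  exact: ltry.
- by apply: aeW => w n _; rewrite gee0_abs ?lee_fin// indicE lern1; case: (_ \in _).
move=> _ _; rewrite integral_cst// mul0e => h.
rewrite (_ : (fun n => P (A n)) = fun n => \int[P]_w (\1_(A n) w)%:E)%E; first exact: h.
by apply/funext => n; rewrite integral_indic// setIT.
Qed.

Lemma cvg_prob_unique (X : nat -> Om -> R) Y Z : (forall n, measurable_fun setT (X n)) ->
  measurable_fun setT Y -> measurable_fun setT Z -> cvg_in_prob P X Y -> cvg_in_prob P X Z ->
  {ae P, forall w, Y w = Z w}.
Proof.
move=> mX mY mZ XY XZ.
have null (a : R) : 0 < a -> P [set w | a < `|Y w - Z w|] = 0%E.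
  move=> a0; have mA := measurable_dist_gt a mY mZ.
  have a2 : 0 < a / 2 by rewrite divr_gt0.
  rewrite -[LHS]fineK ?fin_num_measure//; congr EFin.
  apply/eqP; rewrite eq_le fine_ge0// andbT; apply/ler_addgt0Pl => b b0; rewrite addr0.
  have b2 : 0 < b / 2 by rewrite divr_gt0.
  have [n h1 h2] : exists2 n, (P [set w | (a / 2 < `|X n w - Y w|)%R] < (b / 2)%:E)%E &
      (P [set w | (a / 2 < `|X n w - Z w|)%R] < (b / 2)%:E)%E.
    have h : \forall n \near \oo, (P [set w | (a / 2 < `|X n w - Y w|)%R] < (b / 2)%:E)%E /\
      (P [set w | (a / 2 < `|X n w - Z w|)%R] < (b / 2)%:E)%E.
      apply: filterS2 (ereal_cvg0_near _ (XY _ a2) b2) (ereal_cvg0_near _ (XZ _ a2) b2).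
      by [].
    by have [n _ /(_ n (leqnn n))[]] := h; exists n.
  apply: (le_trans (prob_dist_le a mY (mX n) mZ)); rewrite (splitr b) lerD// -lee_fin.
    rewrite fineK; last by rewrite fin_num_measure//; exact: measurable_dist_gt.
    by under eq_set do rewrite distrC; exact: ltW.
  by rewrite fineK ?ltW//; rewrite fin_num_measure//; exact: measurable_dist_gt.
have : {ae P, forall w, forall n : nat, ~~ (n.+1%:R^-1 < `|Y w - Z w|)}.
  apply: ae_foralln => n; exists [set w | n.+1%:R^-1 < `|Y w - Z w|]; split.
  - exact: measurable_dist_gt.
  - by apply: null; rewrite invr_gt0.
  - by move=> w /= /negP; rewrite negbK.
apply: filterS => w hw; apply/eqP; rewrite -subr_eq0 -normr_le0 leNgt; apply/negP => h.
have [n] := ltr_add_invr h; rewrite add0r => hn.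
by move: (hw n); rewrite hn.
Qed.

End ConvergenceInProbability.

Lemma fine_le_EFin (R : realType) (x : \bar R) (c : R) : (0 <= x)%E -> (x <= c%:E)%E -> fine x <= c.
Proof. by case: x. Qed.

Lemma ge0_integral_le_double (R : realType) (d : measure_display) (S : measurableType d)
  (mu : {measure set S -> \bar R}) (D : set S) (f f1 f2 : S -> \bar R) : measurable D ->
  (forall s, 0 <= f s)%E -> (forall s, 0 <= f1 s)%E -> (forall s, 0 <= f2 s)%E ->
  measurable_fun D f -> measurable_fun D f1 -> measurable_fun D f2 ->
  (forall s, f s <= 2%:E * f1 s + 2%:E * f2 s)%E ->
  (\int[mu]_(s in D) f s <= 2%:E * \int[mu]_(s in D) f1 s + 2%:E * \int[mu]_(s in D) f2 s)%E.
Proof.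
move=> mD f0 g0 h0 mf mg mh fgh.
have m1 : measurable_fun D (fun s => 2%:E * f1 s)%E by exact: measurable_funeM.
have m2 : measurable_fun D (fun s => 2%:E * f2 s)%E by exact: measurable_funeM.
have p1 s : D s -> (0 <= 2%:E * f1 s)%E by move=> _; rewrite mule_ge0.
have p2 s : D s -> (0 <= 2%:E * f2 s)%E by move=> _; rewrite mule_ge0.
rewrite -!ge0_integralZl// -ge0_integralD//; apply: ge0_le_integral => //.
exact: emeasurable_funD.
Qed.

(** * Approximation of the stochastic integrals *)

Section StochasticIntegral.
Context (R : realType) (U : completeNormedModType R).
Context (d : measure_display) (Om : measurableType d) (P : probability Om R).
Context (L : R -> U -> Om -> R) (HL : cyl_levy P L) (T : R) (T0 : 0 < T).

Lemma prob_ae_eq (A B : set Om) : measurable A -> measurable B ->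
  {ae P, forall w, A w <-> B w} -> fine (P A) = fine (P B).
Proof.
move=> mA mB AB; rewrite -(Eindic P mA) -(Eindic P mB); apply: ae_eq_E.
- exact: bdd_meas_indic.
- exact: bdd_meas_indic.
apply: filterS AB => w [AB BA]; rewrite !indicE; congr (nat_of_bool _)%:R.
by apply/idP/idP; rewrite !inE.
Qed.

Lemma energy_sub_le (f f1 f2 : measurableTypeR R -> U) : borel_fun f -> borel_fun f1 -> borel_fun f2 ->
  (forall t, f t = f1 t - f2 t) -> (energy T f <= 2%:E * energy T f1 + 2%:E * energy T f2)%E.
Proof.
move=> bf b1 b2 fE; apply: ge0_integral_le_double => //;
  try by [move=> t; rewrite lee_fin sqr_ge0|exact: borel_norm2].
move=> t; rewrite -!EFinM -EFinD lee_fin fE.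
by have := sqr_norm_add_le (f1 t) (- f2 t); rewrite normrN.
Qed.

(** [psi] approximates [f] only in L^2(dt), while [stoch_int] is about every uniform approximation
    [phi]. The energy of [phi j - psi n] is small, and [step_int_prob] carries the limit of the
    integrals of [psi] over to those of [phi]. The squared error is dominated by a measurable [q],
    as [f] itself is not known to be measurable. *)
Lemma stoch_int_of_steps (f : R -> U) (psi : nat -> stepfun U) (q : nat -> R -> \bar R) (X : Om -> R) :
  (forall n, step_admissible T (psi n)) -> measurable_fun setT X ->
  (forall n, measurable_fun (`[0, T]%classic : set (measurableTypeR R)) (q n)) ->
  (forall n t, 0 <= t <= T -> ((`|step_eval (psi n) t - f t| ^+ 2)%:E <= q n t)%E) ->
  (\int[@lebesgue_measure R]_(t in `[0%R, T]) q n t)%E @[n --> \oo] --> 0%E ->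
  {ae P, forall w, step_int L (psi n) w @[n --> \oo] --> X w} ->
  stoch_int P L T f X.
Proof.
move=> adm mX mq fq q0 psiX; split => // phi admphi hphi e e0.
have mI n := measurable_step_int HL (adm n).
have mJ n := measurable_step_int HL (admphi n).
apply: cvg_prob_fine => [n|a a0]; first exact: measurable_dist_gt.
have e2 : 0 < e / 2 by rewrite divr_gt0.
have a4 : 0 < a / 4 by rewrite divr_gt0.
have [C C0 hC] := step_int_prob HL T0 a4 e2.
have C1 : 0 < C + 1 by rewrite ltr_wpDl.
(* The energy of the difference will be at most [4 * b], so that it costs at most [a / 2]; the two
   remaining terms are [a / 4] each. The [+ 1] guards against [C = 0]. *)
pose b := a / (8 * (C + 1)).
have b0 : 0 < b by rewrite divr_gt0// mulr_gt0.
have Cb : C * b <= a / 8.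
  have -> : C * b = a / 8 * (C / (C + 1)) by rewrite /b; field; rewrite gt_eqF.
  by rewrite ler_piMr ?divr_ge0 ?ltW// ltr_pdivrMr// mul1r ltrDl.
have [n h1 h2] : exists2 n, (P [set w | (e / 2 < `|step_int L (psi n) w - X w|)%R] < (a / 4)%:E)%E &
    (\int[@lebesgue_measure R]_(t in `[0%R, T]) q n t < b%:E)%E.
  have h : \forall n \near \oo, (P [set w | (e / 2 < `|step_int L (psi n) w - X w|)%R] < (a / 4)%:E)%E /\
      (\int[@lebesgue_measure R]_(t in `[0%R, T]) q n t < b%:E)%E.
    apply: filterS2 (ereal_cvg0_near _ (cvg_prob_ae mI mX psiX e2) a4) (ereal_cvg0_near _ q0 b0).
    by [].
  by have [n _ /(_ n (leqnn n))[]] := h; exists n.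
have bT : 0 < b / T by rewrite divr_gt0.
(* A uniform error [del] has energy at most [b] over [0, T]. *)
pose del := Num.sqrt (b / T).
have del0 : 0 < del by rewrite sqrtr_gt0.
apply: filterS (hphi del del0) => j hj.
pose D := step_add (phi j) (step_scale (-1) (psi n)).
have admD : step_admissible T D by apply: admissibleD => //; exact: admissibleZ.
have qn0 t : 0 <= t <= T -> (0 <= q n t)%E.
  by move=> /(fq n); apply: le_trans; rewrite lee_fin sqr_ge0.
have len : @lebesgue_measure R `[0, T]%classic = T%:E.
  by rewrite lebesgue_measure_itv /= lte_fin T0 oppr0 adde0.
have hD : fine (energy T (step_eval D)) <= 4 * b.
  apply: fine_le_EFin; first exact: energy_ge0.
  apply: (@le_trans _ _ (\int[@lebesgue_measure R]_(t in `[0%R, T])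
      ((2 * (b / T))%:E + 2%:E * q n t))%E).
    apply: ge0_le_integral => //.
    - by apply: borel_norm2; exact: borel_step.
    - by apply: emeasurable_funD => //; exact: measurable_funeM.
    - move=> t; rewrite /= in_itv /= => tT.
      apply: (@le_trans _ _ ((2 * (b / T))%:E + 2%:E * (`|step_eval (psi n) t - f t| ^+ 2)%:E)%E).
        rewrite -EFinM -EFinD lee_fin step_evalD step_evalZ scaleN1r.
        have := sqr_norm_add_le (step_eval (phi j) t - f t) (f t - step_eval (psi n) t).
        rewrite addrA subrK [`|f t - _|]distrC => /le_trans; apply.
        rewrite lerD2r ler_wpM2l// -(sqr_sqrtr (ltW bT)).
        by rewrite lerXn2r ?nnegrE ?(ltW del0)// ltW// hj.
      by rewrite leeD2l// lee_wpmul2l// fq.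
  rewrite ge0_integralD//; last 3 first.
  - by move=> t _; rewrite lee_fin mulr_ge0// ltW.
  - by move=> t; rewrite /= in_itv /= => tT; rewrite mule_ge0 ?qn0.
  - exact: measurable_funeM.
  rewrite integral_cst; last exact: measurable_itv.
  rewrite [X in (_ * X)%E](_ : _ = T%:E); last exact: len.
  rewrite ge0_integralZl//.
  apply: (@le_trans _ _ ((2 * (b / T))%:E * T%:E + 2%:E * b%:E)%E).
    by rewrite leeD2l// lee_wpmul2l// ltW.
  by rewrite -!EFinM -EFinD lee_fin -mulrA divfK ?gt_eqF//; lra.
have key : fine (P [set w | e / 2 < `|step_int L (phi j) w - step_int L (psi n) w|]) =
    fine (P [set w | e / 2 < `|step_int L D w|]).
  apply: prob_ae_eq; first exact: measurable_dist_gt.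
    by apply: measurable_gt_norm; exact: (measurable_step_int HL admD).
  apply: filterS (step_intZ HL (-1) (adm n)) => w hw /=.
  by rewrite step_intD hw mulN1r.
apply: (le_trans (prob_dist_le P e (mJ j) (mI n) mX)).
have {}h1 : fine (P [set w | e / 2 < `|step_int L (psi n) w - X w|]) <= a / 4.
  by apply: fine_le_EFin; [exact: measure_ge0|exact: ltW].
have := hC D admD; rewrite -key => h3.
have : C * fine (energy T (step_eval D)) <= C * (4 * b) by rewrite ler_wpM2l.
by move: h1 h3 Cb; lra.
Qed.

End StochasticIntegral.

Section CauchyIntegrands.
Context (R : realType) (U : completeNormedModType R) (ip : U -> U -> R) (e : nat -> U)
  (onb : hilbert_onb ip e).
Context (d : measure_display) (Om : measurableType d) (P : probability Om R).
Context (L : R -> U -> Om -> R) (HL : cyl_levy P L) (T : R) (T0 : 0 < T).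
Context (dS : measure_display) (S : measurableType dS) (eta : {finite_measure set S -> \bar R}).
Context (g : S -> R -> U) (mg : jointly_measurable T g) (rg : L2_regulated eta T g).

Let err G := (\int[@lebesgue_measure R]_(t in `[0%R, T]) slice_error eta T g G t)%E.

Lemma integrand_diff_energy G H : integrand_ok T G -> integrand_ok T H ->
  (\int[eta]_s energy T (step_eval (section_step (G ++ integrand_opp H) s)) <=
   2%:E * err H + 2%:E * err G)%E.
Proof.
move=> okG okH.
have okD : integrand_ok T (G ++ integrand_opp H).
  by apply: integrand_ok_cat => //; exact: integrand_ok_opp.
pose F s := energy T (step_eval (section_step (G ++ integrand_opp H) s)).
pose F1 s := energy T (fun t => zero_extend T g s t - step_eval (section_step H s) t).
pose F2 s := energy T (fun t => zero_extend T g s t - step_eval (section_step G s) t).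
have F0 s : (0 <= F s)%E by exact: energy_ge0.
have F10 s : (0 <= F1 s)%E by exact: energy_ge0.
have F20 s : (0 <= F2 s)%E by exact: energy_ge0.
have mF : measurable_fun setT F.
  exact: (section_measurable (fun psi => energy T (step_eval psi)) okD).
have mF1 : measurable_fun setT F1 by exact: measurable_section_energy.
have mF2 : measurable_fun setT F2 by exact: measurable_section_energy.
have FF s : (F s <= 2%:E * F1 s + 2%:E * F2 s)%E.
  apply: energy_sub_le.
  - exact: borel_step.
  - exact: borel_path_sub.
  - exact: borel_path_sub.
  - by move=> t; rewrite section_step_evalB opprB addrACA addrC subrKA addrC.
rewrite /err -(slice_error_tonelli eta mg okG) -(slice_error_tonelli eta mg okH).
exact: (ge0_integral_le_double eta measurableT F0 F10 F20 mF mF1 mF2 FF).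
Qed.

(* The error of [G k] is made small with respect to all the constants [C 0, ..., C k] of
   [pathwise_L2_prob], since both [G k] and [G k.+1] enter the [k]-th difference. *)
Lemma cauchy_integrands : exists G : nat -> seq (set S * (U * R * R)),
  [/\ forall n, integrand_ok T (G n), forall n, (err (G n) <= (half_pow n)%:E)%E &
    {ae P, forall w, \forall n \near \oo,
      (\int[eta]_s ((pathwise L (G n.+1) s w - pathwise L (G n) s w) ^+ 2)%:E <=
       (8^-1 ^+ n)%:E)%E}].
Proof.
have p0 k : 0 < half_pow k :> R := half_pow_gt0 R k.
have e0 k : 0 < (8^-1 : R) ^+ k by rewrite exprn_gt0.
have /choice[C hC] k : exists C : R, 0 <= C /\ forall G, integrand_ok T G ->
    fine (P [set w | ((8^-1 ^+ k)%:E < \int[eta]_s (pathwise L G s w ^+ 2)%:E)%E]) <=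
    half_pow k / 2 + C * fine (\int[eta]_s energy T (step_eval (section_step G s)))%E.
  have h0 : 0 < half_pow k / 2 :> R by rewrite divr_gt0.
  have [C C0 hC] := pathwise_L2_prob eta (hilbert_parallelogram onb) HL T0 h0 (e0 k).
  by exists C.
have C0 k : 0 <= C k by have [] := hC k.
(* The energy of the [k]-th difference becomes at most [half_pow k / (2 * (1 + C k))], which after
   multiplication by [C k] uses the second half of [half_pow k]. The [1 +] also gives [1 <= D k]. *)
pose D k := 8 * (1 + \sum_(i < k.+1) C i).
have D1 k : 1 <= D k.
  by have : 0 <= \sum_(i < k.+1) C i; [exact: sumr_ge0|rewrite /D; lra].
have D0 k : 0 < D k by exact: lt_le_trans (D1 k).
have /choice[G hG] k : exists G, integrand_ok T G /\ (err G <= (half_pow k / D k)%:E)%E.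
  by apply: integrand_approx => //; rewrite divr_gt0.
have okG k : integrand_ok T (G k) by have [] := hG k.
have errG k : (err (G k) <= (half_pow k / D k)%:E)%E by have [] := hG k.
exists G; split => // [k|].
  by apply: (le_trans (errG k)); rewrite lee_fin ler_pdivrMr// ler_peMr// ltW.
pose H k := G k.+1 ++ integrand_opp (G k).
have okH k : integrand_ok T (H k) by apply: integrand_ok_cat => //; exact: integrand_ok_opp.
pose A k := [set w | ((8^-1 ^+ k)%:E < \int[eta]_s (pathwise L (H k) s w ^+ 2)%:E)%E].
have mA k : measurable (A k).
  have mf : measurable_fun setT (fun z : S * Om => (pathwise L (H k) z.1 z.2 ^+ 2)%:E).
    have mp := measurable_pathwise HL (okH k).
    by apply/measurable_EFinP/measurable_funX; exact: mp.
  have f0 (z : S * Om) : (0 <= (pathwise L (H k) z.1 z.2 ^+ 2)%:E)%E by rewrite lee_fin sqr_ge0.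
  have mG := measurable_fun_fubini_tonelli_G (m1 := eta) _ mf f0.
  pose B : set (\bar R) := [set` `](8^-1 ^+ k)%:E, +oo[ ].
  have -> : A k = setT `&` fubini_G eta (fun z : S * Om => (pathwise L (H k) z.1 z.2 ^+ 2)%:E) @^-1` B.
    by rewrite setTI; apply/seteqP; split => w /=; rewrite /B /= in_itv /= andbT.
  by apply: mG => //; exact: emeasurable_itv.
have PA k : (P (A k) <= (1 * half_pow k)%:E)%E.
  rewrite mul1r -[P (A k)]fineK ?fin_num_measure// lee_fin.
  have [_ /(_ (H k) (okH k))] := hC k; move=> /le_trans; apply.
  rewrite [leRHS]splitr lerD2l.
  have hE : fine (\int[eta]_s energy T (step_eval (section_step (H k) s)))%E <=
      4 * (half_pow k / (8 * (1 + C k))).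
    apply: fine_le_EFin; first by apply: integral_ge0 => s _; exact: energy_ge0.
    apply: (le_trans (integrand_diff_energy (okG k.+1) (okG k))).
    have bnd i : (k <= i)%N -> half_pow i / D i <= half_pow k / (8 * (1 + C k)).
      move=> ki; apply: ler_pM => //; first exact: ltW.
      - by rewrite invr_ge0 ltW.
      - rewrite /half_pow; apply: ler_wiXn2l => //; first by rewrite invf_le1// ler1n.
      - rewrite lef_pV2 ?posrE ?D0 ?mulr_gt0 ?ltr_wpDr//.
        rewrite /D ler_pM2l// lerD2l (bigD1 (Ordinal (ki : (k < i.+1)%N)))//= lerDl.
        exact: sumr_ge0.
    apply: (@le_trans _ _ (2%:E * (half_pow k / (8 * (1 + C k)))%:E +
        2%:E * (half_pow k / (8 * (1 + C k)))%:E)%E).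
      apply: leeD; apply: lee_wpmul2l => //; apply: (le_trans (errG _)); rewrite lee_fin; exact: bnd.
    by rewrite -!EFinM -EFinD lee_fin; lra.
  have C1 : 0 < 1 + C k by rewrite ltr_wpDr.
  apply: (@le_trans _ _ (C k * (4 * (half_pow k / (8 * (1 + C k)))))); first by rewrite ler_wpM2l.
  have -> : C k * (4 * (half_pow k / (8 * (1 + C k)))) = half_pow k / 2 * (C k / (1 + C k)).
    by field; rewrite gt_eqF.
  rewrite ler_piMr ?divr_ge0 ?(ltW (p0 k))// ler_pdivrMr// mul1r lerDr//.
have bc := borel_cantelli_near mA PA.
have opp : {ae P, forall w, forall k s, pathwise L (integrand_opp (G k)) s w = - pathwise L (G k) s w}.
  by apply: ae_foralln => k; have := pathwise_opp HL (okG k).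
apply: filterS2 bc opp => w hw hopp; apply: filterS hw => k /= /negP; rewrite -leNgt.
rewrite (_ : (\int[eta]_s (pathwise L (H k) s w ^+ 2)%:E)%E =
  (\int[eta]_s ((pathwise L (G k.+1) s w - pathwise L (G k) s w) ^+ 2)%:E)%E)//.
by apply: eq_integral => s _; rewrite pathwise_cat hopp.
Qed.

End CauchyIntegrands.

(** * Identification of the limits and exchange of the integrals *)

Section Main.
Context (R : realType) (U : completeNormedModType R) (ip : U -> U -> R) (e : nat -> U)
  (onb : hilbert_onb ip e).
Context (d : measure_display) (Om : measurableType d) (P : probability Om R).
Context (L : R -> U -> Om -> R) (HL : cyl_levy P L) (T : R) (T0 : 0 < T).
Context (dS : measure_display) (S : measurableType dS) (eta : {finite_measure set S -> \bar R}).
Context (g : S -> R -> U) (mg : jointly_measurable T g).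

Lemma pathwise_L2R G w : integrand_ok T G -> L2R eta (fun s => pathwise L G s w).
Proof.
move=> okG.
have mz : measurable_fun setT (fun s => pathwise L G s w).
  exact: (measurable_fun_pair1 w (measurable_pathwise HL okG)).
split => //.
pose M := \sum_(q <- G) `|L q.2.2 q.2.1.1 w - L q.2.1.2 q.2.1.1 w|.
have bM s : `|pathwise L G s w| <= M.
  rewrite pathwiseE (le_trans (ler_norm_sum _ _ _))// ler_sum// => q _.
  by rewrite normrM ler_piMl// indicE normr_nat lern1; case: (_ \in _).
have M0 : 0 <= M by apply: sumr_ge0.
have /integrableP[_] : eta.-integrable setT (EFin \o (fun s => pathwise L G s w ^+ 2)).
  apply: (@bounded_integrable _ _ _ eta _ (M ^+ 2)); first exact: measurable_funX.
  by move=> s; rewrite normrX lerXn2r ?nnegrE.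
congr (_ < _)%E; apply: eq_integral => s _.
by rewrite /= ger0_norm ?sqr_ge0.
Qed.

(** [stoch_int] speaks about all uniformly convergent sequences of step functions; regularity of [f]
    supplies one, and limits in probability are unique. *)
Lemma stoch_int_unique (f : R -> U) (X Y : Om -> R) : regulated T f ->
  stoch_int P L T f X -> stoch_int P L T f Y -> {ae P, forall w, X w = Y w}.
Proof.
move=> rf [mX hX] [mY hY].
have /choice[phi hphi] n : exists phi, step_admissible T phi /\
    forall t, 0 <= t <= T -> `|step_eval phi t - f t| < half_pow n.
  by apply: regulated_step_approx => //; [exact: ltW|exact: half_pow_gt0].
have adm n : step_admissible T (phi n) by have [] := hphi n.
have unif (a : R) : 0 < a -> \forall n \near \oo,
    forall t, 0 <= t <= T -> `|step_eval (phi n) t - f t| < a.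
  move=> a0; have /cvgrPdist_lt/(_ _ a0) := half_pow_cvg0 (1 : R).
  apply: filterS => n; rewrite sub0r normrN mul1r gtr0_norm ?half_pow_gt0// => hn t tT.
  by apply: lt_trans hn; have [_] := hphi n; exact.
apply: (@cvg_prob_unique _ _ _ P (fun n => step_int L (phi n))) => //.
- by move=> n; exact: (measurable_step_int HL (adm n)).
- exact: hX.
- exact: hY.
Qed.

Variable G : nat -> seq (set S * (U * R * R)).
Hypothesis okG : forall n, integrand_ok T (G n).
Hypothesis errG : forall n, (\int[@lebesgue_measure R]_(t in `[0%R, T])
  slice_error eta T g (G n) t <= (half_pow n)%:E)%E.
Hypothesis cauchyG : {ae P, forall w, \forall n \near \oo,
  (\int[eta]_s ((pathwise L (G n.+1) s w - pathwise L (G n) s w) ^+ 2)%:E <=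
   (8^-1 ^+ n)%:E)%E}.

(* Unlike [limn], [limn_esup] preserves joint measurability without a convergence proviso. *)
Definition fine_limsup (u : nat -> R) : R := fine (limn_esup (fun n => (u n)%:E)).

Lemma fine_limsup_cvg (u : nat -> R) (l : R) : u n @[n --> \oo] --> l -> fine_limsup u = l.
Proof.
move=> ul; have ul' : (u n)%:E @[n --> \oo] --> l%:E by apply: cvg_EFin => //; exact: nearW.
by rewrite /fine_limsup (cvg_limn_einf_sup ul').2.
Qed.

Lemma measurable_fine_limsup (d' : measure_display) (X : measurableType d') (u : nat -> X -> R) :
  (forall n, measurable_fun setT (u n)) -> measurable_fun setT (fun x => fine_limsup (u ^~ x)).
Proof.
move=> mu; have : measurable_fun setT (fun x => limn_esup (fun n => (u n x)%:E)).
  by apply: (measurable_fun_limn_esup (f := fun n x => (u n x)%:E)) => n; exact/measurable_EFinP.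
by move=> mlim; apply: (measurableT_comp (f := fine)).
Qed.

Definition limit_version (s : S) (w : Om) : R := fine_limsup (fun n => pathwise L (G n) s w).

Definition limit_mean (w : Om) : R := fine_limsup (fun n => step_int L (mean_step eta (G n)) w).

Lemma measurable_limit_version : measurable_fun setT (fun z : S * Om => limit_version z.1 z.2).
Proof.
apply: (measurable_fine_limsup (u := fun n (z : S * Om) => pathwise L (G n) z.1 z.2)) => n.
exact: (measurable_pathwise HL (@okG n)).
Qed.

Lemma measurable_limit_mean : measurable_fun setT limit_mean.
Proof.
apply: (measurable_fine_limsup (u := fun n => step_int L (mean_step eta (G n)))) => n.
exact: (measurable_step_int HL (mean_admissible eta (@okG n))).
Qed.

Lemma limit_version_ae : {ae P, forall w,
  [/\ {ae eta, forall s, pathwise L (G n) s w @[n --> \oo] --> limit_version s w},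
      L2R eta (limit_version ^~ w),
      (\int[eta]_s (limit_version s w)%:E = (limit_mean w)%:E)%E &
      step_int L (mean_step eta (G n)) w @[n --> \oo] --> limit_mean w] }.
Proof.
have : {ae P, forall w, forall n,
    (\int[eta]_s (pathwise L (G n) s w)%:E = (step_int L (mean_step eta (G n)) w)%:E)%E}.
  apply: ae_foralln => n; have := pathwise_integral eta HL (@okG n).
  by apply: filterS => w [].
apply: filterS2 cauchyG => w [N _ hN] hI.
have m1 : measurable_fun setT (limit_version ^~ w).
  exact: (measurable_fun_pair1 w measurable_limit_version).
(* The bound of [cauchyG] starts at an index [N] that depends on [w], so the sequence is shifted by
   [N]; [8^-1 ^+ (n + N)] is at most [8^-1 ^+ n]. *)
have [cv l2 ri] : [/\ {ae eta, forall s, pathwise L (G (n + N)%N) s w @[n --> \oo] --> limit_version s w},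
    L2R eta (limit_version ^~ w) &
    \int[eta]_s pathwise L (G (n + N)%N) s w @[n --> \oo] --> \int[eta]_s limit_version s w].
  apply: L2_half_pow_limit => //.
  - by move=> n; exact: pathwise_L2R.
  - move=> s l; rewrite (cvg_shiftn N (fun n => pathwise L (G n) s w)).
    exact: fine_limsup_cvg.
  - move=> n; rewrite addSn; apply: (le_trans (hN _ (leq_addl _ _))).
    by rewrite lee_fin; apply: ler_wiXn2l; rewrite ?invr_ge0 ?invf_le1 ?ler1n ?leq_addr.
have ri' : step_int L (mean_step eta (G n)) w @[n --> \oo] --> \int[eta]_s limit_version s w.
  rewrite -(cvg_shiftn N (fun n => step_int L (mean_step eta (G n)) w)).
  rewrite (_ : (fun n => _) = fun n => \int[eta]_s pathwise L (G (n + N)%N) s w)//.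
  by apply/funext => n; rewrite /Rintegral hI.
have Zw : limit_mean w = \int[eta]_s limit_version s w by exact: fine_limsup_cvg.
split => //.
- by apply: filterS cv => s; rewrite (cvg_shiftn N (fun n => pathwise L (G n) s w)).
- rewrite Zw /Rintegral fineK//.
  by have := integrable_fin_num measurableT (L2R_integrable l2).
- by rewrite Zw.
Qed.

(** Convergence is encoded as the vanishing of an upper limit of distances, which is a measurable
    condition on the pair (s, w), so that [ae_swap] applies. *)
Lemma limit_version_cvg : {ae eta, forall s, {ae P, forall w,
  pathwise L (G n) s w @[n --> \oo] --> limit_version s w}}.
Proof.
pose u (z : S * Om) := limn_esup (fun n => (`|pathwise L (G n) z.1 z.2 - limit_version z.1 z.2|)%:E).
have mu : measurable_fun setT u.
  apply: (measurable_fun_limn_esup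
    (f := fun n (z : S * Om) => (`|pathwise L (G n) z.1 z.2 - limit_version z.1 z.2|)%:E)) => n.
  apply/measurable_EFinP; apply: measurableT_comp => //; apply: measurable_funB.
    exact: (measurable_pathwise HL (@okG n)).
  exact: measurable_limit_version.
pose E := [set z : S * Om | u z = 0%E].
have mE : measurable E.
  rewrite (_ : E = setT `&` u @^-1` [set 0%E]); first exact: mu.
  by rewrite setTI.
have EP s w : E (s, w) <-> pathwise L (G n) s w @[n --> \oo] --> limit_version s w.
  rewrite /E /u /=; split => [h|h].
    have h' : (`|pathwise L (G n) s w - limit_version s w|)%:E @[n --> \oo] --> 0%E.
      by apply: limn_esup_le_cvg; [rewrite h|move=> n; rewrite lee_fin].
    apply/cvgrPdist_lt => a a0; have FF : Filter (\oo : set_system nat) by typeclasses eauto.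
    have := ereal_cvg0_near FF h' a0.
    by apply: filterS => n /=; rewrite lte_fin distrC.
  have h' : (`|pathwise L (G n) s w - limit_version s w|)%:E @[n --> \oo] --> 0%E.
    apply: cvg_EFin; first exact: nearW.
    apply/cvgrPdist_lt => a a0; have /cvgrPdist_lt/(_ _ a0) := h.
    by apply: filterS => n; rewrite /= sub0r normrN normr_id distrC.
  by rewrite (cvg_limn_einf_sup h').2.
have : {ae P, forall w, {ae eta, forall s, E (s, w)}}.
  by apply: filterS limit_version_ae => w [+ _ _ _]; apply: filterS => s /EP.
move/(ae_swap eta P mE); apply: filterS => s; apply: filterS => w /EP.
by [].
Qed.

(** The path errors are summable in mean over [S], so for almost all [s] the sections of the [G n]
    converge to [g s] in L^2(dt), and the integrals of these sections converge almost surely. *)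
Lemma limit_version_meas_version : meas_version eta P L T g limit_version.
Proof.
split; first exact: measurable_limit_version.
have hsum := ae_cvg0_integral
  (f := fun n s => energy T (fun t => zero_extend T g s t - step_eval (section_step (G n) s) t)).
have {}hsum : {ae eta, forall s,
    energy T (fun t => zero_extend T g s t - step_eval (section_step (G n) s) t) @[n --> \oo] --> 0%E}.
  apply: (ae_cvg0_integral (c := 1)).
  - by move=> n s; exact: energy_ge0.
  - by move=> n; exact: measurable_section_energy.
  - by move=> n; rewrite slice_error_tonelli// mul1r.
apply: filterS2 hsum limit_version_cvg => s hs cs.
apply: (stoch_int_of_steps HL T0 (psi := fun n => section_step (G n) s)
  (q := fun n t => (`|zero_extend T g s t - step_eval (section_step (G n) s) t| ^+ 2)%:E)) => //.
- by move=> n; exact: section_admissible.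
- exact: (measurable_fun_pair2 s measurable_limit_version).
- by move=> n; apply: borel_norm2; exact: borel_path_sub.
- by move=> n t tT; rewrite /zero_extend tT distrC.
Qed.

(** The slice errors times [mass] provide the measurable majorant of the squared distance from
    [mean_step] to [m]. *)
Lemma limit_mean_stoch_int (m : R -> U) :
  (forall t, 0 <= t <= T -> bochner_integral eta (fun s => g s t) (m t)) ->
  stoch_int P L T m limit_mean.
Proof.
move=> hm.
apply: (stoch_int_of_steps HL T0 (psi := fun n => mean_step eta (G n))
  (q := fun n t => ((mass eta)%:E * slice_error eta T g (G n) t)%E)).
- by move=> n; exact: mean_admissible.
- exact: measurable_limit_mean.
- by move=> n; apply: measurable_funeM; apply: measurable_funTS; exact: measurable_slice_error.
- by move=> n t tT; exact: (mean_step_dist mg onb hm).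
- apply: (@squeeze_cvge _ _ _ _ (cst 0%E) _ (fun n => (mass eta * half_pow n)%:E)).
  + apply: nearW => n; apply/andP; split.
      apply: integral_ge0 => t _; rewrite mule_ge0 ?slice_error_ge0// lee_fin ltW//.
      exact: mass_gt0.
    rewrite ge0_integralZl//.
    * by rewrite EFinM lee_wpmul2l// lee_fin ltW// mass_gt0.
    * by apply: measurable_funTS; exact: measurable_slice_error.
    * by move=> t _; exact: slice_error_ge0.
    * by rewrite lee_fin ltW// mass_gt0.
  + exact: cvg_cst.
  + by apply: cvg_EFin; [exact: nearW|exact: half_pow_cvg0].
- by apply: filterS limit_version_ae => w [].
Qed.

Hypothesis reg : {ae eta, forall s, regulated T (g s)}.

(** For almost all [s], uniqueness of the stochastic integral identifies [Y s] with the version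
    already built, up to a P-null set depending on [s]. Joint measurability of both versions allows
    the swap, after which the integrals over [S] agree almost surely. *)
Lemma meas_version_ae (Y : S -> Om -> R) : meas_version eta P L T g Y ->
  {ae P, forall w, L2R eta (fun s => Y s w) /\ (\int[eta]_s (Y s w)%:E)%E = (limit_mean w)%:E}.
Proof.
move=> [mY hY]; have [mV hV] := limit_version_meas_version.
pose E := [set z : S * Om | Y z.1 z.2 - limit_version z.1 z.2 = 0].
have mE : measurable E.
  rewrite (_ : E = setT `&` (fun z : S * Om => Y z.1 z.2 - limit_version z.1 z.2) @^-1` [set 0]).
    by apply: measurable_funB.
  by rewrite setTI.
have : {ae eta, forall s, {ae P, forall w, E (s, w)}}.
  apply: filterS3 reg hY hV => s rs ys vs.
  by apply: filterS (stoch_int_unique rs ys vs) => w /= h; rewrite /E /= h subrr.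
move/(ae_swap eta P mE); apply: filterS2 limit_version_ae => w [_ [m2 v2] iv _] hE.
have {}hE : {ae eta, forall s, Y s w = limit_version s w}.
  by apply: filterS hE => s /= /eqP; rewrite subr_eq0 => /eqP.
have mYw : measurable_fun setT (Y ^~ w) by exact: (measurable_fun_pair1 w mY).
split; first split => //.
- rewrite (ae_eq_integral (fun s => (limit_version s w ^+ 2)%:E))//.
  + by apply/measurable_EFinP; exact: measurable_funX.
  + by apply/measurable_EFinP; exact: measurable_funX.
  + by apply: filterS hE => s -> _.
- rewrite -iv; apply: ae_eq_integral => //.
  + exact/measurable_EFinP.
  + exact/measurable_EFinP.
  + by apply: filterS hE => s -> _.
Qed.

End Main.

Theorem theorem3p1 (R : realType) (U : completeNormedModType R)
  (ip : U -> U -> R) (e : nat -> U) (HU : hilbert_onb ip e)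
  (dO : measure_display) (Om : measurableType dO) (P : probability Om R)
  (L : R -> U -> Om -> R) (HL : cyl_levy P L)
  (T : R) (HT : 0 < T)
  (dS : measure_display) (S : measurableType dS)
  (eta : {finite_measure set S -> \bar R})
  (g : S -> R -> U)
  (Ha : jointly_measurable T g)
  (Hb : {ae eta, forall s, regulated T (g s)})
  (Hc : L2_regulated eta T g) :
  (* (1) t |-> int_S g(s,t) eta(ds) (Bochner) is well defined and regulated *)
  exists m : R -> U,
    (forall t, 0 <= t <= T -> bochner_integral eta (fun s => g s t) (m t)) /\
    regulated T m /\
  (* int_0^T (int_S g(s,t) eta(ds)) dL(t) *)
  exists Z : Om -> R, stoch_int P L T m Z /\
  (* (2) an S (x) F-measurable version of (int_0^T g(s,t) dL(t))_s exists *)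
    (exists Y : S -> Om -> R, meas_version eta P L T g Y) /\
  (* for any such version: a.s. its paths lie in L^2_eta(S;R) and the
     Fubini identity holds *)
    (forall Y : S -> Om -> R, meas_version eta P L T g Y ->
      {ae P, forall w, L2R eta (fun s => Y s w) /\
         (\int[eta]_s (Y s w)%:E)%E = (Z w)%:E}).
Proof.
(* Outside [0, T] the value of [m] is immaterial: [regulated T m] and [stoch_int] see it on [0, T]
   only. *)
have /choice[m hm] t : exists v, 0 <= t <= T -> bochner_integral eta (fun s => g s t) v.
  have [tT|tT] := boolP (0 <= t <= T); last by exists 0.
  have [l2 _ _] := Hc.
  have bg : borel_fun (fun s => g s t).
    have := borel_slice Ha t; rewrite (_ : (fun s => zero_extend T g s t) = (fun s => g s t))//.
    by apply/funext => s; rewrite /zero_extend tT.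
  have [v hv] := bochner_exists HU bg (l2 t tT).
  by exists v.
have [G [okG errG cauchyG]] := cauchy_integrands HU HL HT Ha Hc.
exists m; split => //; split; first exact: (mean_regulated Ha Hc HU hm).
exists (limit_mean L eta G); split; first exact: (limit_mean_stoch_int HU HL HT Ha okG errG cauchyG hm).
split; first by exists (limit_version L G); have := limit_version_meas_version HL HT Ha okG errG cauchyG.
by move=> Y hY; exact: (meas_version_ae HL HT Ha okG errG cauchyG Hb hY).
Qed.
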